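(* Let $m\ge2$, $1<q<p<\infty$, $p_i\in(1,\infty)$ for $i\in\{1,\dots,m\}$, $\frac1p=\frac1{p_1}+\cdots+\frac1{p_m}$, and $k\in\mathbb{N}$. Let $T$ be an $m$-linear non-degenerate Calder\'on--Zygmund operator and let $b\in L^k_{\rm loc}(\mathbb{R}^n)$ be real-valued. If the iterated commutator $T^{(k)}_{b,1}$ is bounded from $L^{p_1}(\mathbb{R}^n)\times\cdots\times L^{p_m}(\mathbb{R}^n)$ to $L^q(\mathbb{R}^n)$, then $b\in\dot L^{kr}(\mathbb{R}^n)$ with $\frac1r:=\frac1q-\frac1p$.
   Context: Let $\Delta=\{(x,y_1,\dots,y_m):x=y_1=\cdots=y_m\}$. A multilinear Calder\'on--Zygmund kernel is $K:(\mathbb{R}^n)^{m+1}\setminus\Delta\to\mathbb{C}$ with $|K(x,y_1,\dots,y_m)|\le C(\sum_{i=1}^m|x-y_i|)^{-mn}$ and, whenever $h\in\mathbb{R}^n$ with $|h|\le\frac12\max_i|x-y_i|$, $|K(x+h,y_1,\dots,y_m)-K(x,y_1,\dots,y_m)|+\sum_{i=1}^m|K(x,y_1,\dots,y_i+h,\dots,y_m)-K(x,y_1,\dots,y_m)|\le \frac{C}{(\sum_i|x-y_i|)^{mn}}\omega\!\left(\frac{|h|}{\sum_i|x-y_i|}\right)$, with $\omega:[0,1)\to[0,\infty)$ increasing, $\omega(0)=0$, $\int_0^1\frac{\omega(t)}{t}dt<\infty$. An $m$-linear Calder\'on--Zygmund operator $T$ is an $m$-linear operator bounded from $L^{q_1}\times\cdots\times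 L^{q_m}$ to $L^{s}$ for some $q_i\in(1,\infty]$ with $\frac1s=\sum_i\frac1{q_i}\in(0,\infty)$, with a multilinear Calder\'on--Zygmund kernel $K$ such that $T(f_1,\dots,f_m)(x)=\int_{\mathbb{R}^{mn}}K(x,y_1,\dots,y_m)\prod_i f_i(y_i)\,dy$ for $f_i\in C_c^\infty$ and $x\notin\bigcap_i\operatorname{supp}f_i$. It is non-degenerate if moreover $\omega(t)\to0$ as $t\to0^+$ and there is $c_0>0$ such that for every $y\in\mathbb{R}^n$ and $\rho>0$ there exists $x$ with $|x-y|\ge\rho$ and $|K(x,y,\dots,y)|\ge\frac1{c_0\rho^{mn}}$. Iterated commutators: $T^{(1)}_{b,1}(f_1,\dots,f_m):=bT(f_1,\dots,f_m)-T(bf_1,f_2,\dots,f_m)$, and $T^{(k)}_{b,1}(f_1,\dots,f_m):=bT^{(k-1)}_{b,1}(f_1,\dots,f_m)-T^{(k-1)}_{b,1}(bf_1,f_2,\dots,f_m)$ for $k\ge2$. $\dot L^{s}(\mathbb{R}^n)$ is the set of $b\in L^{s}_{\rm loc}$ with $\inf_c\|b-c\|_{L^{s}}<\infty$.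
   Formalization: As b is only in L^k_loc, T(b^j f_1, f_2, ...) may be undefined; it is assumed in addition that the kernel formula for T holds a.e. outside the common support when f_1 is integrable with compact support and f_2, ..., f_m are in C_c^∞. *)

(* Defs.v *)
From HB Require Import structures.
From mathcomp Require Import all_boot all_order all_algebra.
From mathcomp Require Import all_classical all_reals all_analysis.
From mathcomp Require Import complex.
Import Order.TTheory GRing.Theory Num.Theory.

Set Implicit Arguments.
Unset Strict Implicit.
Unset Printing Implicit Defensive.

Local Open Scope ring_scope.
Local Open Scope classical_set_scope.

Section CZ.
Context {R : realType}.

(** * Euclidean space R^n, modelled as n-tuples of reals
    (with the product Borel sigma-algebra provided by mathcomp-analysis). *)
Definition vec (n : nat) := n.-tuple R.

Definition vadd n (x y : vec n) : vec n := [tuple tnth x j + tnth y j | j < n].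
Definition vsub n (x y : vec n) : vec n := [tuple tnth x j - tnth y j | j < n].
Definition vnorm n (x : vec n) : R := Num.sqrt (\sum_(j < n) tnth x j ^+ 2).

Definition cabs (z : R[i]) : R :=
  Num.sqrt (complex.Re z ^+ 2 + complex.Im z ^+ 2).
Definition toC (r : R) : R[i] := Complex r 0.

(** * Lebesgue integral of non-negative functions on R^n and on (R^n)^m,
    defined as the iterated one-dimensional Lebesgue integral (Tonelli). *)
Fixpoint iter_int (A : Type) (I : (A -> \bar R) -> \bar R) (m : nat)
  : (m.-tuple A -> \bar R) -> \bar R :=
  match m return (m.-tuple A -> \bar R) -> \bar R with
  | 0 => fun f => f [tuple]
  | m'.+1 => fun f => I (fun a => @iter_int A I m' (fun t => f (cons_tuple a t)))
  end.

Definition leb_int1 (g : R -> \bar R) : \bar R :=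
  (\int[lebesgue_measure]_x g x)%E.

Definition vint n (f : vec n -> \bar R) : \bar R := @iter_int R leb_int1 n f.
Definition vvint m n (f : m.-tuple (vec n) -> \bar R) : \bar R :=
  @iter_int (vec n) (@vint n) m f.

(** integral of a complex-valued (absolutely integrable) function on (R^n)^m,
    via positive and negative parts of real and imaginary parts *)
Definition rvvint m n (F : m.-tuple (vec n) -> R) : R :=
  fine (vvint (fun y => (Num.max (F y) 0)%:E)) -
  fine (vvint (fun y => (Num.max (- F y) 0)%:E)).
Definition cvvint m n (F : m.-tuple (vec n) -> R[i]) : R[i] :=
  Complex (rvvint (fun y => complex.Re (F y))) (rvvint (fun y => complex.Im (F y))).

Definition rmeas n (f : vec n -> R) : Prop := measurable_fun setT f.
Definition cmeas n (f : vec n -> R[i]) : Prop :=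
  rmeas (fun x => complex.Re (f x)) /\ rmeas (fun x => complex.Im (f x)).

Definition esssup n (f : vec n -> R[i]) : \bar R :=
  ereal_inf [set M%:E | M in [set M : R | 0 <= M /\
     vint (fun x : vec n => (if M < cabs (f x) then 1 else 0)%:E) = 0%E]].

Definition lnorm n (p : \bar R) (f : vec n -> R[i]) : \bar R :=
  match p with
  | r%:E => (vint (fun x => (cabs (f x) `^ r)%:E) `^ r^-1)%E
  | +oo%E => esssup f
  | -oo%E => 0%E
  end.

Definition inLp n (p : \bar R) (f : vec n -> R[i]) : Prop :=
  cmeas f /\ (lnorm p f < +oo)%E.

Definition einv (p : \bar R) : R :=
  match p with r%:E => r^-1 | _ => 0 end.

Definition Lloc n (s : R) (b : vec n -> R) : Prop :=
  rmeas b /\ forall rad : R, 0 < rad ->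
    (vint (fun x => (if vnorm x <= rad then `|b x| `^ s else 0)%:E) < +oo)%E.

(** homogeneous space: b in dot L^s iff inf_c ||b - c||_{L^s} < oo *)
Definition dotL n (s : R) (b : vec n -> R) : Prop :=
  exists c : R, inLp s%:E (fun x => toC (b x - c)).

Definition out_supp n (f : vec n -> R[i]) (x : vec n) : Prop :=
  exists2 d : R, 0 < d & forall y, vnorm (vsub y x) < d -> f y = 0.
Definition cpt_supp n (f : vec n -> R[i]) : Prop :=
  exists rad : R, forall y, rad < vnorm y -> f y = 0.

Definition rcont n (g : vec n -> R) : Prop :=
  forall x (e : R), 0 < e -> exists2 d : R, 0 < d &
    forall y, vnorm (vsub y x) < d -> `|g y - g x| < e.

Definition shift n (x : vec n) (i : 'I_n) (t : R) : vec n :=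
  [tuple (if j == i then tnth x j + t else tnth x j) | j < n].

Definition partial n (i : 'I_n) (g : vec n -> R) : vec n -> R :=
  fun x => derive1 (fun t : R => g (shift x i t)) 0.

Definition rsmooth n (g : vec n -> R) : Prop :=
  forall l : seq 'I_n, let h := foldr (@partial n) g l in
    rcont h /\ forall (i : 'I_n) (x : vec n), derivable (fun t : R => h (shift x i t)) 0 1.

Definition Ccinf n (f : vec n -> R[i]) : Prop :=
  rsmooth (fun x => complex.Re (f x)) /\ rsmooth (fun x => complex.Im (f x)) /\ cpt_supp f.

Definition ktuple m n := m.-tuple (vec n).
Definition op m n := ('I_m -> vec n -> R[i]) -> vec n -> R[i].

Definition upd m n (f : 'I_m -> vec n -> R[i]) (i : 'I_m) (g : vec n -> R[i]) :=
  fun j => if j == i then g else f j.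

Definition offdiag m n (x : vec n) (y : ktuple m n) : Prop :=
  exists i : 'I_m, tnth y i != x.

Definition ssum m n (x : vec n) (y : ktuple m n) : R :=
  \sum_(i < m) vnorm (vsub x (tnth y i)).
Definition smax m n (x : vec n) (y : ktuple m n) : R :=
  \big[Num.max/0]_(i < m) vnorm (vsub x (tnth y i)).

Definition yshift m n (y : ktuple m n) (i : 'I_m) (h : vec n) : ktuple m n :=
  [tuple (if j == i then vadd (tnth y j) h else tnth y j) | j < m].

Definition modulus (w : R -> R) : Prop :=
  (forall s t : R, 0 <= s -> s <= t -> t < 1 -> w s <= w t) /\
  w 0 = 0 /\
  (forall t : R, 0 <= t -> t < 1 -> 0 <= w t) /\
  (\int[lebesgue_measure]_(t in `[0%R, 1%R[) (w t / t)%:E < +oo)%E.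

Definition CZ_kernel m n (K : vec n -> ktuple m n -> R[i]) (w : R -> R) : Prop :=
  modulus w /\ exists C : R,
  (forall x y, offdiag x y -> cabs (K x y) <= C / ssum x y ^+ (m * n)) /\
  (forall x y (h : vec n), offdiag x y -> vnorm h <= smax x y / 2 ->
     cabs (K (vadd x h) y - K x y) + \sum_(i < m) cabs (K x (yshift y i h) - K x y)
       <= C / ssum x y ^+ (m * n) * w (vnorm h / ssum x y)).

Definition multilinear m n (T : op m n) : Prop :=
  forall (f : 'I_m -> vec n -> R[i]) (i : 'I_m) (a : R[i]) (g h : vec n -> R[i]) x,
    T (upd f i (fun y => a * g y + h y)) x = a * T (upd f i g) x + T (upd f i h) x.

Definition some_bounded m n (T : op m n) : Prop :=
  exists (q : 'I_m -> \bar R) (s : R),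
    (forall i, (1%:E < q i)%E) /\ 0 < s /\ s^-1 = \sum_(i < m) einv (q i) /\
    exists Cb : R, forall f : 'I_m -> vec n -> R[i],
      (forall i, inLp (q i) (f i)) ->
      inLp s%:E (T f) /\
      (lnorm s%:E (T f) <= Cb%:E * \prod_(i < m) lnorm (q i) (f i))%E.

Definition kernel_integral m n (K : vec n -> ktuple m n -> R[i])
  (f : 'I_m -> vec n -> R[i]) (x : vec n) : R[i] :=
  cvvint (fun y : ktuple m n => K x y * \prod_(i < m) f i (tnth y i)).

Definition kernel_repr m n (T : op m n) (K : vec n -> ktuple m n -> R[i]) : Prop :=
  forall f : 'I_m -> vec n -> R[i], (forall i, Ccinf (f i)) ->
    forall x, (exists i, out_supp (f i) x) -> T f x = kernel_integral K f x.

Definition CZO m n (T : op m n) (K : vec n -> ktuple m n -> R[i]) (w : R -> R) : Prop :=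
  multilinear T /\ some_bounded T /\ CZ_kernel K w /\ kernel_repr T K.

Definition nondegenerate_CZO m n (T : op m n) (K : vec n -> ktuple m n -> R[i])
  (w : R -> R) : Prop :=
  CZO T K w /\
  (w t @[t --> 0^'+] --> 0) /\
  exists2 c0 : R, 0 < c0 & forall (y : vec n) (rho : R), 0 < rho ->
    exists x : vec n, rho <= vnorm (vsub x y) /\
      1 / (c0 * rho ^+ (m * n)) <= cabs (K x [tuple y | _ < m]).

Definition bmul1 m n (b : vec n -> R) (f : 'I_m -> vec n -> R[i]) : 'I_m -> vec n -> R[i] :=
  fun j => if nat_of_ord j == 0%N then (fun y => toC (b y) * f j y) else f j.

Fixpoint commutator m n (k : nat) (T : op m n) (b : vec n -> R) : op m n :=
  match k with
  | 0 => T
  | k'.+1 => fun f x =>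
      toC (b x) * commutator k' T b f x - commutator k' T b (bmul1 b f) x
  end.

(** Extra standing convention: the off-support kernel
    representation of T is also valid (almost everywhere) when the first entry is a
    compactly supported integrable function (such as b^j f_1 with b in L^k_loc and
    f_1 in C_c^oo) and the other entries are in C_c^oo. *)
Definition kernel_repr_ext m n (T : op m n) (K : vec n -> ktuple m n -> R[i]) : Prop :=
  forall f : 'I_m -> vec n -> R[i],
    (forall i : 'I_m, nat_of_ord i = 0%N -> cmeas (f i) /\ cpt_supp (f i) /\ inLp 1%:E (f i)) ->
    (forall i : 'I_m, nat_of_ord i <> 0%N -> Ccinf (f i)) ->
    exists N : set (vec n), measurable N /\ vint (fun x => (\1_N x)%:E) = 0%E /\
      forall x, ~ N x -> (exists i, out_supp (f i) x) -> T f x = kernel_integral K f x.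

End CZ.

(* Main.v *)
(* Next to every cube Q, nondegeneracy and regularity of K provide a cube Q' of the same
   size on which, up to a constant phase, Re K is bounded below by a multiple of
   |Q|^(-m) when the other variables lie in Q.  If alpha is a median of b on Q', then
   b - alpha has a fixed sign on at least half of Q', so pairing the commutator with this
   half of Q' controls the integral of |b - alpha|^k over the part of Q where b - alpha
   has the opposite sign.  Testing on all cubes of a Carleson family at once, with signs
   that make the off-diagonal terms harmless, the Hoelder inequality and the Carleson
   embedding bound the sum of osc(Q)^r |Q| over the family, where osc(Q) is the mean of
   |b - alpha_Q|^k over Q.

   Conversely, in a dyadic cube Q_0 the stopping cubes, at which the mean deviation from
   the previous median doubles, form a Carleson family, and the dyadic averages of
   |b - alpha_(Q_0)|^k at x are dominated by the k-th power of the sum of osc(Q)^(1/k)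
   over the stopping cubes Q containing x.  The Carleson embedding with exponent k r
   bounds these averages in L^r uniformly in the level; letting the level tend to
   infinity gives an L^(k r) bound for b - alpha_(Q_0) on Q_0, independent of Q_0, and
   cubes exhausting the space then share a constant c. *)
Require Import Defs.
From HB Require Import structures.
From mathcomp Require Import all_boot all_order all_algebra.
From mathcomp Require Import all_classical all_reals all_analysis.
From mathcomp Require Import measurable_realfun measurable_fun_approximation lebesgue_integral_fubini.
From mathcomp Require Import complex lra ring zify.
Import Order.TTheory GRing.Theory Num.Theory.
Import numFieldNormedType.Exports.

Set Implicit Arguments.
Unset Strict Implicit.
Unset Printing Implicit Defensive.

Local Open Scope classical_set_scope.
Local Open Scope ring_scope.

(** * Tuple spaces as measure spaces *)

(** The bound is available for C_c^oo inputs only, while the natural tests are indicators of sets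
    cut out by a sign condition on b. They are approximated in L^1 with weight (1 + |b|)^k, which
    dominates |b x - b y|^k in y, so the error is linear in a parameter [eps] that goes to 0 once
    the smooth functions have left the inequality. Weights beta_Q enter slot i with exponent 1/p_i
    and the dual function with exponent 1/q', so both sides carry 1/q' + 1/p = 1 - 1/r. With beta_Q
    = osc(Q)^r the left side becomes the sum X to be bounded, and X <= const X^(1 - 1/r). The
    families are finite, so X is finite and the power can be divided out; this is why stopping cubes
    are collected up to a level N only, with constants independent of N. The reference cube Q' may
    lie at distance A times the size of Q, so packing must hold for dilated cubes, which are no
    longer nested. The embedding is therefore proved for arbitrary sets under a packing condition on
    the later sets that meet a given one. *)

Section tuple_measure.
Context d (T : measurableType d) (R : realType).
Variable mu : {sigma_finite_measure set T -> \bar R}.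

Definition tcons n (z : T * n.-tuple T) : n.+1.-tuple T := cons_tuple z.1 z.2.

Lemma measurable_tcons n : measurable_fun setT (@tcons n).
Proof. exact: measurable_cons. Qed.

Lemma measurable_tbehead n : measurable_fun setT (fun t : n.+1.-tuple T => behead_tuple t).
Proof. exact: measurable_behead. Qed.

Definition tuple_measure_succ n (nu : {sigma_finite_measure set (n.-tuple T) -> \bar R}) :
  set (n.+1.-tuple T) -> \bar R := pushforward (mu \x nu)%E (@tcons n).

Section succ.
Context n (nu : {sigma_finite_measure set (n.-tuple T) -> \bar R}).

Let pm : {measure set (n.+1.-tuple T) -> \bar R} :=
  measure_function_pushforward__canonical__measure_function_Measure
    (mu \x nu)%E (@measurable_tcons n).

HB.instance Definition _ := isMeasure.Build _ _ _ (tuple_measure_succ nu)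
  (measure0 pm) (measure_ge0 pm) (@measure_semi_sigma_additive _ _ _ pm).

Let sf : sigma_finite setT (tuple_measure_succ nu).
Proof.
have /sigma_finiteP[F [TF ndF Foo]] := sigma_finiteT mu.
have /sigma_finiteP[G [TG ndG Goo]] := sigma_finiteT nu.
(* [u] inverts [tcons], so exhausting rectangles of the product pull back to exhausting sets of
   tuples. *)
pose u (t : n.+1.-tuple T) := (thead t, behead_tuple t).
have mu' : measurable_fun setT u.
  apply/measurable_fun_pairP; split => /=.
    exact: (measurable_tnth (T := T) ord0).
  exact: measurable_tbehead.
exists (fun k => u @^-1` (F k `*` G k)).
  rewrite -preimage_bigcup -[LHS](preimage_setT u); congr preimage.
  rewrite -setXTT TF TG predeqE => -[x y]; split.
    move=> [/= [i _ Fnx] [k _ Gky]]; exists (maxn i k) => //; split.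
    - by move: x Fnx; exact/subsetPset/ndF/leq_maxl.
    - by move: y Gky; exact/subsetPset/ndG/leq_maxr.
  by move=> [i _ []/= ? ?]; split; exists i.
move=> k; have [mF ?] := Foo k; have [mG ?] := Goo k; split.
  by rewrite -[X in measurable X]setTI; apply: mu' => //; exact: measurableX.
rewrite /tuple_measure_succ /pushforward.
rewrite (_ : _ @^-1` _ = F k `*` G k) ?product_measure1E// ?lte_mul_pinfty// ?ge0_fin_numE//.
apply/seteqP; split => -[a t] /=; rewrite /u /= theadE;
  (suff -> : behead_tuple (cons_tuple a t) = t by []); exact/val_inj.
Qed.

HB.instance Definition _ := @Measure_isSigmaFinite.Build _ _ _ (tuple_measure_succ nu) sf.

End succ.

Let dirac_nil : set (0.-tuple T) -> \bar R := dirac [tuple].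
HB.instance Definition _ := Measure.on dirac_nil.
Let sfd : sigma_finite setT dirac_nil.
Proof.
apply: fin_num_fun_sigma_finite => //; first by rewrite measure0.
Qed.
HB.instance Definition _ := @Measure_isSigmaFinite.Build _ _ _ dirac_nil sfd.

Fixpoint tuple_measure n : {sigma_finite_measure set (n.-tuple T) -> \bar R} :=
  match n with
  | 0 => dirac_nil
  | n'.+1 => tuple_measure_succ (tuple_measure n')
  end.

Lemma integral_tuple0 (f : 0.-tuple T -> \bar R) : measurable_fun setT f ->
  (\int[tuple_measure 0]_x f x = f [tuple])%E.
Proof. by move=> mf; rewrite /= integral_dirac// diracT mul1e. Qed.

Lemma integral_tupleS n (f : n.+1.-tuple T -> \bar R) : measurable_fun setT f ->
  (forall x, 0 <= f x)%E ->
  (\int[tuple_measure n.+1]_x f x =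
   \int[mu]_a \int[tuple_measure n]_t f (cons_tuple a t))%E.
Proof.
move=> mf f0; rewrite [LHS](ge0_integral_pushforward (@measurable_tcons n))//.
rewrite fubini_tonelli1//; last by move=> x; exact: f0.
exact: measurableT_comp (@measurable_tcons n).
Qed.

(** [I] only has to agree with the integral on nonnegative measurable functions, so the lemma
    applies twice: with [leb_int1] to compute [vint], then with [vint] itself to compute [vvint]. *)
Lemma iter_intE (I : (T -> \bar R) -> \bar R)
  (hI : forall g, measurable_fun setT g -> (forall x, 0 <= g x)%E -> I g = (\int[mu]_x g x)%E) n
  (f : n.-tuple T -> \bar R) : measurable_fun setT f -> (forall x, 0 <= f x)%E ->
  iter_int I f = (\int[tuple_measure n]_x f x)%E.
Proof.
elim: n f => [|n IH] f mf f0; first by rewrite integral_tuple0.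
have mf' : measurable_fun setT (f \o @tcons n).
  exact: measurableT_comp (@measurable_tcons n).
rewrite integral_tupleS//= (_ : (fun a => _) =
   fun a => (\int[tuple_measure n]_t f (cons_tuple a t))%E); last first.
  apply/funext => a; apply: IH => //.
  exact: (measurableT_comp mf' (pair1_measurable a)).
rewrite hI//; last by move=> x; apply: integral_ge0.
by apply: (measurable_fun_fubini_tonelli_F (m2 := tuple_measure n) (f \o @tcons n)) => // x; exact: f0.
Qed.

Lemma measurable_prod_tnth n (g : 'I_n -> T -> R) :
  (forall i, measurable_fun setT (g i)) ->
  measurable_fun setT (fun t : n.-tuple T => \prod_(i < n) g i (tnth t i)).
Proof.
move=> mg; apply: measurable_prod => i _.
exact: (measurableT_comp (mg i) (measurable_tnth i)).
Qed.

Lemma integral_tuple_prod n (g : 'I_n -> T -> R) :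
  (forall i, measurable_fun setT (g i)) -> (forall i x, 0 <= g i x) ->
  (\int[tuple_measure n]_t (\prod_(i < n) g i (tnth t i))%:E =
   \prod_(i < n) \int[mu]_x (g i x)%:E)%E.
Proof.
elim: n g => [|n IH] g mg g0.
  rewrite integral_tuple0 ?big_ord0//.
  by apply/measurable_EFinP; exact: measurable_prod_tnth.
rewrite integral_tupleS//; last 2 first.
- by apply/measurable_EFinP; exact: measurable_prod_tnth.
- by move=> x; rewrite lee_fin; apply: prodr_ge0.
rewrite big_ord_recl -IH//.
set c := (\int[tuple_measure n]_t _)%E.
have c0 : (0 <= c)%E by apply: integral_ge0 => t _; rewrite lee_fin; apply: prodr_ge0.
rewrite -ge0_integralZr//; last 2 first.
- exact/measurable_EFinP.
- by move=> x _; rewrite lee_fin.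
apply: eq_integral => a _.
rewrite -ge0_integralZl//; last 3 first.
- by apply/measurable_EFinP; exact: (measurable_prod_tnth (g := fun i => g (lift ord0 i))).
- by move=> t _; rewrite lee_fin; apply: prodr_ge0.
- by rewrite lee_fin.
apply: eq_integral => t _; rewrite -EFinM big_ord_recl tnth0.
by congr (_ * _)%:E; apply: eq_bigr => i _; rewrite tnthS.
Qed.

End tuple_measure.

(** * Lebesgue measure on R^n and (R^n)^m as iterated integrals *)

Section lebesgue.
Context {R : realType}.

(* [lebesgue_measure] lives on [measurableTypeR R], whose sigma-algebra is only
   convertible to the canonical one of [R]. *)
Definition leb : set R -> \bar R :=
  pushforward (@lebesgue_measure R) (idfun : measurableTypeR R -> R).

Let mid : measurable_fun setT (idfun : measurableTypeR R -> R).
Proof. by move=> _ A mA; rewrite setTI. Qed.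

Let pm : {measure set R -> \bar R} :=
  measure_function_pushforward__canonical__measure_function_Measure
    (@lebesgue_measure R) mid.

HB.instance Definition _ := isMeasure.Build _ _ _ leb
  (measure0 pm) (measure_ge0 pm) (@measure_semi_sigma_additive _ _ _ pm).

Let sf : sigma_finite setT leb.
Proof. by have [F TF Foo] := sigma_finiteT (@lebesgue_measure R); exists F. Qed.

HB.instance Definition _ := @Measure_isSigmaFinite.Build _ _ _ leb sf.

Lemma leb_int1E (g : R -> \bar R) : measurable_fun setT g -> (forall x, 0 <= g x)%E ->
  leb_int1 g = (\int[leb]_x g x)%E.
Proof. by move=> mg g0; rewrite (ge0_integral_pushforward mid). Qed.

Definition mun n : {sigma_finite_measure set (n.-tuple R) -> \bar R} := tuple_measure leb n.
Definition muk m n : {sigma_finite_measure set (m.-tuple (n.-tuple R)) -> \bar R} :=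
  tuple_measure (mun n) m.

Lemma vintE n (f : vec n -> \bar R) : measurable_fun setT f -> (forall x, 0 <= f x)%E ->
  vint f = (\int[mun n]_x f x)%E.
Proof. by move=> mf f0; apply: iter_intE => // g mg g0; exact: leb_int1E. Qed.

Lemma vvintE m n (f : ktuple m n -> \bar R) : measurable_fun setT f -> (forall x, 0 <= f x)%E ->
  vvint f = (\int[muk m n]_x f x)%E.
Proof. by move=> mf f0; apply: iter_intE => // g mg g0; exact: vintE. Qed.

Lemma rvvintE m n (F : ktuple m n -> R) : (muk m n).-integrable setT (EFin \o F) ->
  rvvint F = Rintegral (muk m n) setT F.
Proof.
move=> iF; have mF : measurable_fun setT F by apply/measurable_EFinP; exact: measurable_int iF.
rewrite /rvvint !vvintE; try by move=> x; rewrite lee_fin le_max lexx orbT.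
2,3: by apply/measurable_EFinP; apply: measurable_maxr => //; exact: measurableT_comp.
have [ip im] : ((\int[muk m n]_x (EFin \o F)^\+ x)%E \is a fin_num) /\
   ((\int[muk m n]_x (EFin \o F)^\- x)%E \is a fin_num).
  by split; [apply: integrable_pos_fin_num|apply: integrable_neg_fin_num].
rewrite /Rintegral [in RHS]integralE [RHS]fineB//.
congr (_ - _); congr fine; apply: eq_integral => x _.
  by rewrite funeposE EFin_max.
by rewrite funenegE EFin_max.
Qed.

Definition cube n (z : vec n) (d : R) : set (vec n) :=
  [set x | forall i, `|tnth x i - tnth z i| < d].

Lemma cubeE n (z : vec n) (d : R) : 
  (\1_(cube z d) : vec n -> R) = fun x => \prod_(i < n) \1_(ball (tnth z i) d) (tnth x i).
Proof.
apply/funext => x; rewrite indicE; case: (boolP (x \in _)) => [|/negP] xz.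
  rewrite big1// => i _; rewrite indicE mem_set//.
  by move: xz; rewrite inE => /(_ i); rewrite distrC.
apply/esym/eqP; rewrite prodf_seq_eq0; apply/hasP.
have [i /negP Hi] : exists i, ~ `|tnth x i - tnth z i| < d.
  by apply/existsNP => H; apply: xz; rewrite inE.
exists i; first by rewrite mem_index_enum.
by rewrite /= indicE memNset// /ball/= distrC; exact/negP.
Qed.

Lemma measurable_cube n (z : vec n) d : measurable (cube z d).
Proof.
rewrite (_ : cube z d = \bigcap_(i in [set: 'I_n]) (fun x => tnth x i) @^-1` ball (tnth z i) d).
  apply: fin_bigcap_measurable => // i _.
  rewrite -[X in measurable X]setTI; apply: measurable_tnth => //.
  exact: measurable_ball.
apply/seteqP; split => x /= H i; first by move=> _; rewrite /ball/= distrC.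
by have := H i I; rewrite /ball/= distrC.
Qed.

Lemma mun_cube n (z : vec n) d : 0 < d -> mun n (cube z d) = ((2 * d) ^+ n)%:E.
Proof.
move=> d0; have mc := measurable_cube z d.
have -> : mun n (cube z d) = (\int[mun n]_x (\1_(cube z d) x)%:E)%E.
  by rewrite integral_indic// setIT.
have E i : (\int[leb]_x (\1_(ball (tnth z i) d) x)%:E)%E = (2 * d)%:E.
  rewrite integral_indic// ?setIT; last exact: measurable_ball.
  by rewrite [LHS](lebesgue_measure_ball _ (ltW d0)) mulr_natl.
rewrite cubeE (integral_tuple_prod leb (g := fun i x => \1_(ball (tnth z i) d) x)).
- under eq_bigr => i _ do rewrite E.
  by rewrite prodEFin prodr_const card_ord.
- by move=> i; apply: measurable_indic; exact: measurable_ball.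
- by move=> i x; rewrite indicE.
Qed.

Lemma mun_cube_lty n (z : vec n) d : 0 < d -> (mun n (cube z d) < +oo)%E.
Proof. by move=> d0; rewrite mun_cube// ltry. Qed.

Lemma Rintegral_cube n (z : vec n) d : 0 < d ->
  Rintegral (mun n) setT (\1_(cube z d) : n.-tuple R -> R) = (2 * d) ^+ n.
Proof.
move=> d0; rewrite /Rintegral integral_indic//; last exact: measurable_cube.
by rewrite setIT [X in fine X](mun_cube z d0).
Qed.

End lebesgue.

(** * Smooth functions *)

Section flat.
Context {R : realType}.

(** The factor [x^-1 ^+ l] makes the family closed under differentiation: the derivative of [flat l]
    is a combination of [flat l.+1] and [flat l.+2]. *)
Definition flat (l : nat) (x : R) : R :=
  if 0 < x then x^-1 ^+ l * expR (- x^-1) else 0.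

Lemma flat_ge0 l x : 0 <= flat l x.
Proof.
rewrite /flat; case: ifPn => // x0.
by rewrite mulr_ge0 ?expR_ge0// exprn_ge0// invr_ge0 ltW.
Qed.

Lemma flat0_le1 x : flat 0 x <= 1.
Proof.
rewrite /flat; case: ifPn => // x0; rewrite expr0 mul1r -expR0 ler_expR.
by rewrite oppr_le0 invr_ge0 ltW.
Qed.

(** Read as flat l x - flat l 0 = flat (l+1) x * (x - 0), this is the Caratheodory form of
    differentiability at the origin. *)
Lemma flatS l x : flat l x = flat l.+1 x * x.
Proof.
rewrite /flat; case: ifPn => x0; last by rewrite mul0r.
by rewrite exprSr -!mulrA; congr (_ * _); rewrite mulrCA mulVf ?mulr1 ?gt_eqF.
Qed.

(** The exponential series gives e^y >= y^(l+1) / (l+1)! at y = 1/x. The resulting linear bound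
    yields continuity at 0. *)
Lemma flat_le l x : flat l x <= (l.+1)`!%:R * `|x|.
Proof.
rewrite /flat; case: ifPn => x0; last by rewrite mulr_ge0.
rewrite expRN gtr0_norm// ler_pdivrMr ?expR_gt0//.
have := @expR_ge1Dxn R x^-1 l; rewrite invr_ge0 => /(_ (ltW x0)) H.
have f0 : (0 : R) < (l.+1)`!%:R by rewrite ltr0n fact_gt0.
have : x^-1 ^+ l.+1 / (l.+1)`!%:R <= expR x^-1 by apply: le_trans H; rewrite lerDr.
rewrite ler_pdivrMr// => H2.
apply: (@le_trans _ _ (x * (x^-1 ^+ l.+1))).
  by rewrite exprS mulrA mulfV ?gt_eqF// mul1r.
by rewrite mulrAC (mulrC (_`!%:R)) [leRHS]mulrC ler_pM2l.
Qed.

Lemma flat_pos l x : 0 < x -> flat l x = x^-1 ^+ l * expR (- x^-1).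
Proof. by rewrite /flat => ->. Qed.

Lemma flat_at0 l : flat l 0 = 0.
Proof. by rewrite /flat ltxx. Qed.

Lemma flat_continuous0 l : {for 0, continuous (flat l)}.
Proof.
suff : flat l x @[x --> (0 : R)] --> (0 : R) by rewrite -{2}(flat_at0 l).
apply: (@squeeze_cvgr _ _ _ _ (cst 0) (fun x => (l.+1)`!%:R * `|x|)).
- by near=> x; rewrite flat_ge0 flat_le.
- exact: cvg_cst.
- rewrite -[X in _ --> X](mulr0 (l.+1)`!%:R); apply: cvgMr.
  by have := @norm_continuous _ R (0 : R); rewrite /continuous_at normr0.
Unshelve. all: by end_near. Qed.

Lemma is_derive_flat (l : nat) (x : R) :
  is_derive x 1 (flat l) (- l%:R * flat l.+1 x + flat l.+2 x).
Proof.
have [x0|x0|->] := ltgtP x 0.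
- rewrite /flat !ltNge !ltW//= mulr0 addr0.
  have : is_derive x 1 (cst 0 : R -> R) 0 by exact: is_derive_cst.
  apply: near_eq_is_derive.
  near=> y; rewrite ltNge ltW//=; near: y.
  exact: lt_nbhsl.
- have xn0 : x != 0 by rewrite gt_eqF.
  have h : is_derive x 1 (fun y : R => y^-1 ^+ l * expR (- y^-1))
     (- l%:R * flat l.+1 x + flat l.+2 x).
    have hV : is_derive x 1 (fun y : R => y^-1) (- x ^- 2).
      have := @is_deriveV R id x 1 1 xn0 (is_derive_id x 1).
      by rewrite /GRing.scale/= mulr1.
    have hE : is_derive x 1 (fun y : R => expR (- y^-1)) (x^-1 ^+ 2 * expR (- x^-1)).
      have hN : is_derive x 1 (fun y : R => - y^-1) (x^-1 ^+ 2).
        by apply: is_derive_eq; rewrite opprK exprVn.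
      have := @is_derive1_comp _ expR (fun y : R => - y^-1) x _ _ (is_derive_expR _) hN.
      by rewrite mulrC.
    have hX : is_derive x 1 (fun y : R => y^-1 ^+ l) (- l%:R * x^-1 ^+ l.+1).
      have := @is_deriveX _ _ (fun y : R => y^-1) l x 1 _ hV; rewrite exprfctE => h.
      apply: (is_derive_eq h); rewrite /GRing.scale/=.
      case: l {h} => [|l]; first by rewrite !mul0r oppr0 mul0r.
      rewrite /= mulrN mulNr; congr (- _); rewrite -!mulrA; congr (_ * _).
      by rewrite -exprVn -exprD addn2.
    have := @is_deriveM _ _ _ _ x 1 _ _ hX hE => h.
    apply: (is_derive_eq h).
    rewrite /flat x0 /GRing.scale/=; rewrite !exprS; ring.
  apply: near_eq_is_derive h.
  near=> y; rewrite /flat ifT//; near: y.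
  exact: lt_nbhsr.
- apply/is_derive1_caratheodory; exists (flat l.+1); split.
  + by move=> z; rewrite flat_at0 !subr0 -flatS.
  + exact: flat_continuous0.
  + by rewrite !flat_at0 mulr0 addr0.
Unshelve. all: by end_near. Qed.

Lemma flat_continuous l : continuous (flat l).
Proof.
move=> x; apply: differentiable_continuous; apply/derivable1_diffP.
by have [] := is_derive_flat l x.
Qed.

Lemma measurable_flat l : measurable_fun setT (flat l).
Proof. exact: continuous_measurable_fun (@flat_continuous l). Qed.

(* dilations of [flat 0] converge to the indicator of the positive half-line *)
Lemma cvg_flat0 x : flat 0 (N%:R * x) @[N --> \oo] --> ((0 < x)%R%:R : R).
Proof.
case: ltP => x0; last first.
  apply: cvg_near_cst; near=> N; apply/eqP.
  by rewrite /flat ltNge mulr_ge0_le0.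
rewrite [X in _ --> X](_ : _ = expR 0); last by rewrite expR0.
apply: (@cvg_trans _ ((fun N => expR (- (N%:R * x)^-1)) @ \oo)).
  apply: near_eq_cvg; near=> N; rewrite flat_pos ?expr0 ?mul1r//.
  by rewrite mulr_gt0// ltr0n; near: N; exists 1%N.
have h : (fun N : nat => - (N%:R * x)^-1) @ \oo --> (0 : R).
  under eq_fun do rewrite invfM.
  rewrite -oppr0 -(mul0r x^-1); apply: cvgN; apply: cvgMl.
  apply/(@gtr0_cvgV0 _ _ _ _ (fun N : nat => N%:R : R)); first by near=> N; rewrite ltr0n; near: N; exists 1%N.
  exact: cvgr_idn.
by apply: continuous_cvg h; exact: continuous_expR.
Unshelve. all: by end_near. Qed.

End flat.

Section smooth.
Context {R : realType} (n : nat).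
Notation V := (n.-tuple R).

(* A class stable under partial derivatives that contains enough bump functions. *)
Inductive elem_smooth : (V -> R) -> Prop :=
| elem_smooth_cst (c : R) : elem_smooth (fun=> c)
| elem_smooth_flat l i (c a : R) : elem_smooth (fun x => flat l (c * (tnth x i - a)))
| elem_smoothD f g : elem_smooth f -> elem_smooth g -> elem_smooth (fun x => f x + g x)
| elem_smoothM f g : elem_smooth f -> elem_smooth g -> elem_smooth (fun x => f x * g x).

Lemma elem_smooth_measurable f : elem_smooth f -> measurable_fun setT f.
Proof.
elim=> [c|l i c a|u v _ mu _ mv|u v _ mu _ mv].
- exact: measurable_cst.
- apply: (measurableT_comp (@measurable_flat R l)).
  apply: measurable_funM => //; apply: measurable_funB => //.
  exact: measurable_tnth.
- exact: measurable_funD.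
- exact: measurable_funM.
Qed.

(** [rcont] is phrased with [vnorm]; as a filter, its neighbourhoods give access to the limit
    theorems for sums and products. *)
Definition vnbhs (x : V) : set_system V :=
  [set A | exists2 d : R, 0 < d & forall y, vnorm (vsub y x) < d -> A y].

Instance vnbhs_filter x : Filter (vnbhs x).
Proof.
split.
- by exists 1.
- move=> P Q [d d0 dP] [e e0 eQ]; exists (Num.min d e); first by rewrite lt_min d0.
  by move=> y; rewrite lt_min => /andP[yd ye]; split; [exact: dP|exact: eQ].
- by move=> P Q PQ [d d0 dP]; exists d => // y yd; apply/PQ/dP.
Qed.

Lemma vnorm_coord (x : V) i : `|tnth x i| <= vnorm x.
Proof.
rewrite -sqrtr_sqr /vnorm; apply: ler_wsqrtr.
by rewrite (bigD1 i)//= lerDl sumr_ge0// => j _; exact: sqr_ge0.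
Qed.

Lemma rcontP (f : V -> R) : (forall x, f y @[y --> vnbhs x] --> f x) -> rcont f.
Proof.
move=> H x e e0; have /cvgrPdist_lt/(_ e e0)[d d0 Hd] := H x.
by exists d => // y /Hd; rewrite distrC.
Qed.

Lemma elem_smooth_cvg f : elem_smooth f -> forall x, f y @[y --> vnbhs x] --> f x.
Proof.
elim=> [c|l i c a|u v _ mu _ mv|u v _ mu _ mv] x.
- exact: cvg_cst.
- apply: continuous_cvg; first exact: flat_continuous.
  apply: cvgMr; apply: cvgB; last exact: cvg_cst.
  apply/cvgrPdist_lt => e e0; exists e => // y; apply: le_lt_trans.
  apply: le_trans (vnorm_coord _ i); rewrite tnth_mktuple distrC//.
- exact: cvgD.
- exact: cvgM.
Qed.

Lemma elem_smooth_derive f (i : 'I_n) : elem_smooth f -> exists2 g, elem_smooth g &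
  forall x : V, is_derive (0 : R) 1 (fun t : R => f (Defs.shift x i t)) (g x).
Proof.
have sh0 (x : V) : Defs.shift x i 0 = x.
  by apply: eq_from_tnth => j; rewrite tnth_mktuple addr0 if_same.
elim=> [c|l j c a|u v su [u' su' hu] sv [v' sv' hv]|u v su [u' su' hu] sv [v' sv' hv]].
- by exists (fun=> 0); [exact: elem_smooth_cst|move=> x; exact: is_derive_cst].
- have [->|ij] := eqVneq i j; last first.
    exists (fun=> 0); first exact: elem_smooth_cst.
    move=> x; under eq_fun do rewrite tnth_mktuple eq_sym (negbTE ij).
    exact: is_derive_cst.
  exists (fun x => c * (- l%:R * flat l.+1 (c * (tnth x j - a)) +
                        flat l.+2 (c * (tnth x j - a)))).
    apply: elem_smoothM; first exact: elem_smooth_cst.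
    apply: elem_smoothD; last exact: elem_smooth_flat.
    by apply: elem_smoothM; [exact: elem_smooth_cst|exact: elem_smooth_flat].
  move=> x; under eq_fun do rewrite tnth_mktuple eqxx.
  have h : is_derive (0 : R) 1 (fun t : R => c * (tnth x j + t - a)) c.
    rewrite (_ : (fun t => _) = (fun t => c *: (t + (tnth x j - a)))); last first.
      by apply/funext => t; rewrite /GRing.scale/=; ring.
    by apply: is_derive_eq; rewrite addr0 /GRing.scale/= mulr1.
  have := @is_derive1_comp _ (flat l) _ _ _ _ (is_derive_flat _ _) h.
  by rewrite addr0 mulrC.
- exists (fun x => u' x + v' x); first exact: elem_smoothD.
  by move=> x; have := hu x; have := hv x => hv1 hu1; exact: is_deriveD.
- exists (fun x => u x * v' x + v x * u' x).
    by apply: elem_smoothD; exact: elem_smoothM.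
  move=> x; have := is_deriveM (hu x) (hv x); rewrite sh0; exact.
Qed.

(** The class survives every partial derivative, so continuity and derivability need only be known
    for its members. *)
Lemma elem_smooth_rsmooth f : elem_smooth f -> rsmooth f.
Proof.
move=> sf l h; have sh : elem_smooth h.
  rewrite {}/h; elim: l => //= i l IH; have [g sg hg] := elem_smooth_derive i IH.
  rewrite (_ : partial _ _ = g)//; apply/funext => x; rewrite /partial derive1E.
  by have [_ ->] := hg x.
split; first by apply: rcontP; exact: elem_smooth_cvg.
by move=> i x; have [g _ /(_ x)[]] := elem_smooth_derive i sh.
Qed.

End smooth.

(** * Density in weighted L^1 *)

Section density.
Context (R : realType) (n : nat).
Notation V := (n.-tuple R).
Context (mu : {measure set V -> \bar R}) (W : V -> R).
Hypothesis W0 : forall x, 0 <= W x.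
Hypothesis iW : mu.-integrable setT (EFin \o W).

Lemma integral_weight_cvg0 (h : nat -> V -> R) :
  (forall N, measurable_fun setT (h N)) -> (forall N x, `|h N x| <= 1) ->
  (forall x, h ^~ x @ \oo --> (0 : R)) ->
  (\int[mu]_x (W x * `|h N x|)%:E)%E @[N --> \oo] --> 0%E.
Proof.
move=> mh h1 h0.
have mW : measurable_fun setT W by apply/measurable_EFinP; exact: measurable_int iW.
have -> : 0%E = (\int[mu]_(x in [set: V]) (cst 0 x))%E by rewrite integral_cst// mul0e.
apply: (@dominated_cvg _ _ _ mu setT _
  (fun N x => (W x * `|h N x|)%:E) (cst 0%E) (EFin \o W)) => //.
- move=> N; apply/measurable_EFinP; apply: measurable_funM => //.
  exact: measurableT_comp.
- move=> x _; apply: cvg_EFin; first by near=> N.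
  rewrite /comp/= -(mulr0 (W x)); apply: cvgMr.
  by rewrite -(@normr0 _ R); apply: cvg_norm.
- move=> N x _ /=; rewrite lee_fin ger0_norm ?mulr_ge0//.
  by rewrite ler_piMr.
Unshelve. all: by end_near. Qed.

Variable F : set (V -> R).
Hypothesis F_meas : forall f, F f -> measurable_fun setT f.
Hypothesis F_01 : forall f, F f -> forall x, 0 <= f x <= 1.
Hypothesis F1 : F (cst 1).
Hypothesis FC : forall f, F f -> F (fun x => 1 - f x).
Hypothesis FM : forall f g, F f -> F g -> F (fun x => f x * g x).
Hypothesis F_ray : forall i (a : R), exists2 f : nat -> V -> R, forall N, F (f N) &
  forall x, f N x @[N --> \oo] --> ((a < tnth x i)%R%:R : R).

Let approx (A : set V) : Prop := measurable A /\
  forall e : R, 0 < e -> exists2 f, F f & (\int[mu]_x (W x * `|f x - \1_A x|)%:E <= e%:E)%E.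

Let mW : measurable_fun setT W.
Proof. by apply/measurable_EFinP; exact: measurable_int iW. Qed.

Lemma indic_weight_approx (A : set V) (f : nat -> V -> R) : measurable A -> (forall N, measurable_fun setT (f N)) ->
  (forall N x, 0 <= f N x <= 1) ->
  (forall x, f N x @[N --> \oo] --> (\1_A x : R)) ->
  forall e, 0 < e -> exists N, (\int[mu]_x (W x * `|f N x - \1_A x|)%:E <= e%:E)%E.
Proof.
move=> mA mf f01 fA e e0.
have h : (\int[mu]_x (W x * `|f N x - \1_A x|)%:E)%E @[N --> \oo] --> 0%E.
  apply: (@integral_weight_cvg0 (fun N x => f N x - \1_A x)) => [N|N x|x].
  - by apply: measurable_funB => //; exact: measurable_indic.
  - have /andP[a b] := f01 N x; rewrite indicE ler_norml; case: (_ \in _) => /=; lra.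
  - by rewrite -(subrr (\1_A x)); apply: cvgB => //; exact: cvg_cst.
have /fine_cvgP[fn /cvgrPdist_le/(_ e e0) he] := h.
near \oo => N; exists N.
have fN : (\int[mu]_x (W x * `|f N x - \1_A x|)%:E)%E \is a fin_num by near: N.
rewrite -(fineK fN) lee_fin; apply: le_trans (ler_norm _) _.
by rewrite -normrN -sub0r; near: N.
Unshelve. all: by end_near. Qed.

Let mWn (g : V -> R) : measurable_fun setT g -> measurable_fun setT (fun x => (W x * `|g x|)%:E).
Proof.
by move=> mg; apply/measurable_EFinP; apply: measurable_funM => //; exact: measurableT_comp.
Qed.

(** Approximability passes to L^1 limits of sets, which leads from finite to countable unions. *)
Let approx_half (A : set V) : measurable A ->
  (forall e : R, 0 < e -> exists2 B, approx B & (\int[mu]_x (W x * `|\1_B x - \1_A x|)%:E <= e%:E)%E) ->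
  approx A.
Proof.
move=> mA H; split => // e e0; have e2 : 0 < e / 2 by rewrite divr_gt0.
have [B [mB /(_ _ e2)[f Ff fB]] BA] := H _ e2.
exists f => //; rewrite (splitr e) EFinD; apply: le_trans (leeD fB BA).
have mf := F_meas Ff.
have mfB := mWn (measurable_funB mf (measurable_indic mB)).
have mBA := mWn (measurable_funB (measurable_indic mB) (measurable_indic mA)).
rewrite -ge0_integralD//=; try by move=> x _; rewrite lee_fin mulr_ge0.
apply: ge0_le_integral => //=; try by move=> x _; rewrite lee_fin mulr_ge0.
- exact: (mWn (measurable_funB mf (measurable_indic mA))).
- exact: emeasurable_funD.
- move=> x _; rewrite -EFinD lee_fin -mulrDr ler_wpM2l//.
  by rewrite -(subrKA (\1_B x)) ler_normD.
Qed.

Let approxC A : approx A -> approx (~` A).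
Proof.
move=> [mA H]; split; first exact: measurableC.
move=> e e0; have [f Ff fA] := H e e0; exists (fun x => 1 - f x); first exact: FC.
under eq_integral => x _.
  rewrite (_ : `|_ - _| = `|f x - \1_A x|); last first.
    rewrite !indicE in_setC; case: (_ \in _) => /=; first by rewrite subr0 distrC.
    by rewrite -normrN; congr (`|_|); ring.
  over.
exact: fA.
Qed.

Let approxU A B : approx A -> approx B -> approx (A `|` B).
Proof.
move=> [mA HA] [mB HB]; split; first exact: measurableU.
move=> e e0; have e2 : 0 < e / 2 by rewrite divr_gt0.
have [f Ff fA] := HA _ e2; have [g Fg gB] := HB _ e2.
(* De Morgan with products as intersections; pointwise, the distance to the indicator of the union
   is at most the sum of the two distances. *)
have FU : F (fun x => 1 - (1 - f x) * (1 - g x)).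
  by apply: (FC (f := fun x => (1 - f x) * (1 - g x))); apply: FM; exact: FC.
exists (fun x => 1 - (1 - f x) * (1 - g x)) => //.
rewrite (splitr e) EFinD; apply: le_trans (leeD fA gB).
have mf := F_meas Ff; have mg := F_meas Fg.
have mfA := mWn (measurable_funB mf (measurable_indic mA)).
have mgB := mWn (measurable_funB mg (measurable_indic mB)).
rewrite -ge0_integralD//=; try by move=> x _; rewrite lee_fin mulr_ge0.
apply: ge0_le_integral => //=; try by move=> x _; rewrite lee_fin mulr_ge0.
- exact: (mWn (measurable_funB (F_meas FU) (measurable_indic (measurableU _ _ mA mB)))).
- exact: emeasurable_funD.
- move=> x _; rewrite -EFinD lee_fin -mulrDr ler_wpM2l//.
  have /andP[f0 f1] := F_01 Ff x; have /andP[g0 g1] := F_01 Fg x.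
  rewrite !indicE in_setU; case: (x \in A); case: (x \in B) => /=;
   rewrite ?subr0 ler_norml; apply/andP; split; 
   rewrite ?(ler0_norm (_ : f x - 1 <= 0)) ?(ler0_norm (_ : g x - 1 <= 0)) ?ger0_norm; nra.
Qed.

Let approx_sigma : sigma_algebra setT approx.
Proof.
have approx0 : approx set0.
  split => // e e0; exists (fun x => 1 - cst 1 x); first exact: FC.
  rewrite integral0_eq ?lee_fin ?ltW// => x _.
  by rewrite indic0 /= subrr subr0 normr0 mulr0.
split => //; first by move=> A /approxC; rewrite setTD.
move=> A HA.
have HU N : approx (\big[setU/set0]_(i < N) A i).
  by elim: N => [|N IH]; [rewrite big_ord0|rewrite big_ord_recr/=; exact: approxU].
have mU : measurable (\bigcup_i A i) by apply: bigcupT_measurable => i; exact: (HA i).1.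
apply: approx_half => // e e0.
have mi N : measurable_fun setT (\1_(\big[setU/set0]_(i < N) A i) : V -> R).
  by apply: measurable_indic; exact: (HU N).1.
have [|x|N HN] := indic_weight_approx mU mi _ _ e0.
- by move=> N x; rewrite indicE; case: (_ \in _); rewrite /= ?lexx ?ler01.
- apply: cvg_near_cst; have [[k _ Akx]|xA] := pselect ((\bigcup_i A i) x).
    exists k.+1 => // N /= kN; apply/eqP; rewrite !indicE !mem_set//=; first by exists k.
    by rewrite -bigcup_mkord; exists k.
  near=> N; apply/eqP; rewrite !indicE !memNset//= -bigcup_mkord => -[k _ Akx].
  by apply: xA; exists k.
- by exists (\big[setU/set0]_(i < N) A i).
Unshelve. all: by end_near. Qed.

(** The approximable sets form a sigma-algebra, and by [F_ray] it contains the half-spaces that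
    generate the sigma-algebra of tuples. [F] stays abstract because it is instantiated twice, by
    smooth functions and by dyadic step functions. *)
Lemma tuple_density (A : set V) : measurable A -> forall e : R, 0 < e ->
  exists2 f, F f & (\int[mu]_x (W x * `|f x - \1_A x|)%:E <= e%:E)%E.
Proof.
suff H : measurable `<=` approx by move=> /H[].
apply: smallest_sub; first exact: approx_sigma.
move=> B; rewrite -bigcup_seq/= => -[i _ [Y mY <-{B}]].
have /= := sigma_algebra_image (fun x : V => tnth x i) approx_sigma.
set C := image_set_system _ _ _ => sC.
suff : C Y by [].
have mYr : (RGenOInfty.G (R:=R)).-sigma.-measurable Y.
  by rewrite -RGenOInfty.measurableE.
apply: smallest_sub mYr => // _ [a ->]; rewrite /C /image_set_system/= setTI.
have [f Ff fA] := F_ray i a.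
split.
  by rewrite -[X in measurable X]setTI; exact: measurable_tnth.
move=> e e0.
have [||N x|x|N HN] := @indic_weight_approx ((fun x => tnth x i) @^-1` `]a, +oo[) f _ _ _ _ e e0.
- by rewrite -[X in measurable X]setTI; exact: measurable_tnth.
- by move=> N; exact: F_meas.
- exact: F_01.
- have := fA x; rewrite indicE/= (_ : (x \in _) = (a < tnth x i))//.
  by apply/idP/idP; rewrite inE/= in_itv/= andbT.
- by exists (f N).
Qed.

End density.

(** * Sign selection and the Carleson embedding *)

(* A deterministic substitute for random signs: the sign of each new index is chosen so
   that its off-diagonal terms contribute nonnegatively. *)
Lemma greedy_signs (R : realDomainType) (J : nat) (c : nat -> nat -> R) :
  exists e : nat -> bool, \sum_(j < J) c j j <=
    \sum_(j < J) \sum_(l < J) (-1) ^+ e j * (-1) ^+ e l * c j l.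
Proof.
elim: J => [|J [e IH]]; first by exists xpred0; rewrite !big_ord0.
pose D := \sum_(l < J) (-1) ^+ e l * (c J l + c l J).
pose e' j := if (j == J)%N then D < 0 else e j; exists e'.
have H (j : 'I_J) : e' j = e j by rewrite /e' ltn_eqF.
have HJ : e' J = (D < 0) by rewrite /e' eqxx.
have DE : (-1) ^+ (D < 0)%R * D = `|D|.
  by case: ltP => D0; rewrite ?expr1 ?expr0 ?mulN1r ?mul1r ?(ltr0_norm D0) ?ger0_norm.
have -> : \sum_(j < J.+1) \sum_(l < J.+1) (-1) ^+ e' j * (-1) ^+ e' l * c j l =
    \sum_(j < J) \sum_(l < J) (-1) ^+ e j * (-1) ^+ e l * c j l + `|D| + c J J.
  rewrite big_ord_recr/= big_ord_recr/= -expr2 sqrr_sign mul1r addrA; congr (_ + _).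
  rewrite -DE /D mulr_sumr.
  under eq_bigr => j _ do rewrite big_ord_recr/= H HJ.
  under [X in _ + X = _]eq_bigr => j _ do rewrite H HJ.
  rewrite big_split/= -addrA; congr (_ + _).
    by apply: eq_bigr => j _; apply: eq_bigr => l _; rewrite H.
  by rewrite -big_split/=; apply: eq_bigr => j _; ring.
by rewrite big_ord_recr/= lerD2r; apply: (le_trans IH); rewrite lerDl.
Qed.

Section multilinear_signs.
Context (R : realDomainType) (m J : nat).
Implicit Types (a : 'I_m -> 'I_J -> R) (v : 'I_J -> R).

Definition set_slot a (i : 'I_m) v : 'I_m -> 'I_J -> R := fun i' => if i' == i then v else a i'.

Definition unit_vec (l : 'I_J) : 'I_J -> R := fun j => (j == l)%:R.

(** The slots are treated one after the other: in slot [s], [greedy_signs] replaces the [j]-th unit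
    vector by a signed sum of all unit vectors without decreasing the sum over [j]. The sign of [j]
    is also put in front of the [j]-th term, where it cancels the sign of the diagonal
    contribution. *)
Lemma multilinear_signs (Phi : ('I_m -> 'I_J -> R) -> 'I_J -> R) :
  (forall a i v j, Phi (set_slot a i v) j = \sum_l v l * Phi (set_slot a i (unit_vec l)) j) ->
  exists e : 'I_m -> 'I_J -> bool,
   \sum_j Phi (fun=> unit_vec j) j <=
   \sum_j (\prod_(i < m) (-1) ^+ e i j) * Phi (fun i l => (-1) ^+ e i l) j.
Proof.
move=> PhiE.
pose mix (e : 'I_m -> 'I_J -> bool) s j : 'I_m -> 'I_J -> R :=
  fun i l => if (i < s)%N then (-1) ^+ e i l else unit_vec j l.
suff H s : (s <= m)%N -> exists e : 'I_m -> 'I_J -> bool,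
   \sum_j Phi (fun=> unit_vec j) j <=
   \sum_j (\prod_(i < m | (i < s)%N) (-1) ^+ e i j) * Phi (mix e s j) j.
  have [e He] := H m (leqnn _); exists e; apply: le_trans He _.
  apply: ler_sum => j _; rewrite (eq_bigl xpredT) => [|i]; last exact: ltn_ord.
  suff -> : mix e m j = (fun i l => (-1) ^+ e i l) by [].
  by apply/funext => i; apply/funext => l; rewrite /mix ltn_ord.
elim: s => [_|s IH sm].
  exists (fun _ _ => false); apply: ler_sum => j _.
  by rewrite big_pred0// mul1r.
have [e He] := IH (ltnW sm); pose k0 := Ordinal sm.
(* [greedy_signs] speaks of natural indices; the value 0 beyond [J] never enters its sums. *)
pose C (j l : nat) : R := if insub j is Some j' then if insub l is Some l' then
  (\prod_(i < m | (i < s)%N) (-1) ^+ e i j') * Phi (set_slot (mix e s j') k0 (unit_vec l')) j'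
  else 0 else 0.
have CE (j l : 'I_J) : C j l = (\prod_(i < m | (i < s)%N) (-1) ^+ e i j) *
    Phi (set_slot (mix e s j) k0 (unit_vec l)) j by rewrite /C !valK.
have [eps Heps] := greedy_signs J C.
exists (fun i (l : 'I_J) => if i == k0 then eps l else e i l).
apply: (le_trans He); apply: le_trans (le_trans Heps _).
  apply: ler_sum => j _; rewrite CE.
  suff -> : set_slot (mix e s j) k0 (unit_vec j) = mix e s j by [].
  apply/funext => i; rewrite /set_slot; case: eqP => // ->.
  by apply/funext => l; rewrite /mix/= ltnn.
apply: ler_sum => j _.
rewrite (bigD1 k0)//= eqxx.
rewrite [X in _ <= X * _](_ : _ = (-1) ^+ eps j * \prod_(i < m | (i < s)%N) (-1) ^+ e i j); last first.
  congr (_ * _); apply: eq_big => [i|i /andP[_ /negbTE->]]//.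
  by rewrite ltnS ltn_neqAle -(inj_eq val_inj)/= andbC.
rewrite [X in _ <= _ * X](_ : _ =
   Phi (set_slot (mix e s j) k0 (fun l => (-1) ^+ eps l)) j); last first.
  congr (Phi _ _); apply/funext => i; apply/funext => l.
  rewrite /mix /set_slot ltnS leq_eqVlt -(inj_eq val_inj)/=.
  by case: eqP.
rewrite PhiE mulr_sumr; apply: ler_sum => l _; rewrite CE le_eqVlt; apply/orP; left; apply/eqP; ring.
Qed.

End multilinear_signs.

Section carleson.
Context (R : realType).

Lemma le_powR (r a b : R) : 0 <= r -> 0 <= a -> a <= b -> a `^ r <= b `^ r.
Proof. by move=> r0 a0 ab; apply: ge0_ler_powR; rewrite ?nnegrE// (le_trans a0). Qed.

(** The coefficient of [u] may be as close to 1 as desired, at the price of [C]. This permits an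
    induction over arbitrarily many sets, where any fixed coefficient would be compounded. Either
    [a] is at most [h * u], with [h] chosen so that (1 + h)^s = g, or [u] is at most [a / h]. *)
Lemma powRD_le (s g : R) : 0 < s -> 1 < g -> exists2 C, 1 <= C &
  forall a u : R, 0 <= a -> 0 <= u -> (u + a) `^ s <= g * u `^ s + C * a `^ s.
Proof.
move=> s0 g1; have g0 : 0 < g by exact: lt_trans g1.
pose h := g `^ s^-1 - 1.
have h0 : 0 < h.
  rewrite subr_gt0 (_ : 1 = 1 `^ s^-1); last by rewrite powR1.
  by rewrite gt0_ltr_powR ?invr_gt0 ?nnegrE ?ler01 ?ltW.
have hg : (1 + h) `^ s = g by rewrite addrC subrK -powRrM mulVf ?gt_eqF// powRr1// ltW.
have h1 : 0 < 1 + h by rewrite addr_gt0.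
have h2 : 0 < 1 + h^-1 by rewrite addr_gt0 ?invr_gt0.
exists ((1 + h^-1) `^ s).
  have : 1 <= 1 + h^-1 by rewrite lerDl invr_ge0 ltW.
  by move/(le_powR (ltW s0) ler01); rewrite powR1.
move=> a u a0 u0; have [ah|ah] := leP a (h * u).
  apply: (@le_trans _ _ (((1 + h) * u) `^ s)).
    by apply: le_powR; [exact: ltW|exact: addr_ge0|rewrite mulrDl mul1r lerD2l].
  by rewrite powRM// ?hg ?(ltW h1)// lerDl mulr_ge0// ?powR_ge0// ltW.
apply: (@le_trans _ _ (((1 + h^-1) * a) `^ s)).
  apply: le_powR; [exact: ltW|exact: addr_ge0|].
  by rewrite mulrDl mul1r addrC lerD2l mulrC ler_pdivlMr// mulrC ltW.
by rewrite powRM// ?(ltW h2)// lerDr mulr_ge0 ?powR_ge0// ltW.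
Qed.

Context d (T : measurableType d) (mu : {measure set T -> \bar R}).
Variables (J : nat) (A : nat -> set T) (v : nat -> R) (Lam : R).
Hypothesis mA : forall j, measurable (A j).
Hypothesis Av : forall j, (j < J)%N -> mu (A j) = (v j)%:E.
Hypothesis Lam0 : 0 < Lam.
Hypothesis packing : forall i, (i < J)%N ->
  \sum_(i.+1 <= j < J | `[< A i `&` A j !=set0 >]) v j <= Lam * v i.

(** Chosen so that eta * 2 * Lam = 1, which closes the induction in [carleson_weight]. *)
Let eta := (2 * Lam)^-1.
Let W N j (x : T) := \prod_(j.+1 <= i < N) (1 + eta * \1_(A i) x).

Let eta0 : 0 < eta. Proof. by rewrite invr_gt0 mulr_gt0. Qed.

Let W_ge0 N j x : 0 <= W N j x.
Proof.
apply: prodr_ge0 => i _; rewrite addr_ge0// mulr_ge0// ?ltW// indicE. 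
Qed.

Let mW N j : measurable_fun setT (W N j).
Proof.
apply: measurable_prod => i _; apply: measurable_funD => //; apply: measurable_funM => //.
Qed.

(** Telescoping: removing the factor of [A i] from the product changes it by [eta * \1_(A i)] times
    the product of the factors after [i]. *)
Let WE N j x : W N j x = 1 + eta * \sum_(j.+1 <= i < N) \1_(A i) x * W N i x.
Proof.
elim: N => [|N IH]; first by rewrite /W !big_geq// mulr0 addr0.
have [jN|Nj] := ltnP j N; last by rewrite /W !big_geq// mulr0 addr0.
have WS i : (i < N)%N -> W N.+1 i x = W N i x * (1 + eta * \1_(A N) x).
  by move=> iN; rewrite /W big_nat_recr.
have WN : W N.+1 N x = 1 by rewrite /W big_geq.
have SE : \sum_(j.+1 <= i < N) \1_(A i) x * W N.+1 i x =
    (\sum_(j.+1 <= i < N) \1_(A i) x * W N i x) * (1 + eta * \1_(A N) x).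
  by rewrite mulr_suml; apply: eq_big_nat => i /andP[_ iN]; rewrite WS// mulrA.
by rewrite WS// big_nat_recr//= WN mulr1 SE IH; ring.
Qed.

(** Downward induction on [j]. By [WE], the excess over v_j is at most eta times the weighted masses
    of the later sets meeting A_j; each of these is at most 2 v_i by induction, so packing bounds
    the excess by eta * 2 * Lam * v_j = v_j. *)
Lemma carleson_weight j : (j < J)%N -> (\int[mu]_x (\1_(A j) x * W J j x)%:E <= (2 * v j)%:E)%E.
Proof.
have mAW i : measurable_fun setT (fun x => (\1_(A i) x * W J i x)%:E).
  by apply/measurable_EFinP; apply: measurable_funM => //; exact: measurable_indic.
have AW0 i x : 0 <= \1_(A i) x * W J i x by rewrite mulr_ge0// indicE; case: (_ \in _).
have [k Hk] : {k | (J <= j + k)%N} by exists J; rewrite leq_addl.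
elim: k j Hk => [|k IH] j Hk jJ; first by move: Hk; rewrite addn0 leqNgt jJ.
pose c i : R := if `[< A j `&` A i !=set0 >] then eta else 0.
have c0 i : 0 <= c i by rewrite /c; case: ifP => // _; exact: ltW.
apply: (@le_trans _ _ (\int[mu]_x ((\1_(A j) x)%:E + \sum_(j.+1 <= i < J)
    (c i)%:E * (\1_(A i) x * W J i x)%:E))%E).
  apply: ge0_le_integral => //.
  - by move=> x _; rewrite lee_fin.
  - apply: emeasurable_funD; first by apply/measurable_EFinP; exact: measurable_indic.
    by apply: emeasurable_sum => i; apply: emeasurable_funM => //; exact: measurable_cst.
  - move=> x _; rewrite (eq_bigr (fun i => (c i * (\1_(A i) x * W J i x))%:E))// sumEFin -EFinD lee_fin.
    rewrite WE mulrDr mulr1 lerD2l mulrCA mulr_sumr mulr_sumr; apply: ler_sum => i _.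
    rewrite /c; case: ifPn => [_|/asboolPn H].
      apply: ler_wpM2l; first exact: ltW.
      by rewrite ler_piMl// indicE; case: (_ \in _).
    rewrite !indicE; case: (boolP (x \in A j)) => [|_]; last by rewrite !(mul0r, mulr0).
    rewrite inE => Ajx; case: (boolP (x \in A i)) => [|_]; last by rewrite !(mul0r, mulr0).
    by rewrite inE => Aix; case: H; exists x.
rewrite ge0_integralD//; last 3 first.
- by apply/measurable_EFinP; exact: measurable_indic.
- by move=> x _; apply: sume_ge0 => i _; rewrite -EFinM lee_fin mulr_ge0.
- by apply: emeasurable_sum => i; apply: emeasurable_funM => //; exact: measurable_cst.
rewrite integral_indic// setIT Av// ge0_integral_sum//; last 2 first.
- by move=> i; apply: emeasurable_funM => //; exact: measurable_cst.
- by move=> i x _; rewrite -EFinM lee_fin mulr_ge0.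
rewrite mulrDl mul1r EFinD leeD2l//.
apply: (@le_trans _ _ (\sum_(j.+1 <= i < J) (c i * (2 * v i))%:E)%E).
  rewrite big_nat_cond [leRHS]big_nat_cond; apply: lee_sum => i /andP[/andP[ji iJ] _].
  rewrite ge0_integralZl//; last 2 first.
  - by move=> x _; rewrite lee_fin.
  - by rewrite lee_fin.
  rewrite EFinM lee_wpmul2l//; first by rewrite lee_fin.
  by apply: IH => //; lia.
rewrite sumEFin lee_fin.
have -> : \sum_(j.+1 <= i < J) c i * (2 * v i) =
    eta * (2 * \sum_(j.+1 <= i < J | `[< A j `&` A i !=set0 >]) v i).
  rewrite !mulr_sumr [RHS]big_mkcond/=; apply: eq_bigr => i _.
  by rewrite /c; case: ifP => // _; rewrite mul0r.
apply: le_trans (ler_wpM2l (ltW eta0) (ler_wpM2l (ler0n R 2) (packing jJ))) _.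
by rewrite /eta (mulrA 2) mulrA mulVf ?mul1r// gt_eqF// mulr_gt0.
Qed.

(* The multiplicity of later sets is exponentially integrable on each set; Hoelder with these
   exponential weights replaces the maximal function. *)
Lemma carleson_powR (s C : R) : 0 < s -> 1 <= C ->
  (forall a u : R, 0 <= a -> 0 <= u -> (u + a) `^ s <= (1 + eta) * u `^ s + C * a `^ s) ->
  forall lam : nat -> R, (forall j, 0 <= lam j) ->
  (\int[mu]_x ((\sum_(j < J) lam j * \1_(A j) x) `^ s)%:E
   <= (2 * C * \sum_(j < J) lam j `^ s * v j)%:E)%E.
Proof.
move=> s0 C1 HC lam lam0.
have C0 : 0 <= C by exact: le_trans C1.
have i0 i x : 0 <= (\1_(A i) x : R) by rewrite indicE; case: (_ \in _).
(* Adding [A N] costs a factor [1 + eta] on the earlier terms, and only at points of [A N]; this is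
   exactly how the weights [W] grow. *)
have pt x N : (\sum_(j < N) lam j * \1_(A j) x) `^ s <=
    C * \sum_(j < N) lam j `^ s * (\1_(A j) x * W N j x).
  elim: N => [|N IH]; first by rewrite !big_ord0 powR0 ?mulr0// gt_eqF.
  have u0 : 0 <= \sum_(j < N) lam j * \1_(A j) x by apply: sumr_ge0 => j _; rewrite mulr_ge0.
  have WN : W N.+1 N x = 1 by rewrite /W big_geq.
  rewrite big_ord_recr/= [in leRHS]big_ord_recr/= WN mulr1 mulrDr.
  have WS (i : 'I_N) : W N.+1 i x = W N i x * (1 + eta * \1_(A N) x).
    by rewrite /W big_nat_recr.
  have SE : \sum_(i < N) lam i `^ s * (\1_(A i) x * W N.+1 i x) =
      (\sum_(i < N) lam i `^ s * (\1_(A i) x * W N i x)) * (1 + eta * \1_(A N) x).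
    by rewrite mulr_suml; apply: eq_bigr => i _; rewrite WS !mulrA.
  rewrite SE mulrA.
  have [xA|xA] := boolP (x \in A N); rewrite indicE; last first.
    rewrite (negbTE xA)/= !mulr0 !addr0 mulr1; exact: IH.
  rewrite xA/= !mulr1; apply: le_trans (HC _ _ _ _) _ => //.
  rewrite lerD2r mulrC ler_wpM2r//; rewrite addr_ge0// ltW//.
have mAW i : measurable_fun setT (fun x => \1_(A i) x * W J i x).
  by apply: measurable_funM => //; exact: measurable_indic.
apply: (@le_trans _ _ (\int[mu]_x (\sum_(j < J) (C * lam j `^ s)%:E * (\1_(A j) x * W J j x)%:E))%E).
  apply: ge0_le_integral => //.
  - by move=> x _; rewrite lee_fin powR_ge0.
  - apply/measurable_EFinP; apply: (measurableT_comp (measurable_powR s)).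
    apply: measurable_sum => i; apply: measurable_funM => //; exact: measurable_indic.
  - apply: emeasurable_sum => i; apply: emeasurable_funM; first exact: measurable_cst.
    exact/measurable_EFinP.
  - move=> x _; rewrite (eq_bigr (fun i : 'I_J => (C * lam i `^ s * (\1_(A i) x * W J i x))%:E))//.
    rewrite sumEFin lee_fin; apply: le_trans (pt x J) _.
    by rewrite mulr_sumr; apply: ler_sum => i _; rewrite mulrA.
rewrite ge0_integral_sum//; last 2 first.
- move=> i; apply: emeasurable_funM; first exact: measurable_cst.
  exact/measurable_EFinP.
- by move=> i x _; rewrite -EFinM lee_fin !mulr_ge0// powR_ge0.
rewrite mulr_sumr -sumEFin; apply: lee_sum => i _.
rewrite ge0_integralZl//; last 3 first.
- exact/measurable_EFinP.
- by move=> x _; rewrite lee_fin mulr_ge0.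
- by rewrite lee_fin mulr_ge0// powR_ge0.
apply: le_trans (lee_wpmul2l _ (carleson_weight (ltn_ord i))) _.
  by rewrite lee_fin mulr_ge0// powR_ge0.
by rewrite -EFinM lee_fin le_eqVlt; apply/orP; left; apply/eqP; ring.
Qed.

End carleson.

(** The constant of [powRD_le] depends on [s] and [Lam] alone, so it can be fixed before the
    measure, the sets and their number. *)
Lemma carleson_Lp (R : realType) (s Lam : R) : 0 < s -> 0 < Lam -> exists2 C, 0 < C &
  forall d (T : measurableType d) (mu : {measure set T -> \bar R}) (J : nat)
    (A : nat -> set T) (v : nat -> R),
  (forall j, measurable (A j)) -> (forall j, (j < J)%N -> mu (A j) = (v j)%:E) ->
  (forall i, (i < J)%N ->
    \sum_(i.+1 <= j < J | `[< A i `&` A j !=set0 >]) v j <= Lam * v i) ->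
  forall lam : nat -> R, (forall j, 0 <= lam j) ->
  (\int[mu]_x ((\sum_(j < J) lam j * \1_(A j) x) `^ s)%:E
   <= (C * \sum_(j < J) lam j `^ s * v j)%:E)%E.
Proof.
move=> s0 L0; have [|C C1 HC] := @powRD_le R s (1 + (2 * Lam)^-1) s0.
  by rewrite ltrDl invr_gt0 mulr_gt0.
exists (2 * C); first by rewrite mulr_gt0// (lt_le_trans _ C1).
by move=> d T mu J A v mA Av pack lam lam0; apply: (carleson_powR mA Av L0 pack).
Qed.

(** * Kernel bounds *)

Section cabs.
Context {R : realType}.
Implicit Types z : R[i].

Lemma cabsE z : cabs z = ComplexField.Normc.normc z.
Proof. by case: z. Qed.

Lemma cabs_ge0 z : 0 <= cabs z. Proof. exact: sqrtr_ge0. Qed.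

Lemma cabsD z z' : cabs (z + z') <= cabs z + cabs z'.
Proof. by rewrite !cabsE; exact: le_normcD. Qed.

Lemma cabsM z z' : cabs (z * z') = cabs z * cabs z'.
Proof. by rewrite !cabsE; exact: ComplexField.Normc.normcM. Qed.

Lemma cabs0 : cabs (0 : R[i]) = 0.
Proof. by rewrite /cabs/= expr0n addr0 sqrtr0. Qed.

Lemma cabsN z : cabs (- z) = cabs z.
Proof. by case: z => a c; rewrite /cabs/= !sqrrN. Qed.

Lemma cabsB z z' : cabs (z - z') = cabs (z' - z).
Proof. by rewrite -cabsN opprB. Qed.

Lemma cabs_toC (r : R) : cabs (toC r) = `|r|.
Proof. by rewrite /cabs/= expr0n addr0 sqrtr_sqr. Qed.

Lemma Re_le_cabs z : `|complex.Re z| <= cabs z.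
Proof. by rewrite -sqrtr_sqr ler_wsqrtr// lerDl sqr_ge0. Qed.

Lemma Im_le_cabs z : `|complex.Im z| <= cabs z.
Proof. by rewrite -sqrtr_sqr ler_wsqrtr// lerDr sqr_ge0. Qed.

End cabs.

Section vectors.
Context {R : realType} (n : nat).
Implicit Types x y : @vec R n.

Lemma vnorm_ge0 x : 0 <= vnorm x. Proof. exact: sqrtr_ge0. Qed.

Lemma vnorm_sum x : vnorm x <= \sum_(j < n) `|tnth x j|.
Proof.
have s0 : 0 <= \sum_(j < n) `|tnth x j| by apply: sumr_ge0.
rewrite -(ger0_norm s0) -sqrtr_sqr ler_wsqrtr//.
have H (s : seq 'I_n) : \sum_(j <- s) tnth x j ^+ 2 <= (\sum_(j <- s) `|tnth x j|) ^+ 2.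
  elim: s => [|j s IH]; first by rewrite !big_nil expr0n.
  rewrite !big_cons sqrrD real_normK ?num_real//.
  apply: le_trans (lerD (lexx _) IH) _; rewrite lerD2r lerDl mulrn_wge0// mulr_ge0//.
  by apply: sumr_ge0.
exact: H.
Qed.

Lemma vnorm_le (e : R) x : (forall j, `|tnth x j| <= e) -> vnorm x <= n%:R * e.
Proof.
move=> H; apply: le_trans (vnorm_sum x) _.
apply: (le_trans (ler_sum _ (fun j _ => H j))).
by rewrite sumr_const card_ord mulr_natl.
Qed.

Lemma vnorm_subC x y : vnorm (vsub x y) = vnorm (vsub y x).
Proof.
congr Num.sqrt; apply: eq_bigr => j _.
by rewrite !tnth_mktuple -sqrrN opprB.
Qed.

Lemma vadd_sub x y : vadd x (vsub y x) = y.
Proof. by apply: eq_from_tnth => j; rewrite !tnth_mktuple addrC subrK. Qed.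

End vectors.

Section kernel.
Context {R : realType} (m n : nat) (K : @vec R n -> @ktuple R m n -> R[i]) (w : R -> R) (C : R).
Hypothesis C0 : 0 <= C.
Hypothesis w_homo : forall s t : R, 0 <= s -> s <= t -> t < 1 -> w s <= w t.
Hypothesis w_ge0 : forall t : R, 0 <= t -> t < 1 -> 0 <= w t.
Hypothesis K_size : forall x y, offdiag x y -> cabs (K x y) <= C / ssum x y ^+ (m * n).
Hypothesis K_smooth : forall x y (h : @vec R n), offdiag x y -> vnorm h <= smax x y / 2 ->
     cabs (K (vadd x h) y - K x y) + \sum_(i < m) cabs (K x (yshift y i h) - K x y)
       <= C / ssum x y ^+ (m * n) * w (vnorm h / ssum x y).

Lemma ssum_ge (L : R) x (y : @ktuple R m n) i : L <= vnorm (vsub x (tnth y i)) -> L <= ssum x y.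
Proof.
move=> H; apply: (le_trans H); rewrite /ssum (bigD1 i)//= lerDl.
by apply: sumr_ge0 => j _; exact: vnorm_ge0.
Qed.

Lemma smax_ge (L : R) x (y : @ktuple R m n) i : L <= vnorm (vsub x (tnth y i)) -> L <= smax x y.
Proof.
move=> H; apply: (le_trans H); rewrite /smax (bigD1 i)//= le_max; exact/orP/or_introl.
Qed.

Lemma offdiag_ge (L : R) x (y : @ktuple R m n) i : 0 < L -> L <= vnorm (vsub x (tnth y i)) -> offdiag x y.
Proof.
move=> L0 H; exists i; apply/eqP => E; move: (lt_le_trans L0 H).
rewrite E ltNge => /negP[]; apply: le_trans (vnorm_sum _) _.
by rewrite big1// => j _; rewrite tnth_mktuple subrr normr0.
Qed.

Lemma K_size_le (L : R) x y i : 0 < L -> L <= vnorm (vsub x (tnth y i)) -> cabs (K x y) <= C / L ^+ (m * n).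
Proof.
move=> L0 H; apply: le_trans (K_size (offdiag_ge L0 H)) _.
have Ls := ssum_ge H; have s0 := lt_le_trans L0 Ls.
by rewrite ler_wpM2l// lef_pV2 ?posrE ?exprn_gt0// lerXn2r// nnegrE ltW.
Qed.

(** One variable at distance at least [L] from [x] bounds both [ssum] and [smax] below. The
    condition e <= L / 2 makes the increment admissible and keeps the argument of [w] below 1, where
    [w] is monotone. *)
Lemma K_smooth_le (L e : R) x y i (h : @vec R n) : 0 < L -> L <= vnorm (vsub x (tnth y i)) ->
  vnorm h <= e -> e <= L / 2 ->
  cabs (K (vadd x h) y - K x y) + \sum_(i < m) cabs (K x (yshift y i h) - K x y)
       <= C / L ^+ (m * n) * w (e / L).
Proof.
move=> L0 H he eL; have Ls := ssum_ge H; have s0 := lt_le_trans L0 Ls.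
have e0 : 0 <= e := le_trans (vnorm_ge0 h) he.
have eL1 : e / L < 1 by rewrite ltr_pdivrMr// mul1r; lra.
have hs : vnorm h / ssum x y <= e / L.
  rewrite ler_pdivrMr// mulrAC ler_pdivlMr//.
  by apply: ler_pM => //; [exact: vnorm_ge0|exact: ltW].
apply: le_trans (K_smooth (offdiag_ge L0 H) _) _.
  apply: (le_trans he); apply: (le_trans eL).
  by rewrite ler_pM2r ?invr_gt0//; exact: smax_ge H.
apply: ler_pM.
- by rewrite divr_ge0// exprn_ge0// ltW.
- by apply: w_ge0; [rewrite divr_ge0 ?vnorm_ge0// ltW|exact: le_lt_trans eL1].
- by rewrite ler_wpM2l// lef_pV2 ?posrE ?exprn_gt0// lerXn2r// nnegrE ltW.
- by apply: w_homo => //; rewrite divr_ge0 ?vnorm_ge0// ltW.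
Qed.

Lemma K_var_x (L e : R) x x' y i : 0 < L -> L <= vnorm (vsub x (tnth y i)) ->
  vnorm (vsub x' x) <= e -> e <= L / 2 ->
  cabs (K x' y - K x y) <= C / L ^+ (m * n) * w (e / L).
Proof.
move=> L0 H he eL; apply: le_trans (K_smooth_le L0 H he eL).
by rewrite vadd_sub lerDl sumr_ge0// => j _; exact: cabs_ge0.
Qed.

(** Regularity moves one variable at a time, so every hybrid of [y] and [y'] met on the way must
    stay at distance [L] from [x]; this is the last hypothesis. The [m] moves give the factor. *)
Lemma K_var_y (L e : R) x (y y' : @ktuple R m n) : 0 < L ->
  (forall i, vnorm (vsub (tnth y' i) (tnth y i)) <= e) -> e <= L / 2 ->
  (forall z : @ktuple R m n, (forall i, tnth z i = tnth y i \/ tnth z i = tnth y' i) ->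
     exists i, L <= vnorm (vsub x (tnth z i))) ->
  cabs (K x y' - K x y) <= m%:R * (C / L ^+ (m * n) * w (e / L)).
Proof.
move=> L0 he eL H.
pose z s : @ktuple R m n := [tuple if (i < s)%N then tnth y' i else tnth y i | i < m].
have z0 : z 0 = y by apply: eq_from_tnth => i; rewrite tnth_mktuple.
have zm : z m = y' by apply: eq_from_tnth => i; rewrite tnth_mktuple ltn_ord.
suff Hs s : (s <= m)%N -> cabs (K x (z s) - K x y) <= s%:R * (C / L ^+ (m * n) * w (e / L)).
  by have := Hs m (leqnn _); rewrite zm.
elim: s => [_|s IH sm]; first by rewrite z0 subrr cabs0 mul0r.
rewrite -(subrKA (K x (z s))); apply: le_trans (cabsD _ _) _.
rewrite -natr1 mulrDl mul1r addrC; apply: lerD; first exact: IH (ltnW sm).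
have [j Hj] : exists i, L <= vnorm (vsub x (tnth (z s) i)).
  by apply: H => i; rewrite tnth_mktuple; case: ifP => _; [right|left].
pose i := Ordinal sm.
have zS : z s.+1 = yshift (z s) i (vsub (tnth y' i) (tnth y i)).
  apply: eq_from_tnth => l; rewrite !tnth_mktuple ltnS leq_eqVlt -(inj_eq val_inj)/=.
  case: eqVneq => //= ls; have -> : l = i by exact: val_inj.
  by rewrite ltnn vadd_sub.
apply: le_trans (K_smooth_le L0 Hj (he i) eL).
apply: ler_wpDl; first exact: cabs_ge0.
rewrite zS (bigD1 i)//= lerDl; apply: sumr_ge0 => *; exact: cabs_ge0.
Qed.

End kernel.

(** * Measurability of the kernel *)

Section rounding.
Context {R : realType}.

Definition rnd (N : nat) (t : R) : R := (Num.floor (t * N.+1%:R))%:~R / N.+1%:R.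

Lemma rnd_close N t : `|rnd N t - t| <= N.+1%:R^-1.
Proof.
have N0 : 0 < (N.+1%:R : R) by rewrite ltr0n.
have /andP[a b] := Num.Theory.floor_itv (t * N.+1%:R).
rewrite /rnd -{2}(mulfK (lt0r_neq0 N0) t) -mulrBl normrM.
rewrite (ger0_norm (x := N.+1%:R^-1)) ?invr_ge0// ler_piMl ?invr_ge0//.
by move: b; rewrite intrD ler_norml; lra.
Qed.

Lemma measurable_floor (M : R) (c : int) : 0 < M -> measurable [set t : R | Num.floor (t * M) = c].
Proof.
move=> M0.
rewrite (_ : [set t | _] = [set` `[c%:~R / M, (c + 1)%:~R / M[]); first exact: measurable_itv.
apply/seteqP; split => t /=; rewrite in_itv/= ler_pdivrMr// ltr_pdivlMr//.
  by move=> <-; exact: Num.Theory.floor_itv.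
by move/Num.Theory.floor_def.
Qed.

Context (m n : nat).

(* Rounding takes countably many values, so [F \o krnd N] is measurable for every [F];
   the regularity of the kernel then makes [K] a limit of measurable functions. *)
Definition krnd N (y : m.-tuple (n.-tuple R)) : m.-tuple (n.-tuple R) :=
  [tuple [tuple rnd N (tnth (tnth y i) j) | j < n] | i < m].

Lemma measurable_krnd N (F : m.-tuple (n.-tuple R) -> R) : measurable_fun setT (F \o krnd N).
Proof.
pose code (y : m.-tuple (n.-tuple R)) : {ffun 'I_m * 'I_n -> int} :=
  [ffun ij => Num.floor (tnth (tnth y ij.1) ij.2 * N.+1%:R)].
pose dec (c : {ffun 'I_m * 'I_n -> int}) : m.-tuple (n.-tuple R) :=
  [tuple [tuple (c (i, j))%:~R / N.+1%:R | j < n] | i < m].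
have dc y : krnd N y = dec (code y).
  by apply: eq_from_tnth => i; apply: eq_from_tnth => j; rewrite !tnth_mktuple ffunE.
move=> _ Y mY; rewrite setTI.
(* Countably many codes occur; the union keeps the fibres of those whose decoded point is sent into
   [Y]. *)
rewrite (_ : _ @^-1` Y = \bigcup_(c : {ffun 'I_m * 'I_n -> int})
   (if pselect (Y (F (dec c))) then [set y | code y = c] else set0)); last first.
  apply/seteqP; split => [y/= Yy|y [c _]/=].
    by exists (code y) => //; case: pselect => //; rewrite /= -dc.
    by case: pselect => // Yc /= E; rewrite dc E.
apply: countable_bigcupT_measurable => // c; case: pselect => Yc; last exact: measurable0.
rewrite (_ : [set y | _] = \bigcap_(ij in [set: 'I_m * 'I_n])
   [set y : m.-tuple (n.-tuple R) | Num.floor (tnth (tnth y ij.1) ij.2 * N.+1%:R) = c ij]); last first.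
  apply/seteqP; split => [y /= <- ij _|y /= H]; first by rewrite /= ffunE.
  by apply/ffunP => ij; rewrite ffunE; exact: H.
apply: fin_bigcap_measurable => // -[i j] _ /=.
rewrite -[X in measurable X]setTI.
have mij : measurable_fun setT (fun y : m.-tuple (n.-tuple R) => tnth (tnth y i) j).
  exact: (measurableT_comp (measurable_tnth j) (measurable_tnth i)).
exact: (mij measurableT _ (measurable_floor (c (i, j)) (ltr0Sn R N))).
Qed.

End rounding.

Section kernel_measurable.
Context {R : realType} (m n : nat) (K : @vec R n -> @ktuple R m n -> R[i]) (w : R -> R) (C : R).
Hypothesis C0 : 0 <= C.
Hypothesis w_homo : forall s t : R, 0 <= s -> s <= t -> t < 1 -> w s <= w t.
Hypothesis w_ge0 : forall t : R, 0 <= t -> t < 1 -> 0 <= w t.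
Hypothesis w_cvg0 : w t @[t --> 0^'+] --> (0 : R).
Hypothesis K_size : forall x y, offdiag x y -> cabs (K x y) <= C / ssum x y ^+ (m * n).
Hypothesis K_smooth : forall x y (h : @vec R n), offdiag x y -> vnorm h <= smax x y / 2 ->
     cabs (K (vadd x h) y - K x y) + \sum_(i < m) cabs (K x (yshift y i h) - K x y)
       <= C / ssum x y ^+ (m * n) * w (vnorm h / ssum x y).

Lemma modulus_small (D e : R) : 0 <= D -> 0 < e -> exists2 t, 0 < t < 1 & D * w t <= e.
Proof.
move=> D0 e0; have e1 : 0 < e / (D + 1) by rewrite divr_gt0// ltr_wpDl.
have /cvgrPdist_le/(_ _ e1) H := w_cvg0.
have [t [/andP[t0 t1] wt]] : exists t, 0 < t < 1 /\ `|0 - w t| <= e / (D + 1).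
  near (0 : R)^'+ => t; exists t; split; last by near: t.
  by apply/andP; split; near: t; [exact: nbhs_right_gt|exact: nbhs_right_lt].
exists t; first by rewrite t0.
rewrite sub0r normrN in wt; have wt' := le_trans (ler_norm _) wt.
apply: (@le_trans _ _ ((D + 1) * w t)).
  by rewrite ler_wpM2r ?lerDl//; apply: w_ge0; rewrite // ltW.
by rewrite mulrC -ler_pdivlMr// ltr_wpDl.
Unshelve. all: by end_near. Qed.

Lemma K_cvg x (y : @ktuple R m n) : offdiag x y ->
  forall e, 0 < e -> exists N0, forall N, (N0 <= N)%N -> cabs (K x (krnd N y) - K x y) <= e.
Proof.
move=> [i0 yx] e e0.
have [j0 yxj] : exists j, tnth (tnth y i0) j != tnth x j.
  apply: contrapT => H; move/eqP: yx; apply; apply: eq_from_tnth => j.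
  by apply/eqP/negPn/negP => Hj; apply: H; exists j.
(* Half of a nonzero coordinate difference: the rounded tuples still differ from [x] by [L] in that
   coordinate. *)
pose L := `|tnth (tnth y i0) j0 - tnth x j0| / 2.
have L0 : 0 < L by rewrite divr_gt0// normr_gt0 subr_eq0.
pose D := m%:R * (C / L ^+ (m * n)).
have D0 : 0 <= D by rewrite mulr_ge0// divr_ge0// exprn_ge0// ltW.
have [t /andP[t0 t1] wt] := modulus_small D0 e0.
(* The first entry brings the argument of the modulus below [t], the second makes the displacement
   admissible for [K_var_y]. *)
pose s := Num.min (t * L) (L / 2).
have s0 : 0 < s by rewrite lt_min mulr_gt0//= divr_gt0.
exists (Num.trunc ((n.+1)%:R / s)) => N N0N.
have Ns : n%:R * N.+1%:R^-1 <= s.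
  rewrite ler_pdivrMr ?ltr0n// mulrC -ler_pdivrMr//.
  have H : n.+1%:R / s < (Num.trunc (n.+1%:R / s)).+1%:R by exact: truncnS_gt.
  apply: le_trans (ltW (lt_le_trans H _)); last by rewrite ler_nat.
  by rewrite ler_pM2r ?invr_gt0// ler_nat.
have HN i : vnorm (vsub (tnth (krnd N y) i) (tnth y i)) <= s.
  apply: le_trans Ns; apply: vnorm_le => j.
  by rewrite !tnth_mktuple; exact: rnd_close.
apply: le_trans (K_var_y C0 w_homo w_ge0 K_smooth (L := L) (e := s) L0 HN _ _) _.
- by rewrite ge_min lexx orbT.
- move=> z Hz; exists i0; apply: le_trans (vnorm_coord _ j0).
  rewrite tnth_mktuple.
  have zy : `|tnth (tnth z i0) j0 - tnth (tnth y i0) j0| <= L.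
    case: (Hz i0) => ->; first by rewrite subrr normr0 ltW.
    apply: (@le_trans _ _ s); last by rewrite ge_min; apply/orP; right; lra.
    by have := le_trans (vnorm_coord _ j0) (HN i0); rewrite tnth_mktuple.
  have : `|tnth (tnth y i0) j0 - tnth x j0| = L * 2 by rewrite /L; lra.
  move: zy; rewrite ler_norml => /andP[a b] /eqP.
  by rewrite eqr_norml => /andP[/orP[/eqP c|/eqP c] _]; rewrite ler_normr; apply/orP; [right|left]; lra.
rewrite mulrA -/D; apply: le_trans wt; rewrite ler_wpM2l//.
apply: w_homo => //; first by rewrite divr_ge0// ltW.
by rewrite ler_pdivrMr// ge_min lexx.
Qed.

Lemma measurable_offdiag (x : @vec R n) : measurable [set y : m.-tuple (n.-tuple R) | offdiag x y].
Proof.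
rewrite (_ : [set y | _] = \bigcup_(i in [set: 'I_m]) \bigcup_(j in [set: 'I_n])
   [set y : m.-tuple (n.-tuple R) | tnth (tnth y i) j <> tnth x j]).
  apply: fin_bigcup_measurable => // i _; apply: fin_bigcup_measurable => // j _.
  have mij : measurable_fun setT (fun y : m.-tuple (n.-tuple R) => tnth (tnth y i) j).
    exact: (measurableT_comp (measurable_tnth j) (measurable_tnth i)).
  have := mij measurableT _ (measurableC (measurable_set1 (tnth x j))).
  by rewrite setTI.
apply/seteqP; split => y /=.
  move=> [i /eqP yx]; exists i => //; apply: contrapT => H; apply: yx.
  apply: eq_from_tnth => j; apply: contrapT => Hj; apply: H.
  by exists j.
by move=> [i _ [j _ /= yx]]; exists i; apply/eqP => E; apply: yx; rewrite E.
Qed.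

Lemma measurable_ReK x : measurable_fun [set y | offdiag x y] (fun y : m.-tuple (n.-tuple R) => complex.Re (K x y)).
Proof.
apply: (@measurable_fun_cvg _ _ _ _ (fun N y => complex.Re (K x (krnd N y)))) => [N|y yx].
  apply: measurable_funTS.
  exact: (measurable_krnd N (fun y => complex.Re (K x y))).
apply/cvgrPdist_le => e e0; have [N0 HN] := K_cvg yx e0.
exists N0 => // N /= N0N; apply: le_trans (HN _ N0N).
rewrite cabsB; apply: le_trans (Re_le_cabs _); by case: (K x y) => a c; case: (K x _).
Qed.

Lemma measurable_ImK x : measurable_fun [set y | offdiag x y] (fun y : m.-tuple (n.-tuple R) => complex.Im (K x y)).
Proof.
apply: (@measurable_fun_cvg _ _ _ _ (fun N y => complex.Im (K x (krnd N y)))) => [N|y yx].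
  apply: measurable_funTS.
  exact: (measurable_krnd N (fun y => complex.Im (K x y))).
apply/cvgrPdist_le => e e0; have [N0 HN] := K_cvg yx e0.
exists N0 => // N /= N0N; apply: le_trans (HN _ N0N).
rewrite cabsB; apply: le_trans (Im_le_cabs _); by case: (K x y) => a c; case: (K x _).
Qed.

End kernel_measurable.

(** * Kernel representation of the commutator *)

Section tuple_integrable.
Context d (T : measurableType d) (R : realType).
Variable mu : {sigma_finite_measure set T -> \bar R}.

Lemma integrable_tuple_prod n (g : 'I_n -> T -> R) :
  (forall i, mu.-integrable setT (EFin \o g i)) ->
  (tuple_measure mu n).-integrable setT (fun t => (\prod_(i < n) g i (tnth t i))%:E).
Proof.
move=> ig; have mg i : measurable_fun setT (g i).
  by apply/measurable_EFinP; exact: measurable_int (ig i).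
apply/integrableP; split; first by apply/measurable_EFinP; exact: measurable_prod_tnth.
under eq_integral do rewrite /= normr_prod.
rewrite (integral_tuple_prod mu (g := fun i x => `|g i x|)); last 2 first.
- by move=> i; exact: measurableT_comp.
- by [].
have h i : (\int[mu]_x `|g i x|%:E)%E \is a fin_num.
  rewrite ge0_fin_numE; last by apply: integral_ge0 => x _; rewrite lee_fin.
  by have /integrableP[_] := ig i.
under eq_bigr => i _ do rewrite -(fineK (h i)).
by rewrite prodEFin ltry.
Qed.

End tuple_integrable.

Section toC.
Context {R : realType}.

Lemma toCM (r s : R) : toC r * toC s = toC (r * s).
Proof. by rewrite /toC; apply/eqP; rewrite eq_complex/= !mulr0 mul0r subr0 addr0 !eqxx. Qed.

Lemma prod_toC (I : Type) (s : seq I) (F : I -> R) : \prod_(i <- s) toC (F i) = toC (\prod_(i <- s) F i).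
Proof. by elim: s => [|i s IH]; rewrite ?big_nil// !big_cons IH toCM. Qed.

Lemma Re_mul_toC (z : R[i]) r : complex.Re (z * toC r) = complex.Re z * r.
Proof. by case: z => a c /=; rewrite mulr0 subr0. Qed.

Lemma Im_mul_toC (z : R[i]) r : complex.Im (z * toC r) = complex.Im z * r.
Proof. by case: z => a c /=; rewrite mulr0 add0r. Qed.

Lemma toC_mul_sub (r a1 a2 c1 c2 : R) :
  toC r * Complex a1 a2 - Complex c1 c2 = Complex (r * a1 - c1) (r * a2 - c2).
Proof. by apply/eqP; rewrite eq_complex/= !mul0r subr0 addr0 !eqxx. Qed.

End toC.

Section kernel_integrable.
Context {R : realType} (m n : nat) (K : @vec R n -> @ktuple R m n -> R[i]) (C : R).
Hypothesis K_size : forall x y, offdiag x y -> cabs (K x y) <= C / ssum x y ^+ (m * n).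
Hypothesis C0 : 0 <= C.
Hypothesis mReK : forall x, measurable_fun [set y | offdiag x y] (fun y : m.-tuple (n.-tuple R) => complex.Re (K x y)).
Hypothesis mImK : forall x, measurable_fun [set y | offdiag x y] (fun y : m.-tuple (n.-tuple R) => complex.Im (K x y)).

Definition rfun (g : 'I_m -> n.-tuple R -> R) : 'I_m -> vec n -> R[i] := fun i y => toC (g i y).

(** Where the product of the inputs is nonzero, the variable [y_i0] stays at distance [dd] from [x],
    so the size bound makes the kernel bounded there. *)
Lemma integrable_kernel (Kr : m.-tuple (n.-tuple R) -> R) x (g : 'I_m -> n.-tuple R -> R) :
  (forall y, `|Kr y| <= cabs (K x y)) -> measurable_fun [set y | offdiag x y] Kr ->
  (forall i, (mun n).-integrable setT (EFin \o g i)) ->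
  (exists i, out_supp (rfun g i) x) ->
  (muk m n).-integrable setT (fun y => (Kr y * \prod_(i < m) g i (tnth y i))%:E).
Proof.
move=> KrK mKr ig [i0 [dd d0 Hd]].
pose P (y : m.-tuple (n.-tuple R)) := \prod_(i < m) g i (tnth y i).
have iP : (muk m n).-integrable setT (EFin \o P) by exact: integrable_tuple_prod.
have mP : measurable_fun setT P by apply/measurable_EFinP; exact: measurable_int iP.
have HP y : P y != 0 -> dd <= vnorm (vsub x (tnth y i0)).
  move=> Py; rewrite leNgt; apply/negP => H; move/eqP: Py; apply.
  rewrite /P (bigD1 i0)//=; move: H; rewrite vnorm_subC => /Hd; rewrite /rfun/toC => -[->].
  by rewrite mul0r.
have HD y : P y != 0 -> offdiag x y by move/HP; exact: offdiag_ge.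
(* [Kr] is known to be measurable off the diagonal only; the product vanishes on the diagonal, so
   zeroing [Kr] there changes nothing. *)
have E : (fun y => (Kr y * P y)%:E) = EFin \o (fun y => (Kr \_ [set y | offdiag x y]) y * P y).
  apply/funext => y /=; congr EFin; rewrite patchE; case: ifPn => //= yD.
  by rewrite mul0r; have [->|/HD H] := eqVneq (P y) 0; rewrite ?mulr0//; move: yD; rewrite notin_setE.
rewrite E.
apply: (@le_integrable _ _ _ _ _ measurableT _ (EFin \o (fun y => C / dd ^+ (m * n) * P y))).
- apply/measurable_EFinP; apply: measurable_funM => //.
  by apply/measurable_restrict => //; [exact: measurable_offdiag|rewrite setTI].
- move=> y _ /=; rewrite lee_fin !normrM.
  have [->|Py] := eqVneq (P y) 0; first by rewrite normr0 !mulr0.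
  rewrite ler_wpM2r// patchE mem_set; last exact: HD.
  apply: (le_trans (KrK y)); apply: (le_trans (K_size_le C0 K_size d0 (HP _ Py))).
  by rewrite -normrM; exact: ler_norm.
- have := integrableZl measurableT (C / dd ^+ (m * n)) iP.
  by under eq_fun do rewrite -EFinM.
Qed.

End kernel_integrable.

Section representation.
Context {R : realType} (m n : nat) (T : @op R m n) (K : @vec R n -> @ktuple R m n -> R[i]) (C : R) (b : n.-tuple R -> R).
Hypothesis K_size : forall x y, offdiag x y -> cabs (K x y) <= C / ssum x y ^+ (m * n).
Hypothesis C0 : 0 <= C.
Hypothesis mReK : forall x, measurable_fun [set y | offdiag x y] (fun y : m.-tuple (n.-tuple R) => complex.Re (K x y)).
Hypothesis mImK : forall x, measurable_fun [set y | offdiag x y] (fun y : m.-tuple (n.-tuple R) => complex.Im (K x y)).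
Hypothesis T_repr : kernel_repr_ext T K.
Hypothesis mb : measurable_fun setT b.
Variable i0 : 'I_m.
Hypothesis i00 : nat_of_ord i0 = 0%N.

Definition mul0 (h : n.-tuple R -> R) (g : 'I_m -> n.-tuple R -> R) : 'I_m -> n.-tuple R -> R :=
  fun i => if i == i0 then (fun y => h y * g i y) else g i.

Lemma prod_mul0 h g (y : m.-tuple (n.-tuple R)) :
  \prod_(i < m) mul0 h g i (tnth y i) = h (tnth y i0) * \prod_(i < m) g i (tnth y i).
Proof.
rewrite (bigD1 i0)//= [in RHS](bigD1 i0)//= /mul0 eqxx mulrA; congr (_ * _).
by apply: eq_bigr => i /negbTE ->.
Qed.

Lemma i0E (i : 'I_m) : (nat_of_ord i == 0%N) = (i == i0).
Proof. by rewrite -(inj_eq val_inj)/= i00. Qed.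

Lemma bmul1_rfun g : bmul1 b (rfun g) = rfun (mul0 b g).
Proof.
apply/funext => i; rewrite /bmul1 i0E /rfun /mul0; case: eqP => // _.
by apply/funext => y; rewrite toCM.
Qed.

(** Kernel form of the k-th commutator: each commutation with [b] in the first slot multiplies the
    kernel by b(x) - b(y_1). *)
Definition kint (Kr : m.-tuple (n.-tuple R) -> R) (k : nat) (g : 'I_m -> n.-tuple R -> R) (x : n.-tuple R) : R :=
  Rintegral (muk m n) setT (fun y => Kr y * ((b x - b (tnth y i0)) ^+ k * \prod_(i < m) g i (tnth y i))).

Lemma out_supp_mul0 h g x : (exists i, out_supp (rfun g i) x) -> exists i, out_supp (rfun (mul0 h g) i) x.
Proof.
move=> [i [d d0 H]]; exists i; exists d => // y /H; rewrite /rfun /mul0; case: eqP => // ->.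
by rewrite /toC => -[->]; rewrite mulr0.
Qed.

Lemma weight_le (k : nat) (r s : R) : (`|r - s|) ^+ k <= (1 + `|r|) ^+ k * (1 + `|s|) ^+ k.
Proof.
rewrite -exprMn lerXn2r// ?nnegrE ?mulr_ge0 ?addr_ge0//.
apply: (le_trans (ler_normB _ _)); have := mulr_ge0 (normr_ge0 r) (normr_ge0 s); nra.
Qed.

(** The invariant of the induction on commutators: the weight dominates the powers of |b x - b y| up
    to order [k], and multiplying the function by [b] lowers the available order by one. *)
Definition wintegrable k (f : n.-tuple R -> R) :=
  (mun n).-integrable setT (EFin \o (fun y => (1 + `|b y|) ^+ k * f y)).

Lemma integrable_dom (h f : n.-tuple R -> R) c k : measurable_fun setT h -> measurable_fun setT f ->
  (forall y, `|h y| <= c * (1 + `|b y|) ^+ k) -> wintegrable k f ->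
  (mun n).-integrable setT (EFin \o (fun y => h y * f y)).
Proof.
move=> mh mf hc ig.
apply: (@le_integrable _ _ _ _ _ measurableT _ (EFin \o (fun y => c * ((1 + `|b y|) ^+ k * f y)))).
- by apply/measurable_EFinP; exact: measurable_funM.
- move=> y _ /=; rewrite lee_fin mulrA !(normrM _ (f y)) ler_wpM2r//.
  by apply: (le_trans (hc y)); exact: ler_norm.
- have := integrableZl measurableT c ig.
  by under eq_fun do rewrite -EFinM.
Qed.

Lemma integrable_kernel_weight (Kr : m.-tuple (n.-tuple R) -> R) k (g : 'I_m -> n.-tuple R -> R) x
    (h : n.-tuple R -> R) :
  (forall y, `|Kr y| <= cabs (K x y)) -> measurable_fun [set y | offdiag x y] Kr ->
  (forall i, measurable_fun setT (g i)) ->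
  (forall i, i != i0 -> (mun n).-integrable setT (EFin \o g i)) ->
  wintegrable k (g i0) ->
  (exists i, out_supp (rfun g i) x) ->
  measurable_fun setT h -> (exists c, forall y, `|h y| <= c * (1 + `|b y|) ^+ k) ->
  (muk m n).-integrable setT (fun y => (Kr y * (h (tnth y i0) * \prod_(i < m) g i (tnth y i)))%:E).
Proof.
move=> KrK mKr mg ig ig0 og mh [c hc].
have := integrable_kernel (C := C) K_size C0 KrK mKr (g := mul0 h g) _ (out_supp_mul0 h og).
under eq_fun do rewrite prod_mul0; apply => i.
rewrite /mul0; case: eqP => [->|/eqP]; last exact: ig.
exact: integrable_dom (mg _) hc ig0.
Qed.

Lemma kint_step (Kr : m.-tuple (n.-tuple R) -> R) k (g : 'I_m -> n.-tuple R -> R) x :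
  (forall y, `|Kr y| <= cabs (K x y)) -> measurable_fun [set y | offdiag x y] Kr ->
  (forall i, measurable_fun setT (g i)) ->
  (forall i, i != i0 -> (mun n).-integrable setT (EFin \o g i)) ->
  wintegrable k.+1 (g i0) ->
  (exists i, out_supp (rfun g i) x) ->
  b x * kint Kr k g x - kint Kr k (mul0 b g) x = kint Kr k.+1 g x.
Proof.
move=> KrK mKr mg ig ig0 og.
have mbx j : measurable_fun setT (fun y => (b x - b y) ^+ j).
  by apply: measurable_funX; exact: measurable_funB.
have H (h : n.-tuple R -> R) := @integrable_kernel_weight Kr k.+1 g x h KrK mKr mg ig ig0 og.
rewrite /kint.
under [X in _ - X]eq_Rintegral do rewrite prod_mul0.
have b1 y : 1 <= 1 + `|b y| by rewrite lerDl.
rewrite -RintegralZl//; last first.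
  apply: (H (fun y => (b x - b y) ^+ k)) => //; exists ((1 + `|b x|) ^+ k) => y.
  rewrite normrX; apply: (le_trans (weight_le _ _ _)).
  by rewrite ler_wpM2l ?exprn_ge0 ?addr_ge0// ler_weXn2l.
rewrite -RintegralB//.
- by apply: eq_Rintegral => y _; rewrite exprS; ring.
- rewrite [X in integrable _ _ X](_ : _ = fun y =>
      (Kr y * ((fun y => b x * (b x - b y) ^+ k) (tnth y i0) * \prod_(i < m) g i (tnth y i)))%:E); last first.
    by apply/funext => y /=; congr EFin; ring.
  apply: (H (fun y => b x * (b x - b y) ^+ k)); first by apply: measurable_funM.
  exists (`|b x| * (1 + `|b x|) ^+ k) => y.
  rewrite normrM normrX -mulrA ler_wpM2l//; apply: (le_trans (weight_le _ _ _)).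
  by rewrite ler_wpM2l ?exprn_ge0 ?addr_ge0// ler_weXn2l.
- rewrite [X in integrable _ _ X](_ : _ = fun y =>
      (Kr y * ((fun y => (b x - b y) ^+ k * b y) (tnth y i0) * \prod_(i < m) g i (tnth y i)))%:E); last first.
    by apply/funext => y /=; congr EFin; ring.
  apply: (H (fun y => (b x - b y) ^+ k * b y)); first by apply: measurable_funM.
  exists ((1 + `|b x|) ^+ k) => y.
  rewrite normrM normrX exprSr mulrA; apply: ler_pM => //; first exact: weight_le.
  by rewrite lerDr.
Qed.

(** A commutation uses the representation for two inputs, [g] and its version multiplied by [b] in
    the first slot. The representation holds almost everywhere, so the two exceptional null sets are
    united at each step. *)
Lemma commutator_repr k (g : 'I_m -> n.-tuple R -> R) :
  (forall i, measurable_fun setT (g i)) ->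
  (forall i, i != i0 -> (mun n).-integrable setT (EFin \o g i)) ->
  (forall i, i != i0 -> Ccinf (rfun g i)) -> cpt_supp (rfun g i0) ->
  wintegrable k (g i0) ->
  exists N : set (n.-tuple R), [/\ measurable N, mun n N = 0%E &
   forall x, ~ N x -> (exists i, out_supp (rfun g i) x) ->
     commutator k T b (rfun g) x =
     Complex (kint (fun y => complex.Re (K x y)) k g x) (kint (fun y => complex.Im (K x y)) k g x)].
Proof.
elim: k g => [|k IH] g mg ig Cg cg ig0.
  have ig1 i : (mun n).-integrable setT (EFin \o g i).
    have [->|] := eqVneq i i0; last exact: ig.
    by move: ig0; rewrite /wintegrable; under eq_fun do rewrite expr0 mul1r.
  have [i H0|i H0|N [mN [N0 HN]]] := T_repr (f := rfun g).
  - have -> : i = i0 by apply/eqP; rewrite -i0E H0.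
    split; first by split; [exact: mg|exact: measurable_cst].
    split => //; split; first by split; [exact: mg|exact: measurable_cst].
    rewrite /lnorm; under eq_fun do rewrite cabs_toC powRr1//.
    rewrite vintE//; last by apply/measurable_EFinP; exact: measurableT_comp.
    by rewrite invr1 poweRe1 ?integral_ge0//; have /integrableP[_] := ig1 i0.
  - by apply: Cg; rewrite -i0E; apply/eqP.
  exists N; split => //.
    move: N0; rewrite vintE ?integral_indic ?setIT//.
    by apply/measurable_EFinP; exact: measurable_indic.
  move=> x Nx og /=; rewrite HN// /kernel_integral /cvvint /kint.
  have E y : \prod_(i < m) rfun g i (tnth y i) = toC (\prod_(i < m) g i (tnth y i)).
    by rewrite -prod_toC.
  congr Complex.
    rewrite rvvintE; last first.
      under eq_fun do rewrite E Re_mul_toC.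
      by apply: (integrable_kernel K_size C0) og => // y; exact: Re_le_cabs.
    by apply: eq_Rintegral => y _; rewrite E Re_mul_toC expr0 mul1r.
  rewrite rvvintE; last first.
    under eq_fun do rewrite E Im_mul_toC.
    by apply: (integrable_kernel K_size C0) og => // y; exact: Im_le_cabs.
  by apply: eq_Rintegral => y _; rewrite E Im_mul_toC expr0 mul1r.
have mk : measurable_fun setT (fun y => (1 + `|b y|) ^+ k).
  by apply: measurable_funX; apply: measurable_funD => //; exact: measurableT_comp.
have b1 y : 1 <= 1 + `|b y| by rewrite lerDl.
have [|N1 [mN1 N10 H1]] := IH g mg ig Cg cg.
  apply: (integrable_dom (c := 1) mk (mg _) _ ig0) => y.
  by rewrite mul1r ger0_norm ?exprn_ge0 ?addr_ge0// ler_weXn2l.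
have [|i /negbTE ii|i /negbTE ii|||N2 [mN2 N20 H2]] := IH (mul0 b g).
- by move=> i; rewrite /mul0; case: ifP => // _; exact: measurable_funM.
- by rewrite /mul0 ii; apply: ig; rewrite ii.
- by rewrite /rfun /mul0 ii; apply: Cg; rewrite ii.
- have [rad Hr] := cg; exists rad => y /Hr; rewrite /rfun /mul0 eqxx /toC => -[->].
  by rewrite mulr0.
- rewrite /wintegrable /mul0 eqxx; under eq_fun do rewrite mulrA.
  apply: (integrable_dom (c := 1) _ (mg _) _ ig0) => [|y]; first exact: measurable_funM.
  rewrite mul1r normrM ger0_norm ?exprn_ge0 ?addr_ge0// exprSr ler_wpM2l ?exprn_ge0 ?addr_ge0//.
  by rewrite lerDr.
exists (N1 `|` N2); split; first exact: measurableU.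
  by apply/eqP; rewrite eq_le measure_ge0 andbT -(adde0 0%E) -{1}N10 -N20; exact: measureU2.
move=> x /not_orP[xN1 xN2] og /=; rewrite bmul1_rfun H1// H2//; last exact: out_supp_mul0.
rewrite toC_mul_sub; congr Complex; apply: kint_step => // y.
- exact: Re_le_cabs.
- exact: Im_le_cabs.
Qed.

End representation.

(** * Reference cubes *)

Section reference.
Context {R : realType} (m n : nat) (K : @vec R n -> @ktuple R m n -> R[i]) (w : R -> R) (C c0 : R).
Hypothesis mn0 : (0 < m * n)%N.
Hypothesis C0 : 0 <= C.
Hypothesis w_homo : forall s t : R, 0 <= s -> s <= t -> t < 1 -> w s <= w t.
Hypothesis w_ge0 : forall t : R, 0 <= t -> t < 1 -> 0 <= w t.
Hypothesis w_cvg0 : w t @[t --> 0^'+] --> (0 : R).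
Hypothesis K_size : forall x y, offdiag x y -> cabs (K x y) <= C / ssum x y ^+ (m * n).
Hypothesis K_smooth : forall x y (h : @vec R n), offdiag x y -> vnorm h <= smax x y / 2 ->
     cabs (K (vadd x h) y - K x y) + \sum_(i < m) cabs (K x (yshift y i h) - K x y)
       <= C / ssum x y ^+ (m * n) * w (vnorm h / ssum x y).
Hypothesis c0_gt0 : 0 < c0.
Hypothesis K_nondeg : forall (y : @vec R n) (rho : R), 0 < rho ->
    exists x : vec n, rho <= vnorm (vsub x y) /\
      1 / (c0 * rho ^+ (m * n)) <= cabs (K x [tuple y | _ < m]).

(** Modulus at most 1 rather than equal to 1 lets [z = 0] be treated with the phase 0. *)
Lemma unit_phase (z : R[i]) : exists2 t : R[i], cabs t <= 1 & complex.Re (t * z) = cabs z.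
Proof.
have [->|z0] := eqVneq z 0.
  by exists 0; rewrite ?mul0r cabs0//.
case: z z0 => a d z0; have z1 : 0 < cabs (Complex a d).
  by rewrite lt_neqAle cabs_ge0 andbT eq_sym cabsE; apply: contra z0 => /eqP/ComplexField.Normc.eq0_normc ->.
have E : a ^+ 2 + d ^+ 2 = cabs (Complex a d) ^+ 2.
  by rewrite /cabs/= sqr_sqrtr// addr_ge0// sqr_ge0.
set r := cabs _ in z1 E *.
exists (Complex (a / r) (- d / r)).
  rewrite /cabs/= !exprMn sqrrN -mulrDl E exprVn mulfV ?sqrtr1// expf_neq0// gt_eqF//.
rewrite /= (_ : _ - _ = (a ^+ 2 + d ^+ 2) / r); last by ring.
by rewrite E expr2 mulfK// lt0r_neq0.
Qed.

Lemma pow_le_max (t D : R) : 0 <= t -> t ^+ (m * n) <= D -> t <= Num.max 1 D.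
Proof.
move=> t0 H; rewrite le_max; case: (leP t 1) => //= t1.
by apply: le_trans H; rewrite -{1}(expr1 t) ler_weXn2l// ltW.
Qed.

(** Nondegeneracy is applied at [z] with [rho = M * d]. The larger [M], the smaller the relative
    variation of the kernel while all variables range over cubes of half side [d]. [M] depends on
    the kernel only, so it affects the constants but not the scaling in [d]. *)
Lemma reference_cube : exists A c S : R, [/\ 1 <= A, 0 < c, 0 < S &
  forall (z : n.-tuple R) (d : R), 0 < d -> exists (z' : n.-tuple R) (t : R[i]),
   [/\ cabs t <= 1, forall j, `|tnth z' j - tnth z j| <= A * d,
    forall x y, cube z' d x -> cube z d y -> d <= vnorm (vsub x y) &
    forall x (y : m.-tuple (n.-tuple R)), cube z' d x -> (forall i, cube z d (tnth y i)) ->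
      c / d ^+ (m * n) <= complex.Re (t * K x y) /\ cabs (K x y) <= S / d ^+ (m * n)]].
Proof.
have n0 : (0 < n)%N by case: n mn0 => //; rewrite muln0.
have m0 : (0 < m)%N by case: m mn0.
have nR : 0 < (n%:R : R) by rewrite ltr0n.
have n1 : 1 <= (n%:R : R) by rewrite ler1n.
(* One move in [x] and [m] moves in [y], each at distance L = rho / (2 n), add up to
   [D / rho ^+ (m * n)] times the modulus. *)
pose D := m.+1%:R * C * (2 * n%:R) ^+ (m * n).
have D0 : 0 <= D by rewrite !mulr_ge0// exprn_ge0// mulr_ge0.
have e0 : 0 < (2 * c0)^-1 by rewrite invr_gt0 mulr_gt0.
have [t /andP[t0 t1] wt] := modulus_small w_ge0 w_cvg0 D0 e0.
(* The first entry yields n d <= L / 2, as the regularity estimates require; the second brings the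
   argument n d / L of the modulus below [t]. *)
pose M := Num.max (4 * n%:R ^+ 2) (2 * n%:R ^+ 2 / t).
have M4 : 4 * n%:R ^+ 2 <= M by rewrite le_max lexx.
have nn : 1 <= (n%:R : R) ^+ 2 by rewrite exprn_ege1.
have M4n : 4 * n%:R <= M.
  by apply: le_trans M4; rewrite ler_pM2l// expr2 ler_peMr// ltW.
have M0 : 0 < M by apply: lt_le_trans M4n; rewrite mulr_gt0.
have Mt : 2 * n%:R ^+ 2 / M <= t.
  have : 2 * n%:R ^+ 2 / t <= M by rewrite le_max lexx orbT.
  by rewrite !ler_pdivrMr// (mulrC M).
(* The nondegeneracy lower bound and the size upper bound at the same point give (|x0 - z| /
   rho)^(mn) <= C c0, so the reference cube cannot be too far away. *)
pose B := Num.max 1 (C * c0).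
have B1 : 1 <= B by rewrite le_max lexx.
exists (M * B), ((2 * c0 * M ^+ (m * n))^-1), (C * (2 * n%:R / M) ^+ (m * n) + 1).
split.
- by rewrite mulr_ege1//; apply: le_trans M4n; nra.
- by rewrite invr_gt0 !mulr_gt0// exprn_gt0.
- by rewrite ltr_wpDl// mulr_ge0// exprn_ge0// divr_ge0// ?mulr_ge0// ltW.
move=> z d d0; pose rho := M * d.
have rho0 : 0 < rho by rewrite mulr_gt0.
have [x0 [xr xK]] := K_nondeg z rho0.
pose zz : m.-tuple (n.-tuple R) := [tuple z | _ < m].
pose i1 := Ordinal m0.
have zzi i : tnth zz i = z by rewrite tnth_mktuple.
have [t' t'1 t'K] := unit_phase (K x0 zz).
pose L := rho / (2 * n%:R).
have L0 : 0 < L by rewrite divr_gt0// mulr_gt0.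
have dL : 2 * d <= L by rewrite /L ler_pdivlMr ?mulr_gt0// /rho; nra.
(* One coordinate carries at least 1/n of the distance; in that coordinate whole cubes remain
   separated by [L]. *)
have [j0 Hj0] : exists j, rho / n%:R <= `|tnth x0 j - tnth z j|.
  apply: contrapT => H; move: xr; rewrite leNgt => /negP; apply.
  apply: le_lt_trans (vnorm_sum _) _.
  apply: (@lt_le_trans _ _ (\sum_(j < n) rho / n%:R)); last first.
    by rewrite sumr_const card_ord -[leLHS]mulr_natr mulfVK// gt_eqF.
  apply: ltr_sum; first by rewrite has_predT /index_enum -enumT size_enum_ord.
  move=> j _; rewrite tnth_mktuple ltNge; apply/negP => Hj; apply: H; by exists j.
have sep x y : cube x0 d x -> cube z d y -> L <= vnorm (vsub x y).
  move=> /(_ j0) xx /(_ j0) yz; apply: le_trans (vnorm_coord _ j0); rewrite tnth_mktuple.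
  have E : rho / n%:R = 2 * L by rewrite /L; field; rewrite gt_eqF.
  rewrite E in Hj0; move: xx yz Hj0.
  rewrite !ltr_norml ler_normr => /andP[a1 a2] /andP[a3 a4] /orP H.
  by rewrite ler_normr; apply/orP; case: H => H; [left|right]; lra.
have cx0 : cube x0 d x0 by move=> j; rewrite subrr normr0.
have cz : cube z d z by move=> j; rewrite subrr normr0.
have dcube (u v : n.-tuple R) : cube u d v -> vnorm (vsub v u) <= n%:R * d.
  by move=> H; apply: vnorm_le => j; rewrite tnth_mktuple ltW.
have eL : n%:R * d <= L / 2.
  rewrite /L /rho ler_pdivlMr// ler_pdivlMr ?mulr_gt0//.
  apply: le_trans (ler_wpM2r (ltW d0) M4); rewrite le_eqVlt; apply/orP; left; apply/eqP; ring.
exists x0, t'; split => //.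
- move=> j; have := vnorm_coord (vsub x0 z) j; rewrite tnth_mktuple => H; apply: (le_trans H).
  have v0 : 0 < vnorm (vsub x0 z) by exact: lt_le_trans xr.
  rewrite mulrAC -/rho mulrC -ler_pdivrMr//; apply: pow_le_max.
    by rewrite divr_ge0// ltW.
  rewrite expr_div_n ler_pdivrMr ?exprn_gt0//.
  have := le_trans xK (K_size_le C0 K_size (i := i1) v0 _).
  rewrite zzi lexx => /(_ isT); rewrite div1r ler_pdivlMr ?exprn_gt0// mulrC ler_pdivrMr ?mulr_gt0 ?exprn_gt0//.
  by rewrite mulrA.
- by move=> x y hx hy; apply: le_trans (sep _ _ hx hy); lra.
move=> x y hx hy.
have LE : L ^+ (m * n) = (M / (2 * n%:R)) ^+ (m * n) * d ^+ (m * n).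
  by rewrite -exprMn; congr (_ ^+ _); rewrite /L /rho mulrAC.
have P0 : 0 < (M / (2 * n%:R)) ^+ (m * n) by rewrite exprn_gt0// divr_gt0// mulr_gt0.
have dm : 0 < d ^+ (m * n) by rewrite exprn_gt0.
have Kd : cabs (K x y - K x0 zz) <= (2 * c0 * rho ^+ (m * n))^-1.
  rewrite -(subrKA (K x0 y)); apply: le_trans (cabsD _ _) _.
  have h1 := K_var_x C0 w_homo w_ge0 K_smooth L0 (sep _ _ cx0 (hy i1)) (dcube _ _ hx) eL.
  have h2 : cabs (K x0 y - K x0 zz) <= m%:R * (C / L ^+ (m * n) * w (n%:R * d / L)).
    apply: (K_var_y C0 w_homo w_ge0 K_smooth L0) => //.
      by move=> i; rewrite zzi; exact: dcube.
    by move=> u Hu; exists i1; apply: sep => //; case: (Hu i1) => ->; rewrite ?zzi.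
  apply: (le_trans (lerD h1 h2)).
  have -> : n%:R * d / L = 2 * n%:R ^+ 2 / M.
    by rewrite /L /rho; field; rewrite !gt_eqF.
  have wM : w (2 * n%:R ^+ 2 / M) <= w t.
    by apply: w_homo => //; rewrite divr_ge0 ?mulr_ge0// ltW.
  rewrite -{1}(mul1r (C / _ * _)) -mulrDl addrC natr1 mulrA.
  have -> : m.+1%:R * (C / L ^+ (m * n)) = D / rho ^+ (m * n).
    rewrite /D /L expr_div_n invfM invrK; ring.
  rewrite mulrAC ler_pdivrMr ?exprn_gt0//.
  rewrite (invfM (2 * c0)) mulfVK ?gt_eqF ?exprn_gt0//.
  by apply: le_trans wt; rewrite ler_wpM2l.
split.
  have -> : t' * K x y = t' * K x0 zz + t' * (K x y - K x0 zz) by rewrite mulrBr addrC subrK.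
  rewrite raddfD/= t'K.
  have h : - (2 * c0 * rho ^+ (m * n))^-1 <= complex.Re (t' * (K x y - K x0 zz)).
    have := Re_le_cabs (t' * (K x y - K x0 zz)); rewrite cabsM ler_norml => /andP[H _].
    apply: le_trans H; rewrite lerN2; apply: le_trans Kd.
    by rewrite ler_piMl// cabs_ge0.
  apply: le_trans (lerD xK h).
  rewrite /rho exprMn le_eqVlt; apply/orP; left; apply/eqP; field.
  by rewrite !gt_eqF// exprn_gt0.
apply: (le_trans (K_size_le C0 K_size L0 (sep _ _ hx (hy i1)))).
rewrite ler_pdivlMr// LE invfM mulrA mulfVK ?gt_eqF//.
by rewrite -exprVn invfM invrK -(mulrC (2 * n%:R)) ler_wpDr.
Qed.

End reference.

(** * Smooth approximation and medians *)

Section approximation.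
Context {R : realType} (n : nat).
Notation V := (n.-tuple R).

Definition unit_smooth : set (V -> R) := [set f | elem_smooth f /\ forall x, 0 <= f x <= 1].

Lemma unit_smooth_ray (N : nat) (i : 'I_n) (c a : R) : unit_smooth (fun x => flat 0 (c * (tnth x i - a))).
Proof. by split; [exact: elem_smooth_flat|move=> x; rewrite flat_ge0 flat0_le1]. Qed.

Lemma unit_smoothM f g : unit_smooth f -> unit_smooth g -> unit_smooth (fun x => f x * g x).
Proof.
move=> [sf f1] [sg g1]; split; first exact: elem_smoothM.
move=> x; have /andP[a b] := f1 x; have /andP[c d] := g1 x.
by rewrite mulr_ge0//= mulr_ile1.
Qed.

Lemma unit_smooth_prod (F : 'I_n -> V -> R) (s : seq 'I_n) : (forall i, unit_smooth (F i)) ->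
  unit_smooth (fun x => \prod_(i <- s) F i x).
Proof.
move=> HF; elim: s => [|i s IH].
  under eq_fun do rewrite big_nil; split; first exact: elem_smooth_cst.
  by rewrite ler01 lexx.
by under eq_fun do rewrite big_cons; exact: unit_smoothM.
Qed.

Lemma cvg_prod_seq (u : 'I_n -> nat -> R) (l : 'I_n -> R) (s : seq 'I_n) :
  (forall i, u i @ \oo --> l i) -> (fun N => \prod_(i <- s) u i N) @ \oo --> \prod_(i <- s) l i.
Proof.
move=> H; elim: s => [|i s IH].
  by under eq_fun do rewrite big_nil; rewrite big_nil; exact: cvg_cst.
by under eq_fun do rewrite big_cons; rewrite big_cons; apply: cvgM.
Qed.

(** [flat 0] vanishes on the negative half-line, so each factor vanishes beyond one face: the
    product is zero outside the cube for every [N], not just in the limit. *)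
Definition cutoff (z : V) (d : R) (N : nat) (x : V) : R :=
  \prod_(i < n) (flat 0 (N%:R * (tnth x i - (tnth z i - d))) * flat 0 ((- N%:R) * (tnth x i - (tnth z i + d)))).

Lemma cutoff_unit_smooth z d N : unit_smooth (cutoff z d N).
Proof. by apply: unit_smooth_prod => i; apply: unit_smoothM; exact: unit_smooth_ray. Qed.

Lemma cutoff_out z d N x : ~ cube z d x -> cutoff z d N x = 0.
Proof.
move=> /existsNP[i /negP]; rewrite -leNgt ler_normr => H.
apply/eqP; rewrite prodf_seq_eq0; apply/hasP; exists i; first exact: mem_index_enum.
have flat0 (r : R) : r <= 0 -> flat 0 r = 0 by move=> r0; rewrite /flat ltNge r0.
case/orP: H => H /=; [rewrite [X in _ * X]flat0 ?mulr0//|rewrite flat0 ?mul0r//].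
  by rewrite mulNr oppr_le0 mulr_ge0// ; lra.
by rewrite mulr_ge0_le0//; lra.
Qed.

Lemma cvg_cutoff z d x : 0 < d -> cutoff z d N x @[N --> \oo] --> (\1_(cube z d) x : R).
Proof.
move=> d0; rewrite cubeE; apply: cvg_prod_seq => i.
have -> : \1_(ball (tnth z i) d) (tnth x i) =
    (0 < tnth x i - (tnth z i - d))%R%:R * (0 < (tnth z i + d) - tnth x i)%R%:R :> R.
  rewrite -natrM mulnb indicE; congr (_%:R); congr nat_of_bool.
  apply/idP/idP; rewrite inE /ball/= ltr_norml.
    by move=> /andP[a b]; apply/andP; split; lra.
  by move=> /andP[a b]; apply/andP; split; lra.
apply: cvgM; first exact: cvg_flat0.
under eq_fun do rewrite mulNr -mulrN opprB.
exact: cvg_flat0.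
Qed.

(** Density gives an approximant without control of its support. Multiplication by a cutoff confines
    it to the cube, at the price of the second half of [e]. *)
Lemma smooth_approx (W : V -> R) z d (E : set V) e : 0 < d -> (forall x, 0 <= W x) ->
  (mun n).-integrable setT (EFin \o (fun x => W x * \1_(cube z d) x)) ->
  measurable E -> E `<=` cube z d -> 0 < e ->
  exists f, [/\ elem_smooth f, forall x, 0 <= f x <= 1, forall x, ~ cube z d x -> f x = 0 &
    (\int[mun n]_x (W x * \1_(cube z d) x * `|f x - \1_E x|)%:E <= e%:E)%E].
Proof.
move=> d0 W0 iW mE Ecube e0; have e2 : 0 < e / 2 by rewrite divr_gt0.
pose W' x := W x * \1_(cube z d) x.
have W'0 x : 0 <= W' x by rewrite mulr_ge0// indicE; case: (_ \in _).
have mW : measurable_fun setT W' by apply/measurable_EFinP; exact: measurable_int iW.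
have u1 : unit_smooth (cst 1) by split; [exact: elem_smooth_cst|move=> x; rewrite ler01 lexx].
have uC f : unit_smooth f -> unit_smooth (fun x => 1 - f x).
  move=> [sf f1]; split; last by move=> x; have := f1 x; lra.
  rewrite (_ : (fun x => _) = (fun x => 1 + (-1) * f x)); last by apply/funext => x; ring.
  by apply: elem_smoothD; [exact: elem_smooth_cst|apply: elem_smoothM => //; exact: elem_smooth_cst].
have [i a|f [sf f1] fE] := @tuple_density R n (mun n) W' W'0 iW unit_smooth
  (fun f H => elem_smooth_measurable H.1) (fun f H => H.2) u1 uC unit_smoothM _ E mE _ e2.
  exists (fun N x => flat 0 (N%:R * (tnth x i - a))); first by move=> N; exact: unit_smooth_ray.
  by move=> x; rewrite -subr_gt0; exact: cvg_flat0.
have mc := measurable_cube z d.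
have [|N x|x|N HN] := @indic_weight_approx R n (mun n) W' W'0 iW (cube z d) (cutoff z d) mc _ _ _ _ e2.
- by move=> N; have [sc _] := cutoff_unit_smooth z d N; exact: elem_smooth_measurable sc.
- by have [_] := cutoff_unit_smooth z d N.
- exact: cvg_cutoff.
have [sc c1] := cutoff_unit_smooth z d N.
exists (fun x => f x * cutoff z d N x); split.
- exact: elem_smoothM.
- move=> x; have /andP[f0 f1x] := f1 x; have /andP[c0 c1x] := c1 x.
  by rewrite mulr_ge0//= mulr_ile1.
- by move=> x /(cutoff_out N) ->; rewrite mulr0.
rewrite (splitr e) EFinD; apply: le_trans (leeD fE HN).
have mf := elem_smooth_measurable sf; have mcut := elem_smooth_measurable sc.
have mW' (h : V -> R) : measurable_fun setT h -> measurable_fun setT (fun x => (W' x * `|h x|)%:E).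
  by move=> mh; apply/measurable_EFinP; apply: measurable_funM => //; exact: measurableT_comp.
have m1 := mW' _ (measurable_funB mf (measurable_indic mE)).
have m2 := mW' _ (measurable_funB mcut (measurable_indic mc)).
rewrite -ge0_integralD//=; try by move=> x _; rewrite lee_fin mulr_ge0.
change (\int[mun n]_x (W' x * `|f x * cutoff z d N x - \1_E x|)%:E <=
  \int[mun n]_x ((W' x * `|f x - \1_E x|)%:E + (W' x * `|cutoff z d N x - \1_(cube z d) x|)%:E))%E.
apply: ge0_le_integral => //=; try by move=> x _; rewrite lee_fin mulr_ge0.
- exact: (mW' _ (measurable_funB (measurable_funM mf mcut) (measurable_indic mE))).
- exact: emeasurable_funD.
- move=> x _; rewrite -EFinD lee_fin -mulrDr ler_wpM2l ?W'0//.
  have /andP[f0 f1x] := f1 x; have /andP[c0 c1x] := c1 x.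
  rewrite !indicE; have [xE|xE] := boolP (x \in E).
    have -> : x \in cube z d by apply/mem_set/Ecube; rewrite inE in xE.
    rewrite /= !(distrC _ 1) !ger0_norm ?subr_ge0 ?mulr_ile1//; nra.
  rewrite subr0 normrM (ger0_norm c0) [X in _ <= X + _](_ : _ = `|f x|) ?subr0//.
  by apply: ler_wpDr => //; rewrite ler_piMr.
Qed.

End approximation.

Section median.
Context {R : realType} d (T : measurableType d) (mu : {measure set T -> \bar R}) (b : T -> R).
Hypothesis mb : measurable_fun setT b.

(** The value is the supremum of the [t] with at most half of the mass strictly below [t];
    continuity of the measure from above reaches it from both sides. Both sets contain the level set
    b = a, so an atom of [b] is no obstacle. *)
Lemma median (A : set T) (v : R) : measurable A -> mu A = v%:E -> 0 < v ->
  exists a, ((v / 2)%:E <= mu (A `&` [set x | b x <= a]%R))%E /\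
            ((v / 2)%:E <= mu (A `&` [set x | a <= b x]%R))%E.
Proof.
move=> mA Av v0.
have mlt t : measurable (A `&` [set x | b x < t]).
  apply: measurableI => //; rewrite -[X in measurable X]setTI.
  by rewrite (_ : [set x | _] = b @^-1` `]-oo, t[); [exact: mb|apply/seteqP; split => x/=; rewrite in_itv].
have mle t : measurable (A `&` [set x | b x <= t]).
  apply: measurableI => //; rewrite -[X in measurable X]setTI.
  by rewrite (_ : [set x | _] = b @^-1` `]-oo, t]); [exact: mb|apply/seteqP; split => x/=; rewrite in_itv].
have mge t : measurable (A `&` [set x | t <= b x]).
  apply: measurableI => //; rewrite -[X in measurable X]setTI.
  by rewrite (_ : [set x | _] = b @^-1` `[t, +oo[); [exact: mb|apply/seteqP; split => x/=; rewrite in_itv/= andbT].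
have Afin B : B `<=` A -> measurable B -> mu B \is a fin_num.
  move=> BA mB; rewrite ge0_fin_numE//; apply: (@le_lt_trans _ _ (mu A)); last by rewrite Av ltry.
  by apply: le_measure; rewrite ?inE.
pose S := [set t | (mu (A `&` [set x | b x < t]%R) <= (v / 2)%:E)%E].
(* Sets increasing to [A] eventually carry more than half of its mass; this will show that [S] is
   nonempty and bounded above. *)
have cvg_up (F : nat -> set T) : (forall i, measurable (F i)) -> {homo F : i j / (i <= j)%N >-> (i <= j)%O} ->
    \bigcup_i F i = A -> exists i, ((v / 2)%:E < mu (F i))%E.
  move=> mF hF FA; have mU : measurable (\bigcup_i F i) by rewrite FA.
  have H : mu \o F @ \oo --> mu (\bigcup_i F i) by exact: nondecreasing_cvg_mu.
  rewrite FA Av in H; apply: contrapT => /forallNP HN.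
  have : (v%:E <= (v / 2)%:E)%E.
    rewrite -(cvg_lim _ H)//; apply: lime_le; first by apply/cvg_ex; exists v%:E.
    by apply: nearW => i /=; rewrite leNgt; apply/negP/HN.
  by rewrite lee_fin; lra.
have [t1 Ht1] : exists t, ((v / 2)%:E < mu (A `&` [set x | b x < t]%R))%E.
  have [|i j ij||i Hi] := cvg_up (fun i => A `&` [set x | b x < i%:R]%R) => //.
  - by apply/subsetPset => x [Ax /= bx]; split => //=; apply: (lt_le_trans bx); rewrite ler_nat.
  - apply/seteqP; split => [x [i _ []]//|x Ax].
    by exists (Num.trunc `|b x|).+1 => //; split => //=; apply: (le_lt_trans (ler_norm _)); exact: truncnS_gt.
  - by exists i%:R.
have [t0 Ht0] : exists t, ((v / 2)%:E < mu (A `&` [set x | t <= b x]%R))%E.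
  have [|i j ij||i Hi] := cvg_up (fun i => A `&` [set x | - i%:R <= b x]%R) => //.
  - by apply/subsetPset => x [Ax /= bx]; split => //=; apply: le_trans bx; rewrite lerN2 ler_nat.
  - apply/seteqP; split => [x [i _ []]//|x Ax].
    exists (Num.trunc `|b x|).+1 => //; split => //=; rewrite lerNl.
    by apply: ltW; apply: (le_lt_trans (ler_norm _)); rewrite normrN; exact: truncnS_gt.
  - by exists (- i%:R).
have split_mu t : (mu (A `&` [set x | b x < t]%R) + mu (A `&` [set x | t <= b x]%R) = v%:E)%E.
  rewrite -Av -measureU//.
    congr (mu _); rewrite -setIUr; apply/seteqP; split => [x []//|x Ax]; split => //=.
    by case: (ltP (b x) t); [left|right].
  apply/seteqP; split => // x [[_ /= h1] [_ /= h2]].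
  by move: h1; rewrite ltNge h2.
have SE t : S t <-> ((v / 2)%:E <= mu (A `&` [set x | t <= b x]%R))%E.
  have := split_mu t; rewrite /S/=.
  have := Afin _ (@subIsetl _ A _) (mlt t); have := Afin _ (@subIsetl _ A _) (mge t).
  case: (mu _) => [p| |]//; case: (mu _) => [p'| |]// _ _ [] E; rewrite !lee_fin; split; lra.
have S0 : S t0 by apply/SE/ltW.
have Sub : ubound S t1.
  move=> t St; rewrite leNgt; apply/negP => tt; move: Ht1; rewrite ltNge => /negP; apply.
  apply: le_trans St; apply: le_measure; rewrite ?inE//.
  by move=> x [Ax /= bx]; split => //=; exact: lt_trans tt.
have hS : has_sup S by split; [exists t0|exists t1].
exists (sup S); split.
- have H : (fun i : nat => mu (A `&` [set x | b x < sup S + i.+1%:R^-1]%R)) @ \oo -->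
     mu (\bigcap_i (A `&` [set x | b x < sup S + i.+1%:R^-1]%R)).
    apply: nonincreasing_cvg_mu => //.
    + by rewrite ltey_eq Afin//; exact: subIsetl.
    + by apply: bigcapT_measurable => i; exact: mlt.
    + move=> i j ij; apply/subsetPset => x [Ax /= bx]; split => //=; apply: (lt_le_trans bx).
      by rewrite lerD2l lef_pV2 ?posrE ?ltr0n// ler_nat.
  have E : \bigcap_i (A `&` [set x | b x < sup S + i.+1%:R^-1]%R) = A `&` [set x | b x <= sup S].
    apply/seteqP; split => x.
      move=> Hx; split; first by case: (Hx 0%N I).
      rewrite /= leNgt; apply/negP => bx; rewrite -subr_gt0 in bx.
      have [_ /=] := Hx (Num.trunc (b x - sup S)^-1) I; rewrite -ltrBlDl ltNge => /negP; apply.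
      rewrite -[leRHS]invrK lef_pV2 ?posrE ?invr_gt0// ltW//; exact: truncnS_gt.
    by move=> [Ax /= bx] i _; split => //=; apply: (le_lt_trans bx); rewrite ltrDl invr_gt0.
  rewrite E in H; rewrite -(cvg_lim _ H)//; apply: lime_ge; first by apply/cvg_ex; eexists; exact: H.
  apply: nearW => i; rewrite leNgt; apply/negP => Hi.
  have : S (sup S + i.+1%:R^-1) by exact: ltW.
  by move/(ub_le_sup hS.2); rewrite gerDl leNgt invr_gt0 ltr0Sn.
- have H : (fun i : nat => mu (A `&` [set x | sup S - i.+1%:R^-1 <= b x]%R)) @ \oo -->
     mu (\bigcap_i (A `&` [set x | sup S - i.+1%:R^-1 <= b x]%R)).
    apply: nonincreasing_cvg_mu => //.
    + by rewrite ltey_eq Afin//; exact: subIsetl.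
    + by apply: bigcapT_measurable => i; exact: mge.
    + move=> i j ij; apply/subsetPset => x [Ax /= bx]; split => //=; apply: le_trans bx.
      by rewrite lerD2l lerN2 lef_pV2 ?posrE ?ltr0n// ler_nat.
  have E : \bigcap_i (A `&` [set x | sup S - i.+1%:R^-1 <= b x]%R) = A `&` [set x | sup S <= b x].
    apply/seteqP; split => x.
      move=> Hx; split; first by case: (Hx 0%N I).
      rewrite /= leNgt; apply/negP => bx; rewrite -subr_gt0 in bx.
      have [_ /=] := Hx (Num.trunc (sup S - b x)^-1) I; rewrite lerBlDl -lerBlDr leNgt => /negP; apply.
      rewrite -[ltRHS]invrK ltf_pV2 ?posrE ?invr_gt0//; exact: truncnS_gt.
    by move=> [Ax /= bx] i _; split => //=; apply: le_trans bx; rewrite gerBl invr_ge0.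
  rewrite E in H; rewrite -(cvg_lim _ H)//; apply: lime_ge; first by apply/cvg_ex; eexists; exact: H.
  apply: nearW => i.
  have i0 : 0 < (i.+1%:R^-1 : R) by rewrite invr_gt0.
  have [t /SE St /ltW Ht] := sup_adherent i0 hS.
  apply: (le_trans St); apply: le_measure; rewrite ?inE//.
  by move=> x [Ax /= bx]; split => //=; exact: le_trans bx.
Qed.

End median.

(** * Pairing with the commutator *)

Lemma integrable_indic_lty d (T : measurableType d) (R : realType) (mu : {measure set T -> \bar R}) (A : set T) :
  measurable A -> (mu A < +oo)%E -> mu.-integrable setT (EFin \o (\1_A : T -> R)).
Proof.
move=> mA Aoo; apply/integrableP; split.
  by apply/measurable_EFinP; exact: measurable_indic.
rewrite (eq_integral (fun x => (\1_A x)%:E)) ?integral_indic ?setIT// => x _ /=.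
by rewrite ger0_norm// indicE; case: (_ \in _).
Qed.

Section weights.
Context {R : realType} (n k : nat) (b : n.-tuple R -> R).

Lemma pow1D_le (t : R) : 0 <= t -> (1 + t) ^+ k <= 2 ^+ k * (1 + t ^+ k).
Proof.
move=> t0; have tk : 0 <= t ^+ k by rewrite exprn_ge0.
have [t1|t1] := leP t 1.
  apply: (@le_trans _ _ (2 ^+ k)); first by rewrite lerXn2r// ?nnegrE; lra.
  by rewrite ler_peMr ?exprn_ge0// lerDl.
apply: (@le_trans _ _ (2 ^+ k * t ^+ k)).
  by rewrite -exprMn lerXn2r// ?nnegrE; lra.
by rewrite ler_wpM2l ?exprn_ge0// lerDr.
Qed.

Lemma Lloc_weight : Lloc k%:R b -> forall (z : n.-tuple R) d, 0 < d ->
  (mun n).-integrable setT (EFin \o (fun x => (1 + `|b x|) ^+ k * \1_(cube z d) x)).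
Proof.
move=> [mb Hb] z d d0.
pose r := \sum_(j < n) `|tnth z j| + d; pose rad := n%:R * r + 1.
have r0 : 0 <= r by apply: addr_ge0; [apply: sumr_ge0|exact: ltW].
have rad0 : 0 < rad by rewrite ltr_wpDl// mulr_ge0.
have cr x : cube z d x -> vnorm x <= rad.
  move=> cx; apply: (@le_trans _ _ (n%:R * r)); last by rewrite lerDl.
  apply: vnorm_le => j; have := cx j => /ltW H.
  rewrite -(subrK (tnth z j) (tnth x j)); apply: le_trans (ler_normD _ _) _.
  rewrite [leLHS]addrC; apply: lerD => //.
  by rewrite (bigD1 j)//= lerDl; apply: sumr_ge0.
have mc := measurable_cube z d.
have mk : measurable_fun setT (fun y => (1 + `|b y|) ^+ k).
  by apply: measurable_funX; apply: measurable_funD => //; exact: measurableT_comp.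
have mrad : measurable [set x : n.-tuple R | vnorm x <= rad].
  rewrite -[X in measurable X]setTI.
  rewrite (_ : [set x | _] = @vnorm R n @^-1` [set` `]-oo, rad]]); last first.
    by apply/seteqP; split => x /=; rewrite in_itv.
  suff : measurable_fun setT (@vnorm R n) by apply => //; exact: measurable_itv.
  have -> : @vnorm R n = (@Num.sqrt R) \o (fun x => \sum_(j < n) tnth x j ^+ 2) by [].
  apply: measurableT_comp; first by apply: continuous_measurable_fun; exact: sqrt_continuous.
  by apply: measurable_sum => j; apply: measurable_funX; exact: measurable_tnth.
have := Hb rad rad0.
have mB : measurable_fun setT (fun x : n.-tuple R => if vnorm x <= rad then `|b x| `^ k%:R else 0).
  rewrite (_ : (fun x => _) = (fun x => (\1_[set x : n.-tuple R | vnorm x <= rad] x) * `|b x| ^+ k)).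
    apply: measurable_funM; first exact: measurable_indic.
    by apply: measurable_funX; exact: measurableT_comp.
  apply/funext => x; rewrite indicE; case: ifPn => H.
    by rewrite mem_set// mul1r powR_mulrn.
  by rewrite memNset/= ?mul0r//; exact/negP.
rewrite vintE; last 2 first.
- exact/measurable_EFinP.
- by move=> x; rewrite lee_fin; case: ifP => // _; exact: powR_ge0.
move=> fin.
have i1 : (mun n).-integrable setT (EFin \o (fun x : n.-tuple R => if vnorm x <= rad then `|b x| `^ k%:R else 0)).
  apply/integrableP; split; first exact/measurable_EFinP.
  rewrite (eq_integral (fun x => (if vnorm x <= rad then `|b x| `^ k%:R else 0)%:E))// => x _ /=.
  by rewrite ger0_norm//; case: ifP => // _; exact: powR_ge0.
have i2 : (mun n).-integrable setT (EFin \o (\1_(cube z d) : n.-tuple R -> R)).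
  by apply: integrable_indic_lty; [exact: measurable_cube|exact: mun_cube_lty].
have := integrableZl measurableT (2 ^+ k : R) (integrableD measurableT i2 i1).
apply: le_integrable => //.
  by apply/measurable_EFinP; apply: measurable_funM => //; exact: measurable_indic.
move=> x _ /=.
rewrite lee_fin.
have p0 : 0 <= (if vnorm x <= rad then `|b x| `^ k%:R else 0).
  by case: ifP => // _; exact: powR_ge0.
have q0 : 0 <= (\1_(cube z d) x : R) by rewrite indicE.
rewrite (ger0_norm (mulr_ge0 (exprn_ge0 k (addr_ge0 ler01 (normr_ge0 (b x)))) q0)).
rewrite (ger0_norm (mulr_ge0 (exprn_ge0 k (ler0n R 2)) (addr_ge0 q0 p0))).
rewrite indicE; have [xc|xc] := boolP (x \in cube z d).
  rewrite inE in xc; rewrite cr//= mulr1 powR_mulrn//; exact: pow1D_le.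
by rewrite mulr0 mulr_ge0 ?exprn_ge0// add0r.
Qed.

End weights.

Section tuple_Rintegral.
Context d (T : measurableType d) (R : realType).
Variable mu : {sigma_finite_measure set T -> \bar R}.

Lemma Rintegral_tuple_prod n (g : 'I_n -> T -> R) :
  (forall i, mu.-integrable setT (EFin \o g i)) -> (forall i x, 0 <= g i x) ->
  Rintegral (tuple_measure mu n) setT (fun t => \prod_(i < n) g i (tnth t i)) =
  \prod_(i < n) Rintegral mu setT (g i).
Proof.
move=> ig g0; rewrite /Rintegral integral_tuple_prod//; last first.
  by move=> i; apply/measurable_EFinP; exact: measurable_int (ig i).
under eq_bigr => i _ do rewrite -(fineK (integrable_fin_num measurableT (ig i))).
by rewrite prodEFin.
Qed.

End tuple_Rintegral.

Section pairing.
Context {R : realType} (m n : nat) (K : @vec R n -> @ktuple R m n -> R[i]) (C : R) (b : n.-tuple R -> R).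
Hypothesis K_size : forall x y, offdiag x y -> cabs (K x y) <= C / ssum x y ^+ (m * n).
Hypothesis C0 : 0 <= C.
Hypothesis mReK : forall x, measurable_fun [set y | offdiag x y] (fun y : m.-tuple (n.-tuple R) => complex.Re (K x y)).
Hypothesis mImK : forall x, measurable_fun [set y | offdiag x y] (fun y : m.-tuple (n.-tuple R) => complex.Im (K x y)).
Hypothesis mb : measurable_fun setT b.
Variables (i0 : 'I_m) (k : nat).
Hypothesis b_loc : forall (z : n.-tuple R) d, 0 < d ->
  (mun n).-integrable setT (EFin \o (fun x => (1 + `|b x|) ^+ k * \1_(cube z d) x)).

(** Only the first slot interacts with [b]: there [f] approximates the part of the cube where b -
    alpha has the chosen sign, whereas [phi] merely has to carry half of the mass of the cube. *)
Definition slot_fam (f phi : n.-tuple R -> R) : 'I_m -> n.-tuple R -> R :=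
  fun i => if i == i0 then f else phi.

Variables (z z' : n.-tuple R) (d c S : R) (t : R[i]).
Hypothesis d0 : 0 < d.
Hypothesis c_gt0 : 0 < c.
Hypothesis S_gt0 : 0 < S.
Hypothesis t1 : cabs t <= 1.
Hypothesis sep : forall x y, cube z' d x -> cube z d y -> d <= vnorm (vsub x y).
Hypothesis K_near : forall x (y : m.-tuple (n.-tuple R)), cube z' d x -> (forall i, cube z d (tnth y i)) ->
      c / d ^+ (m * n) <= complex.Re (t * K x y) /\ cabs (K x y) <= S / d ^+ (m * n).
Variables (f phi : n.-tuple R -> R).
Hypothesis mf : measurable_fun setT f.
Hypothesis mphi : measurable_fun setT phi.
Hypothesis f01 : forall x, 0 <= f x <= 1.
Hypothesis phi01 : forall x, 0 <= phi x <= 1.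
Hypothesis f_out : forall x, ~ cube z d x -> f x = 0.
Hypothesis phi_out : forall x, ~ cube z d x -> phi x = 0.

Let v := (2 * d) ^+ n.
Let g := slot_fam f phi.
Let W y := (1 + `|b y|) ^+ k.
Let Kr x y := complex.Re (t * K x y).

Lemma slot_fam_meas i : measurable_fun setT (g i).
Proof. by rewrite /g /slot_fam; case: ifP. Qed.

Lemma slot_fam_out_supp x : cube z' d x -> forall i, out_supp (rfun g i) x.
Proof.
move=> xz i; exists d => // y yx; rewrite /rfun /toC /g /slot_fam.
have ny : ~ cube z d y by move/(sep xz); rewrite vnorm_subC leNgt yx.
by case: ifP => _; rewrite ?f_out ?phi_out.
Qed.

Lemma unit_cube_integrable (h : n.-tuple R -> R) : measurable_fun setT h -> (forall x, 0 <= h x <= 1) ->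
   (forall x, ~ cube z d x -> h x = 0) -> (mun n).-integrable setT (EFin \o h).
Proof.
move=> mh h01 hout; apply: (@le_integrable _ _ _ _ _ measurableT _ (EFin \o (\1_(cube z d) : n.-tuple R -> R))).
- exact/measurable_EFinP.
- move=> x _ /=; rewrite lee_fin indicE; have /andP[h0 h1] := h01 x.
  rewrite !ger0_norm//; have [_|/negP xc] := boolP (x \in _) => //=.
  by rewrite hout// => H; apply: xc; rewrite inE.
- by apply: integrable_indic_lty; [exact: measurable_cube|exact: mun_cube_lty].
Qed.

Lemma slot_fam_integrable i : (mun n).-integrable setT (EFin \o g i).
Proof.
by rewrite /g /slot_fam; case: ifP => _; exact: unit_cube_integrable.
Qed.

Lemma slot_fam_wintegrable : wintegrable b k (g i0).
Proof.
rewrite /wintegrable /g /slot_fam eqxx.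
apply: le_integrable (b_loc z d0) => //.
  apply/measurable_EFinP; apply: measurable_funM => //; apply: measurable_funX.
  by apply: measurable_funD => //; exact: measurableT_comp.
move=> x _ /=; rewrite lee_fin !normrM ler_wpM2l//; have /andP[h0 h1] := f01 x.
rewrite indicE !ger0_norm//; have [_|/negP xc] := boolP (x \in _) => //=.
by rewrite f_out// => H; apply: xc; rewrite inE.
Qed.

Lemma Kr_le x y : `|Kr x y| <= cabs (K x y).
Proof.
apply: le_trans (Re_le_cabs _) _; rewrite cabsM ler_piMl//; exact: cabs_ge0.
Qed.

Lemma measurable_Kr x : measurable_fun [set y | offdiag x y] (Kr x).
Proof.
rewrite (_ : Kr x = fun y => complex.Re t * complex.Re (K x y) - complex.Im t * complex.Im (K x y)); last first.
  by apply/funext => y; rewrite /Kr; case: t => t2 t3; case: (K x y).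
by apply: measurable_funB; apply: measurable_funM.
Qed.

Lemma kint_phase x : cube z' d x ->
  complex.Re (t * Complex (kint b i0 (fun y => complex.Re (K x y)) k g x)
                          (kint b i0 (fun y => complex.Im (K x y)) k g x)) = kint b i0 (Kr x) k g x.
Proof.
move=> xz.
have [og] : exists i, out_supp (rfun g i) x by exists i0; exact: slot_fam_out_supp.
move=> ogi; have oge := ex_intro (fun i => out_supp (rfun g i) x) _ ogi.
have hb : measurable_fun setT (fun y => (b x - b y) ^+ k).
  by apply: measurable_funX; exact: measurable_funB.
have hc : exists c, forall y, `|(b x - b y) ^+ k| <= c * (1 + `|b y|) ^+ k.
  by exists ((1 + `|b x|) ^+ k) => y; rewrite normrX; exact: weight_le.
have iR := integrable_kernel_weight K_size C0 (fun y => Re_le_cabs (K x y)) (@mReK x)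
  slot_fam_meas (fun i _ => slot_fam_integrable i) slot_fam_wintegrable oge hb hc.
have iI := integrable_kernel_weight K_size C0 (fun y => Im_le_cabs (K x y)) (@mImK x)
  slot_fam_meas (fun i _ => slot_fam_integrable i) slot_fam_wintegrable oge hb hc.
rewrite (_ : complex.Re _ = complex.Re t * kint b i0 (fun y => complex.Re (K x y)) k g x -
    complex.Im t * kint b i0 (fun y => complex.Im (K x y)) k g x); last by case: (t).
rewrite /kint -!RintegralZl// -RintegralB//; last 2 first.
- have := integrableZl measurableT (complex.Re t) iR.
  by under eq_fun do rewrite -EFinM.
- have := integrableZl measurableT (complex.Im t) iI.
  by under eq_fun do rewrite -EFinM.
apply: eq_Rintegral => y _; rewrite /Kr; case: t => t2 t3; case: (K x y) => k1 k2 /=; ring.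
Qed.

Variables (E : set (n.-tuple R)) (s alpha eps : R).
Hypothesis mE : measurable E.
Hypothesis E_cube : E `<=` cube z d.
Hypothesis s1 : s = 1 \/ s = -1.
Hypothesis E_side : forall y, E y -> 0 <= s * (b y - alpha).
Hypothesis f_approx : (\int[mun n]_y (W y * \1_(cube z d) y * `|f y - \1_E y|)%:E <= eps%:E)%E.
Hypothesis phi_mass : v / 2 <= Rintegral (mun n) setT phi.

(** On [E], alpha lies between b(x) and b(y), so |b y - b x| >= |b y - alpha|, and the power (- s)^k
    makes the integrand positive. Off [E], where [f] is only small in mean, the crude weight bound
    is used. *)
Let Kr_pointwise x (y : m.-tuple (n.-tuple R)) : cube z' d x -> s * (b x - alpha) <= 0 ->
  (d ^+ (m * n))^-1 * (c * (\1_E (tnth y i0) * `|b (tnth y i0) - alpha| ^+ k * \prod_(i < m) g i (tnth y i)) -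
     S * (1 + `|b x|) ^+ k * (W (tnth y i0) * \1_(~` E) (tnth y i0) * \prod_(i < m) g i (tnth y i)))
  <= (- s) ^+ k * (Kr x y * ((b x - b (tnth y i0)) ^+ k * \prod_(i < m) g i (tnth y i))).
Proof.
move=> xz xs.
have G0 : 0 <= \prod_(i < m) g i (tnth y i).
  by apply: prodr_ge0 => i _; rewrite /g /slot_fam; case: ifP => _; [case/andP: (f01 (tnth y i))|case/andP: (phi01 (tnth y i))].
have [/allP yz|/allPn[i _ /asboolP yi]] := boolP (all (fun i => `[< cube z d (tnth y i) >]) (enum 'I_m)); last first.
  have -> : \prod_(i < m) g i (tnth y i) = 0.
    apply/eqP; rewrite prodf_seq_eq0; apply/hasP; exists i; first exact: mem_index_enum.
    by rewrite /= /g /slot_fam; case: ifP => _; rewrite ?f_out ?phi_out.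
  by rewrite !mulr0 subr0 mulr0.
have {}yz i : cube z d (tnth y i) by apply/asboolP/yz; rewrite mem_enum.
have [K1 K2] := K_near xz yz.
have dm : 0 < d ^+ (m * n) by rewrite exprn_gt0.
set y0 := tnth y i0; set P := \prod_(i < m) _ in G0 *.
suff H : (d ^+ (m * n))^-1 * (c * (\1_E y0 * `|b y0 - alpha| ^+ k) -
     S * ((1 + `|b x|) ^+ k * (W y0 * \1_(~` E) y0))) <= (- s) ^+ k * (Kr x y * (b x - b y0) ^+ k).
  apply: (le_trans _ (le_trans (ler_wpM2r G0 H) _)).
    by rewrite le_eqVlt; apply/orP; left; apply/eqP; ring.
  by rewrite !mulrA.
have -> : (- s) ^+ k * (Kr x y * (b x - b y0) ^+ k) = Kr x y * (s * b y0 - s * b x) ^+ k.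
  by rewrite mulrCA -exprMn; congr (_ * _ ^+ _); ring.
rewrite !indicE in_setC; have [yE|yE] := boolP (y0 \in E) => /=.
  rewrite !mulr0 subr0 mul1r.
  have sb := E_side (set_mem yE).
  have -> : `|b y0 - alpha| = s * (b y0 - alpha).
    by case: s1 sb => ->; rewrite ?mul1r ?mulN1r; [move/ger0_norm|rewrite oppr_ge0 => /ler0_norm].
  rewrite mulrA; apply: ler_pM.
  - by rewrite mulr_ge0// ?invr_ge0 ltW.
  - by rewrite exprn_ge0.
  - by rewrite mulrC.
  - rewrite lerXn2r// ?nnegrE//; lra.
rewrite !mul0r !mulr0 !mulr1 sub0r.
have : `|Kr x y * (s * b y0 - s * b x) ^+ k| <= (d ^+ (m * n))^-1 * (S * ((1 + `|b x|) ^+ k * W y0)).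
  rewrite normrM mulrA; apply: ler_pM => //.
    by apply: (le_trans (Kr_le x y)); rewrite mulrC.
  rewrite normrX (_ : `|_ - _| = `|b x - b y0|); first exact: weight_le.
  by case: s1 => ->; rewrite ?mul1r ?mulN1r; [exact: distrC|rewrite opprK addrC].
by rewrite ler_norml => /andP[+ _]; apply: le_trans; rewrite mulrN.
Qed.

(** [Kr_pointwise] integrated in [y]: the main term sees the exact set [E], and all that is due to
    [f] differing from its indicator is linear in [eps]. The dependence on b(x) is kept and
    integrated over the reference cube later. *)
Lemma pairing_lower x : cube z' d x -> s * (b x - alpha) <= 0 ->
  (c * (v / 2) ^+ m.-1 * Rintegral (mun n) setT (fun y => \1_E y * `|b y - alpha| ^+ k)
   - (c * (1 + `|alpha|) ^+ k + S * (1 + `|b x|) ^+ k) * v ^+ m.-1 * eps) / d ^+ (m * n)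
  <= (- s) ^+ k * kint b i0 (Kr x) k g x.
Proof.
move=> xz xs.
have og : exists i, out_supp (rfun g i) x by exists i0; exact: slot_fam_out_supp.
have W0 y : 0 <= W y by rewrite exprn_ge0// addr_ge0.
have ind0 (A : set (n.-tuple R)) y : 0 <= (\1_A y : R) by rewrite indicE.
have ind1 (A : set (n.-tuple R)) y : (\1_A y : R) <= 1 by rewrite indicE; case: (_ \in _).
have mW : measurable_fun setT W.
  by apply: measurable_funX; apply: measurable_funD => //; exact: measurableT_comp.
have mba : measurable_fun setT (fun y => `|b y - alpha| ^+ k).
  by apply: measurable_funX; apply: measurableT_comp => //; exact: measurable_funB.
have mh1 : measurable_fun setT (fun y => \1_E y * `|b y - alpha| ^+ k).
  by apply: measurable_funM => //; exact: measurable_indic.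
have mh2 : measurable_fun setT (fun y => W y * \1_(~` E) y).
  by apply: measurable_funM => //; apply: measurable_indic; exact: measurableC.
pose h1 y := \1_E y * `|b y - alpha| ^+ k; pose h2 y := W y * \1_(~` E) y.
have h10 y : 0 <= h1 y by rewrite mulr_ge0// exprn_ge0.
have h20 y : 0 <= h2 y by rewrite mulr_ge0.
have h1W y : h1 y <= (1 + `|alpha|) ^+ k * W y.
  rewrite /h1 distrC; apply: le_trans (weight_le _ _ _).
  by rewrite ler_piMl// exprn_ge0.
pose a := (1 + `|alpha|) ^+ k; have a0 : 0 <= a by rewrite exprn_ge0// addr_ge0.
pose a' := (1 + `|b x|) ^+ k; have a'0 : 0 <= a' by rewrite exprn_ge0// addr_ge0.
have g0 i y : 0 <= g i y.
  by rewrite /g /slot_fam; case: ifP => _; [case/andP: (f01 y)|case/andP: (phi01 y)].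
have gi0 : g i0 = f by rewrite /g /slot_fam eqxx.
have igf := slot_fam_wintegrable; have igi := slot_fam_integrable.
have ih1 : (mun n).-integrable setT (EFin \o (fun y => h1 y * f y)).
  rewrite -gi0; apply: (integrable_dom (c := a) mh1 (slot_fam_meas i0) _ igf) => y.
  by rewrite -/(h1 y) (ger0_norm (h10 y)); exact: h1W.
have ih2 : (mun n).-integrable setT (EFin \o (fun y => h2 y * f y)).
  rewrite -gi0; apply: (integrable_dom (c := 1) mh2 (slot_fam_meas i0) _ igf) => y.
  by rewrite -/(h2 y) (ger0_norm (h20 y)) mul1r /h2 ler_piMr.
have ifE : (mun n).-integrable setT (EFin \o (fun y => W y * \1_(cube z d) y * `|f y - \1_E y|)).
  apply: le_integrable (b_loc z d0) => //.
    apply/measurable_EFinP; apply: measurable_funM.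
      by apply: measurable_funM => //; apply: measurable_indic; exact: measurable_cube.
    by apply: measurableT_comp => //; apply: measurable_funB => //; exact: measurable_indic.
  move=> y _ /=; rewrite lee_fin normrM ler_piMr// normr_id.
  by have := f01 y; have := ind0 E y; have := ind1 E y; rewrite ler_norml; lra.
pose e := Rintegral (mun n) setT (fun y => W y * \1_(cube z d) y * `|f y - \1_E y|).
have e0 : 0 <= e by apply: Rintegral_ge0 => y _; rewrite !mulr_ge0.
have eeps : e <= eps.
  by rewrite -lee_fin /e /Rintegral fineK//; exact: integrable_fin_num.
have ih1' : (mun n).-integrable setT (EFin \o h1).
  have := integrableZl measurableT a (b_loc z d0).
  apply: le_integrable => //; first exact/measurable_EFinP.
  move=> y _ /=; rewrite lee_fin (ger0_norm (h10 y)) ger0_norm; last by rewrite !mulr_ge0.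
  rewrite /h1 indicE; have [yE|_] := boolP (y \in E); last by rewrite mul0r !mulr_ge0.
  rewrite (_ : \1_(cube z d) y = 1); last by rewrite indicE mem_set//; apply: E_cube; exact: set_mem.
  by rewrite mulr1 mul1r distrC; exact: weight_le.
(* Replacing the indicator of [E] by [f] costs at most [a] times the weighted L^1 error, because h1
   <= a W. *)
have I1 : Rintegral (mun n) setT h1 <= Rintegral (mun n) setT (fun y => h1 y * f y) + a * e.
  rewrite -RintegralZl// -RintegralD//; last first.
    by have := integrableZl measurableT a ifE; under eq_fun do rewrite -EFinM.
  apply: le_Rintegral => //.
    exact: (integrableD measurableT ih1 (integrableZl measurableT a ifE)).
  move=> y _; have /andP[f0 f1] := f01 y.
  rewrite /h1 !indicE; have [yE|_] := boolP (y \in E) => /=; last first.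
    by rewrite !mul0r add0r !mulr_ge0.
  have -> : y \in cube z d by apply: mem_set; apply: E_cube; exact: set_mem.
  rewrite !mul1r mulr1 (distrC (b y)) (distrC (f y)) (ger0_norm (_ : 0 <= 1 - f y)) ?subr_ge0//.
  have := weight_le k alpha (b y); rewrite -/a -/(W y) => Hw.
  have : 0 <= `|alpha - b y| ^+ k by rewrite exprn_ge0.
  rewrite mulrA; nra.
(* Off [E] the error |f - 1_E| is [f] itself. *)
have I2 : Rintegral (mun n) setT (fun y => h2 y * f y) <= e.
  apply: le_Rintegral => // y _; rewrite /h2 !indicE in_setC.
  have /andP[f0 f1] := f01 y.
  have [_|_] /= := boolP (y \in E); first by rewrite mulr0 mul0r !mulr_ge0.
  rewrite mulr1 subr0 ger0_norm//.
  have [_|/negP yc] := boolP (y \in cube z d); first by rewrite mulr1.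
  by rewrite f_out ?mulr0// => H; apply: yc; rewrite inE.
(* Each slot other than the first contributes the mass of [phi], which lies between v / 2 and v. *)
have prodE (h : n.-tuple R -> R) : measurable_fun setT h -> (forall y, 0 <= h y) ->
   (mun n).-integrable setT (EFin \o (fun y => h y * f y)) ->
   Rintegral (muk m n) setT (fun y => h (tnth y i0) * \prod_(i < m) g i (tnth y i)) =
   Rintegral (mun n) setT (fun y => h y * f y) * (Rintegral (mun n) setT phi) ^+ m.-1.
  move=> mh h0 ih.
  under eq_Rintegral do rewrite -prod_mul0.
  rewrite Rintegral_tuple_prod.
  - rewrite (bigD1 i0)//= {1}/mul0 eqxx gi0; congr (_ * _).
    rewrite (eq_bigr (fun=> Rintegral (mun n) setT phi)); last first.
      by move=> i /negbTE ii; rewrite /mul0 ii /g /slot_fam ii.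
    by rewrite prodr_const cardC1 card_ord.
  - by move=> i; rewrite /mul0; case: eqP => [->|_]; rewrite ?gi0.
  - by move=> i y; rewrite /mul0; case: eqP => _ //; rewrite mulr_ge0.
set Phi := Rintegral (mun n) setT phi in prodE *.
have iphi : (mun n).-integrable setT (EFin \o phi) by exact: unit_cube_integrable.
have ic1 : (mun n).-integrable setT (EFin \o (\1_(cube z d) : n.-tuple R -> R)).
  by apply: integrable_indic_lty; [exact: measurable_cube|exact: mun_cube_lty].
have Phi_v : Phi <= v.
  have -> : v = Rintegral (mun n) setT (\1_(cube z d) : n.-tuple R -> R).
    by rewrite Rintegral_cube.
  apply: le_Rintegral => // y _; have /andP[p0 p1] := phi01 y.
  have [//|/negP yc] := boolP (y \in cube z d).
  by rewrite phi_out// => H; apply: yc; rewrite inE.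
have v0 : 0 < v by rewrite exprn_gt0// mulr_gt0.
have Phi0 : 0 <= Phi by apply: le_trans phi_mass; rewrite divr_ge0// ltW.
have Pm0 : 0 <= Phi ^+ m.-1 by rewrite exprn_ge0.
have Pm1 : (v / 2) ^+ m.-1 <= Phi ^+ m.-1.
  by rewrite lerXn2r// nnegrE// divr_ge0// ltW.
have Pm2 : Phi ^+ m.-1 <= v ^+ m.-1 by rewrite lerXn2r// nnegrE// ltW.
have Phq : forall h : n.-tuple R -> R, measurable_fun setT h -> (exists c, forall y, `|h y| <= c * (1 + `|b y|) ^+ k) ->
   (muk m n).-integrable setT (fun y => (h (tnth y i0) * \prod_(i < m) g i (tnth y i))%:E).
  move=> h mh [c' hc].
  rewrite [X in integrable _ _ X](_ : _ = fun y => (\prod_(i < m) mul0 i0 h g i (tnth y i))%:E); last first.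
    by apply/funext => y; rewrite prod_mul0.
  apply: integrable_tuple_prod => i; rewrite /mul0; case: eqP => [->|_]; last exact: igi.
  exact: (integrable_dom mh (slot_fam_meas i0) hc igf).
have J1 : (muk m n).-integrable setT (fun y => (h1 (tnth y i0) * \prod_(i < m) g i (tnth y i))%:E).
  by apply: Phq => //; exists a => y; rewrite (ger0_norm (h10 y)); exact: h1W.
have J2 : (muk m n).-integrable setT (fun y => (h2 (tnth y i0) * \prod_(i < m) g i (tnth y i))%:E).
  by apply: Phq => //; exists 1 => y; rewrite (ger0_norm (h20 y)) mul1r /h2 ler_piMr.
have J3 : (muk m n).-integrable setT (fun y => (Kr x y * ((b x - b (tnth y i0)) ^+ k * \prod_(i < m) g i (tnth y i)))%:E).
  apply: (integrable_kernel_weight K_size C0 (Kr_le x) (@measurable_Kr x)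
    slot_fam_meas (fun i _ => slot_fam_integrable i) igf og (h := fun y => (b x - b y) ^+ k)).
    by apply: measurable_funX; exact: measurable_funB.
  by exists a' => y; rewrite normrX; exact: weight_le.
set q := (d ^+ (m * n))^-1.
have q0 : 0 < q by rewrite invr_gt0 exprn_gt0.
have cJ1 : (muk m n).-integrable setT (fun y => (c * (h1 (tnth y i0) * \prod_(i < m) g i (tnth y i)))%:E).
  by have := integrableZl measurableT c J1; under eq_fun do rewrite -EFinM.
have cJ2 : (muk m n).-integrable setT (fun y => (S * a' * (h2 (tnth y i0) * \prod_(i < m) g i (tnth y i)))%:E).
  by have := integrableZl measurableT (S * a') J2; under eq_fun do rewrite -EFinM.
have cJ : (muk m n).-integrable setT (fun y => (c * (h1 (tnth y i0) * \prod_(i < m) g i (tnth y i)) -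
    S * a' * (h2 (tnth y i0) * \prod_(i < m) g i (tnth y i)))%:E).
  by have := integrableB measurableT cJ1 cJ2; under eq_fun do rewrite -EFinB.
have main : q * (c * (Rintegral (mun n) setT (fun y => h1 y * f y) * Phi ^+ m.-1) -
     S * a' * (Rintegral (mun n) setT (fun y => h2 y * f y) * Phi ^+ m.-1)) <= (- s) ^+ k * kint b i0 (Kr x) k g x.
  rewrite -(prodE _ mh1 h10 ih1) -(prodE _ mh2 h20 ih2).
  rewrite -[X in q * (X - _)]RintegralZl// -[X in q * (_ - X)]RintegralZl//.
  rewrite -RintegralB// -[X in X <= _]RintegralZl// /kint -[X in _ <= X]RintegralZl//.
  apply: le_Rintegral => //.
  - by have := integrableZl measurableT q cJ; under eq_fun do rewrite -EFinM.
  - by have := integrableZl measurableT ((- s) ^+ k) J3; under eq_fun do rewrite -EFinM.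
  - by move=> y _; exact: Kr_pointwise.
apply: le_trans main; rewrite mulrC ler_wpM2l ?(ltW q0)// -/h1.
set I := Rintegral (mun n) setT h1 in I1 *.
have I0 : 0 <= I by apply: Rintegral_ge0.
set X1 := Rintegral _ _ _ in I1 *; set X2 := Rintegral _ _ _ in I2 *.
rewrite -/a -/a'.
have s_1 : I * (v / 2) ^+ m.-1 <= I * Phi ^+ m.-1 by rewrite ler_wpM2l.
have s_2 : (I - a * e) * Phi ^+ m.-1 <= X1 * Phi ^+ m.-1 by rewrite ler_wpM2r// lerBlDr.
have s_3 : a * e * Phi ^+ m.-1 <= a * eps * v ^+ m.-1.
  by apply: ler_pM => //; rewrite ?mulr_ge0// ler_wpM2l.
have s_4 : X2 * Phi ^+ m.-1 <= eps * v ^+ m.-1.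
  by apply: ler_pM => //; [apply: Rintegral_ge0 => y _; rewrite mulr_ge0//; case/andP: (f01 y)|exact: le_trans eeps].
have t_1 : c * (I * (v / 2) ^+ m.-1 - a * eps * v ^+ m.-1) <= c * (X1 * Phi ^+ m.-1).
  by rewrite ler_wpM2l ?(ltW c_gt0)//; lra.
have t_2 : S * a' * (X2 * Phi ^+ m.-1) <= S * a' * (eps * v ^+ m.-1).
  by rewrite ler_wpM2l// mulr_ge0// ltW.
by apply: le_trans (lerB t_1 t_2); rewrite le_eqVlt; apply/orP; left; apply/eqP; ring.
Qed.

End pairing.

(** * Multilinearity and the Hoelder inequality *)

Section multilinear.
Context {R : realType} (m n : nat).
Implicit Types (T : @op R m n) (f : 'I_m -> @vec R n -> R[i]).

Lemma bmul1_upd (b : @vec R n -> R) f i g :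
  bmul1 b (upd f i g) = upd (bmul1 b f) i (if nat_of_ord i == 0%N then (fun y => toC (b y) * g y) else g).
Proof.
apply/funext => j; rewrite /bmul1 /upd; have [->|//] := eqVneq j i.
by case: ifP.
Qed.

Lemma commutator_multilinear k T b : multilinear T -> multilinear (commutator k T b).
Proof.
move=> Tm; elim: k => //= k IH f i a g h x.
rewrite IH !bmul1_upd; case: ifP => [i0|i0].
  rewrite (_ : (fun y => toC (b y) * (a * g y + h y)) =
    (fun y => a * (toC (b y) * g y) + toC (b y) * h y)); last by apply/funext => y; ring.
  by rewrite IH; ring.
by rewrite IH; ring.
Qed.

Lemma multilinear0 T f i x : multilinear T -> T (upd f i (fun=> 0)) x = 0.
Proof.
move=> Tm; have := Tm f i 1 (fun=> 0) (fun=> 0) x.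
rewrite (_ : (fun y => _) = fun=> 0); last by apply/funext => y; rewrite mulr0 addr0.
by rewrite mul1r => /(congr1 (fun u => u - T (upd f i (fun=> 0)) x)); rewrite subrr addrK.
Qed.

Lemma multilinearZ T f i a g x : multilinear T -> T (upd f i (fun y => a * g y)) x = a * T (upd f i g) x.
Proof.
move=> Tm; have := Tm f i a g (fun=> 0) x; rewrite (multilinear0 f i x Tm) addr0 => <-.
by congr (T (upd f i _) x); apply/funext => y; rewrite addr0.
Qed.

Lemma multilinear_sum T f i (I : Type) (s : seq I) (a : I -> R[i]) (g : I -> @vec R n -> R[i]) x :
  multilinear T ->
  T (upd f i (fun y => \sum_(l <- s) a l * g l y)) x = \sum_(l <- s) a l * T (upd f i (g l)) x.
Proof.
move=> Tm; elim: s => [|l s IH].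
  rewrite big_nil -[RHS](multilinear0 f i x Tm).
  by congr (T (upd f i _) x); apply/funext => y; rewrite big_nil.
rewrite big_cons -IH -Tm; congr (T (upd f i _) x).
by apply/funext => y; rewrite big_cons.
Qed.

Lemma multilinear_scale T f (a : 'I_m -> R[i]) x : multilinear T ->
  T (fun i y => a i * f i y) x = \prod_(i < m) a i * T f x.
Proof.
move=> Tm.
pose mix s : 'I_m -> @vec R n -> R[i] := fun i => if (i < s)%N then (fun y => a i * f i y) else f i.
suff H s : (s <= m)%N -> T (mix s) x = \prod_(i < m | (i < s)%N) a i * T f x.
  have := H m (leqnn _); rewrite (eq_bigl xpredT) => [<-|i]; last exact: ltn_ord.
  by congr (T _ x); apply/funext => i; rewrite /mix ltn_ord.
elim: s => [_|s IH sm].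
  by rewrite big_pred0// mul1r; congr (T _ x); apply/funext.
pose i0 := Ordinal sm.
have -> : mix s.+1 = upd (mix s) i0 (fun y => a i0 * f i0 y).
  apply/funext => i; rewrite /mix /upd ltnS leq_eqVlt -(inj_eq val_inj)/=.
  by case: eqVneq => //= h; have -> : i = i0 by exact: val_inj.
rewrite multilinearZ// (_ : upd (mix s) i0 (f i0) = mix s); last first.
  apply/funext => i; rewrite /mix /upd; have [->|//] := eqVneq i i0.
  by rewrite /= ltnn.
rewrite IH ?(ltnW sm)// mulrA; congr (_ * _).
rewrite [RHS](bigD1 i0)//=; congr (_ * _); apply: eq_bigl => i.
by rewrite ltnS ltn_neqAle -(inj_eq val_inj)/= andbC.
Qed.

End multilinear.

Section norms.
Context {R : realType} (n : nat).
Implicit Types (u : @vec R n -> R[i]) (G : n.-tuple R -> R).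

Lemma measurable_cabs u : cmeas u -> measurable_fun setT (fun x : n.-tuple R => cabs (u x)).
Proof.
move=> [mr mi]; rewrite (_ : (fun x => _) = (@Num.sqrt R) \o (fun x => complex.Re (u x) ^+ 2 + complex.Im (u x) ^+ 2))//.
apply: measurableT_comp; first by apply: continuous_measurable_fun; exact: sqrt_continuous.
by apply: measurable_funD; apply: measurable_funX.
Qed.

Lemma measurable_cabs_powR u r : cmeas u -> measurable_fun setT (fun x : n.-tuple R => (cabs (u x) `^ r)%:E).
Proof.
move=> cu; apply/measurable_EFinP; apply: (measurableT_comp (measurable_powR r)).
exact: measurable_cabs.
Qed.

Lemma lnorm_le u G (r M : R) : 0 < r -> cmeas u -> measurable_fun setT G ->
  (forall x, cabs (u x) <= G x) -> (\int[mun n]_x (G x `^ r)%:E <= M%:E)%E ->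
  (lnorm r%:E u <= (M `^ r^-1)%:E)%E.
Proof.
move=> r0 cu mG uG H; rewrite /lnorm vintE; last 2 first.
- exact: measurable_cabs_powR.
- by move=> x; rewrite lee_fin powR_ge0.
rewrite -poweR_EFin; apply: gt0_ler_poweR; first by rewrite invr_ge0 ltW.
- by rewrite in_itv/= leey andbT; apply: integral_ge0 => x _; rewrite lee_fin powR_ge0.
- rewrite in_itv/= leey andbT; apply: le_trans H; apply: integral_ge0 => x _; rewrite lee_fin powR_ge0//.
apply: le_trans H; apply: ge0_le_integral => //.
- by move=> x _; rewrite lee_fin powR_ge0.
- exact: measurable_cabs_powR.
- by apply/measurable_EFinP; exact: (measurableT_comp (measurable_powR r)).
- by move=> x _; rewrite lee_fin le_powR ?cabs_ge0// ltW.
Qed.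

Lemma hoelder_lnorm u G (q q' M N : R) : 0 < q -> 0 < q' -> q^-1 + q'^-1 = 1 ->
  cmeas u -> measurable_fun setT G -> (forall x, 0 <= G x) ->
  (\int[mun n]_x (G x `^ q')%:E <= M%:E)%E -> 0 <= N -> (lnorm q%:E u <= N%:E)%E ->
  (\int[mun n]_x (G x * cabs (u x))%:E <= (M `^ q'^-1 * N)%:E)%E.
Proof.
move=> q0 q'0 qq' cu mG G0 GM N0 uN.
have mcu := measurable_cabs cu.
have := @hoelder _ _ _ (mun n) G (fun x => cabs (u x)) q' q mG mcu q'0 q0.
rewrite addrC qq' => /(_ erefl) H.
have E1 : ('N[mun n]_1[EFin \o (G \* (fun x => cabs (u x)))%R] = \int[mun n]_x (G x * cabs (u x))%:E)%E.
  rewrite Lnorm1; apply: eq_integral => x _ /=.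
  by rewrite ger0_norm// mulr_ge0// cabs_ge0.
rewrite E1 in H; apply: (le_trans H).
have LE (h : n.-tuple R -> R) r : (forall x, 0 <= h x) ->
   ('N[mun n]_r%:E[EFin \o h] = (\int[mun n]_x (h x `^ r)%:E) `^ r^-1)%E.
  move=> h0; rewrite unlock; congr (_ `^ _)%E; apply: eq_integral => x _ /=.
  by rewrite ger0_norm.
rewrite EFinM; apply: lee_pmul; [exact: Lnorm_ge0|exact: Lnorm_ge0| |].
  rewrite LE// -poweR_EFin; apply: gt0_ler_poweR => //; first by rewrite invr_ge0 ltW.
  - by rewrite in_itv/= leey andbT; apply: integral_ge0 => x _; rewrite lee_fin powR_ge0.
  - by rewrite in_itv/= leey andbT; apply: le_trans GM; apply: integral_ge0 => x _; rewrite lee_fin powR_ge0.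
rewrite LE; last by move=> x; exact: cabs_ge0.
move: uN; rewrite /lnorm vintE//; first exact: measurable_cabs_powR.
by move=> x; rewrite lee_fin powR_ge0.
Qed.

End norms.

(** * Oscillation sums over Carleson families *)

Section helpers.
Context {R : realType}.

Lemma powR_root (r x : R) : 0 < r -> 0 <= x -> (x `^ r^-1) `^ r = x.
Proof. by move=> r0 x0; rewrite -powRrM mulVf ?powRr1// gt_eqF. Qed.

(** Positive exponents matter at x = 0, where [powR] is 1 for exponent 0 and 0 for other
    exponents. *)
Lemma prod_powR (I : Type) (s : seq I) (x : R) (a : I -> R) : (forall i, 0 < a i) ->
  \prod_(i <- s) x `^ a i = x `^ (\sum_(i <- s) a i).
Proof.
move=> a0; elim: s => [|i s IH]; first by rewrite !big_nil powRr0.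
rewrite !big_cons IH powRD//; apply/implyP => /eqP E; exfalso.
have : 0 <= \sum_(j <- s) a j by apply: sumr_ge0 => j _; exact: ltW.
by have := a0 i; lra.
Qed.

Lemma lee_prod_EFin (I : Type) (s : seq I) (F : I -> \bar R) (M : I -> R) :
  (forall i, 0 <= F i)%E -> (forall i, F i <= (M i)%:E)%E ->
  (\prod_(i <- s) F i <= (\prod_(i <- s) M i)%:E)%E.
Proof.
move=> F0 FM; elim: s => [|i s IH]; first by rewrite !big_nil.
by rewrite !big_cons EFinM; apply: lee_pmul => //; apply: prode_ge0 => j _.
Qed.

Lemma Rintegral_sum d (T : measurableType d) (mu : {measure set T -> \bar R}) (I : Type) (s : seq I) (F : I -> T -> R) :
  (forall i, mu.-integrable setT (EFin \o F i)) ->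
  mu.-integrable setT (EFin \o (fun x => \sum_(i <- s) F i x)) /\
  Rintegral mu setT (fun x => \sum_(i <- s) F i x) = \sum_(i <- s) Rintegral mu setT (F i).
Proof.
move=> iF; elim: s => [|i s [IH1 IH2]].
  rewrite big_nil; split.
    rewrite (_ : _ \o _ = cst 0%E); last by apply/funext => x /=; rewrite big_nil.
    exact: integrable0.
  by under eq_Rintegral do rewrite big_nil; rewrite Rintegral_cst// mul0r.
have E : (fun x => \sum_(j <- i :: s) F j x) = (fun x => F i x + \sum_(j <- s) F j x).
  by apply/funext => x; rewrite big_cons.
rewrite E big_cons -IH2; split; last by rewrite RintegralD.
exact: (integrableD measurableT (iF i) IH1).
Qed.

Lemma Re_sum_toC (I : Type) (s : seq I) (a : I -> R) (u : I -> R[i]) (t : R[i]) :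
  complex.Re (t * \sum_(i <- s) toC (a i) * u i) = \sum_(i <- s) a i * complex.Re (t * u i).
Proof.
elim: s => [|i s IH]; first by rewrite !big_nil mulr0.
rewrite !big_cons mulrDr raddfD/= IH; congr (_ + _).
by rewrite mulrCA; case: (t * u i) => x y /=; rewrite mul0r subr0.
Qed.

End helpers.

Section bounded_support.
Context {R : realType} (n : nat).

Lemma cube_bounded (z : n.-tuple R) d : 0 <= d -> exists2 rad, 0 <= rad & forall y : @vec R n, rad < vnorm y -> ~ cube z d y.
Proof.
move=> d0; pose r := \sum_(j < n) `|tnth z j| + d.
have r0 : 0 <= r by apply: addr_ge0 => //; apply: sumr_ge0.
exists (n%:R * r); first by rewrite mulr_ge0.
move=> y ry cy; move: ry; rewrite ltNge => /negP; apply.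
apply: vnorm_le => j; have := cy j => /ltW H.
rewrite -(subrK (tnth z j) (tnth y j)); apply: le_trans (ler_normD _ _) _.
rewrite [leLHS]addrC; apply: lerD => //.
by rewrite (bigD1 j)//= lerDl; apply: sumr_ge0.
Qed.

Lemma Ccinf_toC (h : n.-tuple R -> R) : elem_smooth h -> cpt_supp (fun y : @vec R n => toC (h y)) ->
  Ccinf (fun y : @vec R n => toC (h y)).
Proof.
move=> sh ch; split; first exact: elem_smooth_rsmooth.
by split => //; apply: elem_smooth_rsmooth; exact: elem_smooth_cst.
Qed.

Lemma cpt_supp_cubes (J : nat) (z : 'I_J -> n.-tuple R) (d : 'I_J -> R) (h : n.-tuple R -> R) :
  (forall l, 0 <= d l) -> (forall y, (forall l, ~ cube (z l) (d l) y) -> h y = 0) ->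
  cpt_supp (fun y : @vec R n => toC (h y)).
Proof.
move=> d0 hz.
(* The [exists2] is repacked as an existential conjunction so that [choice] can pick one radius per
   cube. *)
have [rad Hrad] := choice (fun l => (let: ex_intro2 r r0 H := cube_bounded (z l) (d0 l) in ex_intro (fun r => 0 <= r /\ forall y : @vec R n, r < vnorm y -> ~ cube (z l) (d l) y) r (conj r0 H))).
exists (\sum_(l < J) rad l) => y Hy; rewrite hz// => l.
apply: (Hrad l).2; apply: le_lt_trans Hy; rewrite (bigD1 l)//= lerDl.
by apply: sumr_ge0 => i _; exact: (Hrad i).1.
Qed.

End bounded_support.

Section commutator_pairing.
Context {R : realType} (n m : nat) (p q : R) (ps : 'I_m -> R) (k : nat).
Context (T : @op R m n) (K : @vec R n -> @ktuple R m n -> R[i]) (C Cb : R) (b : n.-tuple R -> R).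
Hypothesis q1 : 1 < q.
Hypothesis qp : q < p.
Hypothesis ps1 : forall i, 1 < ps i.
Hypothesis pE : p^-1 = \sum_(i < m) (ps i)^-1.
Hypothesis T_multi : multilinear T.
Hypothesis K_size : forall x y, offdiag x y -> cabs (K x y) <= C / ssum x y ^+ (m * n).
Hypothesis C0 : 0 <= C.
Hypothesis mReK : forall x, measurable_fun [set y | offdiag x y] (fun y : m.-tuple (n.-tuple R) => complex.Re (K x y)).
Hypothesis mImK : forall x, measurable_fun [set y | offdiag x y] (fun y : m.-tuple (n.-tuple R) => complex.Im (K x y)).
Hypothesis T_repr : kernel_repr_ext T K.
Hypothesis mb : measurable_fun setT b.
Hypothesis b_loc : forall (z : n.-tuple R) d, 0 < d ->
  (mun n).-integrable setT (EFin \o (fun x => (1 + `|b x|) ^+ k * \1_(cube z d) x)).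
Variable i0 : 'I_m.
Hypothesis i00 : nat_of_ord i0 = 0%N.
Hypothesis Cb0 : 0 <= Cb.
Hypothesis T_bdd : forall f : 'I_m -> vec n -> R[i], (forall i, Ccinf (f i)) ->
      inLp q%:E (commutator k T b f) /\
      (lnorm q%:E (commutator k T b f) <= Cb%:E * \prod_(i < m) lnorm (ps i)%:E (f i))%E.

Variables (A c S : R).
Hypothesis A1 : 1 <= A.
Hypothesis c0 : 0 < c.
Hypothesis S0 : 0 < S.

Definition is_reference (z : n.-tuple R) (d : R) (z' : n.-tuple R) (t : R[i]) : Prop :=
   [/\ cabs t <= 1, forall j, `|tnth z' j - tnth z j| <= A * d,
    forall x y, cube z' d x -> cube z d y -> d <= vnorm (vsub x y) &
    forall x (y : m.-tuple (n.-tuple R)), cube z' d x -> (forall i, cube z d (tnth y i)) ->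
      c / d ^+ (m * n) <= complex.Re (t * K x y) /\ cabs (K x y) <= S / d ^+ (m * n)].

Let q' := (1 - q^-1)^-1.
Let Tk := commutator k T b.

Let q0 : 0 < q. Proof. exact: lt_trans q1. Qed.
Let q'V : q'^-1 = 1 - q^-1. Proof. by rewrite invrK. Qed.
Let qV1 : q^-1 < 1. Proof. by rewrite invf_lt1. Qed.
Let q'0 : 0 < q'. Proof. by rewrite invr_gt0 subr_gt0. Qed.
Let ps0 i : 0 < ps i. Proof. exact: lt_trans (ps1 i). Qed.

Section configuration.
Variables (J : nat) (z z' : nat -> n.-tuple R) (d alpha beta : nat -> R) (t : nat -> R[i]) (U : nat -> set (n.-tuple R)) (s : R).
Hypothesis s1 : s = 1 \/ s = -1.
Hypothesis d0 : forall j, 0 < d j.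
Hypothesis zref : forall j, is_reference (z j) (d j) (z' j) (t j).
Hypothesis mU : forall j, measurable (U j).
Hypothesis U_cube : forall j, U j `<=` cube (z j) (d j).
Hypothesis beta0 : forall j, 0 <= beta j.
Let V j := (2 * d j) ^+ n.
(** Contains both the cube and its reference cube, whose centre is at most [A * d j] away in each
    coordinate. One dilation thus controls inputs and dual function together. *)
Let As j := cube (z j) ((A + 1) * d j).
Hypothesis half : forall j, ((V j / 2)%:E <= mun n (cube (z' j) (d j) `&` [set x | (s * (b x - alpha j) <= 0)%R]))%E.

Let E j := U j `&` [set y | (0 <= s * (b y - alpha j))%R].
Let I j := Rintegral (mun n) setT (fun y => \1_(E j) y * `|b y - alpha j| ^+ k).

Let msb j : measurable_fun setT (fun y => s * (b y - alpha j)).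
Proof. by apply: measurable_funM => //; exact: measurable_funB. Qed.

Let mE j : measurable (E j).
Proof.
apply: measurableI; first exact: mU.
rewrite -[X in measurable X]setTI.
rewrite (_ : [set y | _] = (fun y => s * (b y - alpha j)) @^-1` `[0, +oo[); first exact: msb.
by apply/seteqP; split => y /=; rewrite in_itv/= andbT.
Qed.

Let F0 j := cube (z' j) (d j) `&` [set x | (s * (b x - alpha j) <= 0)%R].
Let mF0 j : measurable (F0 j).
Proof.
apply: measurableI; first exact: measurable_cube.
rewrite -[X in measurable X]setTI.
rewrite (_ : [set y | _] = (fun y => s * (b y - alpha j)) @^-1` `]-oo, 0]); first exact: msb.
by apply/seteqP; split => y /=; rewrite in_itv/=.
Qed.

Let V0 j : 0 < V j. Proof. by rewrite exprn_gt0// mulr_gt0. Qed.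
Let dA0 j : 0 < (A + 1) * d j. Proof. by rewrite mulr_gt0//; have := A1; lra. Qed.

Let cube_As j : cube (z j) (d j) `<=` As j.
Proof.
by move=> y cy i; apply: (lt_le_trans (cy i)); rewrite ler_peMl ?(ltW (d0 j))//; have := A1; lra.
Qed.

Let cube'_As j : cube (z' j) (d j) `<=` As j.
Proof.
move=> y cy i; have [_ H _ _] := zref j.
rewrite -(subrKA (tnth (z' j) i)); apply: le_lt_trans (ler_normD _ _) _.
by rewrite mulrDl mul1r addrC; apply: ler_ltD; [exact: H|exact: cy].
Qed.

(** The coefficient of [eps] in [pairing_lower], integrated over the reference cube; it does not
    involve [f], [phi] or [eps]. *)
Let Gam j := Rintegral (mun n) setT (fun x => \1_(cube (z' j) (d j)) x *
   ((c * (1 + `|alpha j|) ^+ k + S * (1 + `|b x|) ^+ k) * (V j) ^+ m.-1 / (d j) ^+ (m * n))).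

Variables (eps : R) (f phi : nat -> n.-tuple R -> R).
Hypothesis eps0 : 0 < eps.
Hypothesis sf : forall j, elem_smooth (f j).
Hypothesis f01 : forall j x, 0 <= f j x <= 1.
Hypothesis f_out : forall j x, ~ cube (z j) (d j) x -> f j x = 0.
Hypothesis f_approx : forall j, (\int[mun n]_x ((1 + `|b x|) ^+ k * \1_(cube (z j) (d j)) x * `|f j x - \1_(E j) x|)%:E <= eps%:E)%E.
Hypothesis sphi : forall j, elem_smooth (phi j).
Hypothesis phi01 : forall j x, 0 <= phi j x <= 1.
Hypothesis phi_out : forall j x, ~ cube (z j) (d j) x -> phi j x = 0.
Hypothesis phi_mass : forall j, V j / 2 <= Rintegral (mun n) setT (phi j).

Let mf j : measurable_fun setT (f j). Proof. exact: elem_smooth_measurable. Qed.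
Let mphi j : measurable_fun setT (phi j). Proof. exact: elem_smooth_measurable. Qed.

Let fam j := slot_fam i0 (f j) (phi j).

Let elem_fam j i : elem_smooth (fam j i).
Proof. by rewrite /fam /slot_fam; case: ifP. Qed.
Let fam01 j i y : 0 <= fam j i y <= 1.
Proof. by rewrite /fam /slot_fam; case: ifP. Qed.
Let fam_out j i y : ~ cube (z j) (d j) y -> fam j i y = 0.
Proof. by move=> H; rewrite /fam /slot_fam; case: ifP => _; rewrite ?f_out ?phi_out. Qed.

Lemma fam_repr j : exists N : set (n.-tuple R), [/\ measurable N, mun n N = 0%E &
  forall x, ~ N x -> cube (z' j) (d j) x ->
   complex.Re (t j * Tk (rfun (fam j)) x) = kint b i0 (fun y => complex.Re (t j * K x y)) k (fam j) x].
Proof.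
have [t1 zz sep near] := zref j.
have iU := unit_cube_integrable (d0 j) (z := z j).
have cp i : cpt_supp (rfun (fam j) i).
  apply: (@cpt_supp_cubes _ _ 1 (fun=> z j) (fun=> d j)) => [_|y H]; first exact: ltW.
  by apply: fam_out; exact: (H ord0).
have := @commutator_repr R m n T K C b K_size C0 mReK mImK T_repr mb i0 i00 k (fam j).
case=> [i|i _|i _|||N [mN N0 HN]].
- exact: elem_smooth_measurable.
- apply: iU; [exact: elem_smooth_measurable|exact: fam01|exact: fam_out].
- by apply: Ccinf_toC; [exact: elem_fam|exact: cp].
- exact: cp.
- exact: (slot_fam_wintegrable mb i0 b_loc (d0 j) (phi j) (mf j) (f01 j) (@f_out j)).
exists N; split => // x Nx xz; rewrite /Tk HN//; last first.
  exists i0; exact: (slot_fam_out_supp i0 (d0 j) sep (@f_out j) (@phi_out j)).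
exact: (kint_phase K_size C0 mReK mImK mb i0 b_loc (t j) (d0 j) sep (mf j) (mphi j) (f01 j) (phi01 j) (@f_out j) (@phi_out j) xz).
Qed.

(** With exponent 1/p_i the L^(p_i) norms of all slots are governed by the same sum [X], and the
    product of the weights over the slots is beta^(1/p). *)
Let wt i j := beta j `^ (ps i)^-1.
Let G i (l : 'I_J) y := wt i l * fam l i y.
Let inp (a : 'I_m -> 'I_J -> R) i y := \sum_(l < J) a i l * G i l y.

Let elem_inp a i : elem_smooth (inp a i).
Proof.
rewrite /inp; elim: (index_enum _) => [|l r IH].
  by under eq_fun do rewrite big_nil; exact: elem_smooth_cst.
under eq_fun do rewrite big_cons; apply: elem_smoothD => //.
by do 2 (apply: elem_smoothM; first exact: elem_smooth_cst).
Qed.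

Let Ccinf_inp a i : Ccinf (rfun (inp a) i).
Proof.
apply: Ccinf_toC; first exact: elem_inp.
apply: (@cpt_supp_cubes _ _ J (fun l => z l) (fun l => d l)) => [l|y H]; first exact: ltW.
by rewrite /inp big1// => l _; rewrite /G fam_out ?mulr0//; exact: H.
Qed.

Let u a := Tk (rfun (inp a)).
Let cu a : cmeas (u a). Proof. by have [[]] := T_bdd (Ccinf_inp a). Qed.

Let int_cube_powR j r : 0 < r -> (\int[mun n]_x ((\1_(cube (z' j) (d j)) x) `^ r)%:E <= (V j)%:E)%E.
Proof.
move=> r0; rewrite (eq_integral (fun x => (\1_(cube (z' j) (d j)) x)%:E)); last first.
  by move=> x _; rewrite indicE; case: (_ \in _); rewrite ?powR1// powR0// gt_eqF.
rewrite integral_indic//; last exact: measurable_cube.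
by rewrite setIT [X in (X <= _)%E](mun_cube (z' j) (d0 j)).
Qed.

Let integrable_cube_u a j : (mun n).-integrable setT (EFin \o (fun x => \1_(cube (z' j) (d j)) x * cabs (u a x))).
Proof.
have [[_ fin] _] := T_bdd (Ccinf_inp a).
have l0 : (0 <= lnorm q%:E (u a))%E by exact: poweR_ge0.
have lfin : lnorm q%:E (u a) \is a fin_num by rewrite ge0_fin_numE.
have i0' x : 0 <= (\1_(cube (z' j) (d j)) x : R) by rewrite indicE; case: (_ \in _).
have mi : measurable_fun setT (\1_(cube (z' j) (d j)) : n.-tuple R -> R).
  by apply: measurable_indic; exact: measurable_cube.
have qq' : q^-1 + q'^-1 = 1 by rewrite q'V addrC subrK.
have H := hoelder_lnorm q0 q'0 qq' (cu a) mi i0' (int_cube_powR j q'0) (fine_ge0 l0) _.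
apply/integrableP; split.
  by apply/measurable_EFinP; apply: measurable_funM => //; exact: measurable_cabs.
apply: (@le_lt_trans _ _ (V j `^ q'^-1 * fine (lnorm q%:E (u a)))%:E); last exact: ltry.
rewrite (eq_integral (fun x => (\1_(cube (z' j) (d j)) x * cabs (u a x))%:E)); last first.
  by move=> x _ /=; rewrite ger0_norm// mulr_ge0// cabs_ge0.
by apply: H; rewrite fineK.
Qed.

Variable N : nat -> set (n.-tuple R).
Hypothesis mN : forall j, measurable (N j).
Hypothesis N0 : forall j, mun n (N j) = 0%E.
Hypothesis reprN : forall j x, ~ N j x -> cube (z' j) (d j) x ->
   complex.Re (t j * Tk (rfun (fam j)) x) = kint b i0 (fun y => complex.Re (t j * K x y)) k (fam j) x.

Let F j := F0 j `\` N j.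
Let mF j : measurable (F j). Proof. exact: measurableD. Qed.

Let F_half j : ((V j / 2)%:E <= mun n (F j))%E.
Proof.
apply: (le_trans (half j)).
have -> : cube (z' j) (d j) `&` [set x | (s * (b x - alpha j) <= 0)%R] = F0 j by [].
apply: (@le_trans _ _ (mun n (F j `|` N j))).
  apply: le_measure; rewrite ?inE//; first exact: measurableU.
  by move=> x Fx; have [Nx|Nx] := pselect (N j x); [right|left].
have H : (mun n (F j `|` N j) <= mun n (F j) + mun n (N j))%E by exact: measureU2.
by rewrite N0 adde0 in H.
Qed.

(** Dual test function, with weight beta^(1/q'); (- s)^k is the sign that appears in
    [pairing_lower]. *)
Let h j x := (- s) ^+ k * (beta j `^ q'^-1 * \1_(F j) x).

Let h_le j x : `|h j x| <= beta j `^ q'^-1 * \1_(cube (z' j) (d j)) x.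
Proof.
rewrite /h normrM normrX normrN (_ : `|s| = 1); last by case: s1 => ->; rewrite ?normrN normr1.
rewrite expr1n mul1r normrM (ger0_norm (powR_ge0 _ _)) ler_wpM2l ?powR_ge0//.
rewrite !indicE; have [xF|_] := boolP (x \in F j); last by rewrite normr0.
by rewrite mem_set ?normr1//; move: xF; rewrite inE => -[[]].
Qed.

Let mh j : measurable_fun setT (h j).
Proof. by do 2 (apply: measurable_funM => //); exact: measurable_indic. Qed.

Let Re_u_meas a j : measurable_fun setT (fun x : n.-tuple R => complex.Re (t j * u a x)).
Proof.
rewrite (_ : (fun x => _) = fun x => complex.Re (t j) * complex.Re (u a x) - complex.Im (t j) * complex.Im (u a x)); last first.
  by apply/funext => x; case: (t j) => t2 t3; case: (u a x).
by have [mr mi] := cu a; apply: measurable_funB; apply: measurable_funM.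
Qed.

Let Re_u_le a j x : `|complex.Re (t j * u a x)| <= cabs (u a x).
Proof.
have [t1 _ _ _] := zref j.
by apply: (le_trans (Re_le_cabs _)); rewrite cabsM ler_piMl// cabs_ge0.
Qed.

Let hu_le a j x : `|h j x * complex.Re (t j * u a x)| <= beta j `^ q'^-1 * (\1_(cube (z' j) (d j)) x * cabs (u a x)).
Proof. by rewrite normrM mulrA ler_pM// ?h_le ?Re_u_le. Qed.

Let integrable_hu a j : (mun n).-integrable setT (EFin \o (fun x => h j x * complex.Re (t j * u a x))).
Proof.
have := integrableZl measurableT (beta j `^ q'^-1) (integrable_cube_u a j).
apply: le_integrable => //.
  by apply/measurable_EFinP; apply: measurable_funM => //; exact: Re_u_meas.
move=> x _ /=; rewrite lee_fin; apply: (le_trans (hu_le a j x)); exact: ler_norm.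
Qed.

Let Phi a (j : 'I_J) := Rintegral (mun n) setT (fun x => h j x * complex.Re (t j * u a x)).

Let toC_inp_sum (v : 'I_J -> R) i y : toC (\sum_(l < J) v l * G i l y) = \sum_(l < J) toC (v l) * toC (G i l y).
Proof.
rewrite [RHS](eq_bigr (fun l => toC (v l * G i l y))); last by move=> l _; rewrite toCM.
elim: (index_enum _) => [|l r IH]; first by rewrite !big_nil.
by rewrite !big_cons -IH /toC; apply/eqP; rewrite eq_complex/= addr0 !eqxx.
Qed.

Let inp_set_slot a i v : rfun (inp (set_slot a i v)) =
  upd (rfun (inp a)) i (fun y => \sum_(l < J) toC (v l) * toC (G i l y)).
Proof.
apply/funext => i'; apply/funext => y; rewrite /rfun /upd /inp /set_slot.
have [->|//] := eqVneq i' i.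
exact: toC_inp_sum.
Qed.

Let unit_sum i (l : 'I_J) y : \sum_(l' < J) unit_vec R l l' * G i l' y = G i l y.
Proof.
rewrite (bigD1 l)//= /unit_vec eqxx mul1r big1 ?addr0// => l' /negbTE ->.
by rewrite mul0r.
Qed.

Let inp_unit_slot a i l : rfun (inp (set_slot a i (unit_vec R l))) =
  upd (rfun (inp a)) i (fun y => toC (G i l y)).
Proof.
apply/funext => i'; apply/funext => y; rewrite /rfun /upd /inp /set_slot.
by have [->|//] := eqVneq i' i; rewrite unit_sum.
Qed.

Let Tk_multi : multilinear Tk. Proof. exact: commutator_multilinear. Qed.

Let Phi_linear a i v (j : 'I_J) : Phi (set_slot a i v) j = \sum_l v l * Phi (set_slot a i (unit_vec R l)) j.
Proof.
have uE x : u (set_slot a i v) x = \sum_(l < J) toC (v l) * u (set_slot a i (unit_vec R l)) x.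
  rewrite /u inp_set_slot (@multilinear_sum R m n Tk (rfun (inp a)) i _ _ _ (fun l y => toC (G i l y)))//.
  by apply: eq_bigr => l _; rewrite inp_unit_slot.
rewrite /Phi.
under eq_Rintegral => x _.
  rewrite uE Re_sum_toC mulr_sumr.
  under eq_bigr => l _ do rewrite mulrCA.
  over.
have iv l : (mun n).-integrable setT
    (EFin \o (fun x => v l * (h j x * complex.Re (t j * u (set_slot a i (unit_vec R l)) x)))).
  have := integrableZl measurableT (v l) (integrable_hu (set_slot a i (unit_vec R l)) j).
  by under eq_fun do rewrite -EFinM.
rewrite (Rintegral_sum (index_enum _) iv).2.
by apply: eq_bigr => l _; rewrite RintegralZl.
Qed.

Let r1 := q'^-1 + p^-1.
(** One factor 2^n / 2 for each slot after the first, and one for the half of the reference cube on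
    which the pairing takes place. *)
Let cc := c * (2 ^+ n / 2) ^+ m.

Let m0 : (0 < m)%N. Proof. by have := ltn_ord i0; rewrite i00. Qed.

Let I0 j : 0 <= I j.
Proof. by apply: Rintegral_ge0 => y _; rewrite mulr_ge0 ?exprn_ge0// indicE. Qed.

Let Gam_integrable j : (mun n).-integrable setT (EFin \o (fun x => \1_(cube (z' j) (d j)) x *
   ((c * (1 + `|alpha j|) ^+ k + S * (1 + `|b x|) ^+ k) * (V j) ^+ m.-1 / (d j) ^+ (m * n)))).
Proof.
have ic := integrable_indic_lty (measurable_cube (z' j) (d j)) (mun_cube_lty (z' j) (d0 j)).
have i1 := integrableZl measurableT (c * (1 + `|alpha j|) ^+ k * (V j) ^+ m.-1 / (d j) ^+ (m * n)) ic.
have i2 := integrableZl measurableT (S * (V j) ^+ m.-1 / (d j) ^+ (m * n)) (b_loc (z' j) (d0 j)).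
have := integrableD measurableT i1 i2.
apply: eq_integrable => // x _ /=; rewrite -EFinM -EFinD; congr EFin; ring.
Qed.

(** With the unit vector of [j] in every slot the input weights multiply to beta^(1/p), and the dual
    weight beta^(1/q') completes them to beta^r1. On [F j], at least half of the reference cube,
    [pairing_lower] applies pointwise. *)
Let diag_lower (j : 'I_J) : beta j `^ r1 * (cc * I j - eps * Gam j) <= Phi (fun=> unit_vec R j) j.
Proof.
have [t1 _ sep near] := zref j.
have dm : 0 < d j ^+ (m * n) by rewrite exprn_gt0.
pose B := \prod_(i < m) wt i j.
have B0 : 0 <= B by apply: prodr_ge0 => i _; exact: powR_ge0.
have wB : beta j `^ q'^-1 * B = beta j `^ r1.
  rewrite /B /wt prod_powR; last by move=> i; rewrite invr_gt0.
  rewrite -pE -powRD//; apply/implyP => /eqP E0; exfalso.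
  have : 0 < q'^-1 by rewrite invr_gt0.
  have : 0 < p^-1 by rewrite invr_gt0 (lt_trans q0).
  by lra.
have uE x : u (fun=> unit_vec R j) x = toC B * Tk (rfun (fam j)) x.
  rewrite /u /B -prod_toC -(@multilinear_scale R m n Tk (rfun (fam j)) (fun i => toC (wt i j)))//.
  congr (Tk _ x); apply/funext => i; apply/funext => y.
  by rewrite /rfun /inp unit_sum toCM.
pose kap := c * (V j / 2) ^+ m.-1 * I j / d j ^+ (m * n).
have kap0 : 0 <= kap.
  by rewrite divr_ge0 ?(ltW dm)// !mulr_ge0 ?(ltW c0)// exprn_ge0// divr_ge0// ltW.
pose gam x := (c * (1 + `|alpha j|) ^+ k + S * (1 + `|b x|) ^+ k) * (V j) ^+ m.-1 / (d j) ^+ (m * n).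
have gam0 x : 0 <= gam x.
  have ca : 0 <= (1 + `|alpha j|) ^+ k by rewrite exprn_ge0// addr_ge0.
  have cb : 0 <= (1 + `|b x|) ^+ k by rewrite exprn_ge0// addr_ge0.
  apply: divr_ge0; last exact: ltW.
  apply: mulr_ge0; last by rewrite exprn_ge0// ltW.
  by apply: addr_ge0; apply: mulr_ge0 => //; exact: ltW.
have pt x : beta j `^ r1 * (kap * \1_(F j) x - eps * (\1_(cube (z' j) (d j)) x * gam x)) <=
    h j x * complex.Re (t j * u (fun=> unit_vec R j) x).
  have b0 : 0 <= beta j `^ r1 by exact: powR_ge0.
  rewrite /h !indicE; have [xF|xF] := boolP (x \in F j); last first.
    rewrite !(mulr0, mul0r) sub0r mulrN oppr_le0; apply: mulr_ge0 => //.
    by apply: mulr_ge0; [exact: ltW|apply: mulr_ge0].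
  have [[xz xs] Nx] := set_mem xF.
  rewrite mem_set//= !mulr1 mul1r uE.
  rewrite (_ : complex.Re (t j * (toC B * Tk (rfun (fam j)) x)) = B * complex.Re (t j * Tk (rfun (fam j)) x)); last first.
    by rewrite mulrCA; case: (t j * _) => v1 v2 /=; rewrite mul0r subr0.
  rewrite reprN//.
  have Ec : E j `<=` cube (z j) (d j) by move=> y [/U_cube].
  have Es y : E j y -> 0 <= s * (b y - alpha j) by case.
  have H := pairing_lower K_size C0 mReK mImK mb i0 b_loc (d0 j) c0 S0 t1 sep near
     (mf j) (mphi j) (f01 j) (phi01 j) (@f_out j) (@phi_out j)
     (mE j) Ec s1 Es (f_approx j) (phi_mass j) xz xs.
  apply: le_trans (ler_wpM2l b0 _) _.
    apply: le_trans H; rewrite le_eqVlt; apply/orP; left; apply/eqP; rewrite /kap /gam /V /I; ring.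
  by rewrite -wB le_eqVlt; apply/orP; left; apply/eqP; rewrite /fam; ring.
have icF : (mun n).-integrable setT (EFin \o (\1_(F j) : n.-tuple R -> R)).
  apply: integrable_indic_lty => //; apply: le_lt_trans (mun_cube_lty (z' j) (d0 j)).
  by apply: le_measure; rewrite ?inE//; [exact: measurable_cube|move=> x [[]]].
have i1 : (mun n).-integrable setT (EFin \o (fun x => kap * \1_(F j) x)).
  by have := integrableZl measurableT kap icF; under eq_fun do rewrite -EFinM.
have i2 : (mun n).-integrable setT (EFin \o (fun x => eps * (\1_(cube (z' j) (d j)) x * gam x))).
  by have := integrableZl measurableT eps (Gam_integrable j); under eq_fun do rewrite -EFinM.
have i3 := integrableB measurableT i1 i2.
apply: (@le_trans _ _ (Rintegral (mun n) setT (fun x => beta j `^ r1 * (kap * \1_(F j) x - eps * (\1_(cube (z' j) (d j)) x * gam x))))).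
  rewrite RintegralZl//.
  rewrite ler_wpM2l ?powR_ge0// RintegralB//.
  rewrite [X in _ <= X - _]RintegralZl// [X in _ <= _ - X]RintegralZl//.
  rewrite lerB//.
  have Fh : V j / 2 <= Rintegral (mun n) setT (\1_(F j) : n.-tuple R -> R).
    rewrite -lee_fin /Rintegral fineK; last exact: integrable_fin_num.
    by rewrite integral_indic// setIT; exact: F_half.
  apply: le_trans (ler_wpM2l kap0 Fh).
  rewrite le_eqVlt; apply/orP; left; apply/eqP; rewrite /kap /cc.
  have -> : c * (V j / 2) ^+ m.-1 * I j / d j ^+ (m * n) * (V j / 2) =
      c * ((V j / 2) ^+ m.-1 * (V j / 2)) / d j ^+ (m * n) * I j by ring.
  rewrite -exprSr prednK//.
  have -> : (V j / 2) ^+ m = (2 ^+ n / 2) ^+ m * d j ^+ (m * n).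
    have -> : V j / 2 = 2 ^+ n / 2 * d j ^+ n by rewrite /V exprMn mulrAC.
    by rewrite exprMn -exprM (mulnC n).
  by field; rewrite gt_eqF// exprn_gt0.
apply: le_Rintegral => //.
exact: (integrableZl measurableT (beta j `^ r1) i3).
Qed.

Let VA j := (2 * ((A + 1) * d j)) ^+ n.
Let X := \sum_(j < J) beta j * VA j.
Variable CC : R.
Hypothesis CC0 : 0 <= CC.
Hypothesis carl : forall r, (r = (1 - q^-1)^-1 \/ exists i, r = ps i) -> forall lam : nat -> R, (forall j, 0 <= lam j) ->
  (\int[mun n]_x ((\sum_(j < J) lam j * \1_(cube (z j) ((A + 1) * d j)) x) `^ r)%:E
   <= (CC * \sum_(j < J) lam j `^ r * (2 * ((A + 1) * d j)) ^+ n)%:E)%E.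

Let carl_root r : 0 < r -> (r = q' \/ exists i, r = ps i) ->
  (\int[mun n]_x ((\sum_(j < J) beta j `^ r^-1 * \1_(As j) x) `^ r)%:E <= (CC * X)%:E)%E.
Proof.
move=> r0 Hr; have := carl Hr (fun j => powR_ge0 (beta j) r^-1).
by under [X in (_ <= (_ * X)%:E)%E]eq_bigr => j _ do rewrite powR_root//.
Qed.

Let measurable_sum_indic (r : R) : measurable_fun setT (fun x => \sum_(j < J) beta j `^ r * \1_(As j) x).
Proof.
apply: measurable_sum => j; apply: measurable_funM => //.
by apply: measurable_indic; exact: measurable_cube.
Qed.

Let sum_indic_ge0 (r : R) x : 0 <= \sum_(j < J) beta j `^ r * \1_(As j) x.
Proof. by apply: sumr_ge0 => j _; rewrite mulr_ge0 ?powR_ge0// indicE. Qed.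

Let cmeas_toC (g : n.-tuple R -> R) : measurable_fun setT g -> cmeas (fun y : @vec R n => toC (g y)).
Proof. by move=> mg; split => //; exact: measurable_cst. Qed.

Let inp_lnorm (e : 'I_m -> 'I_J -> bool) i :
  (lnorm (ps i)%:E (rfun (inp (fun i l => (-1) ^+ e i l)%R) i) <= ((CC * X) `^ (ps i)^-1)%:E)%E.
Proof.
apply: (@lnorm_le R n _ (fun x => \sum_(j < J) beta j `^ (ps i)^-1 * \1_(As j) x)) => //.
- by apply: cmeas_toC; apply: elem_smooth_measurable.
- move=> x; rewrite /rfun cabs_toC /inp; apply: (le_trans (ler_norm_sum _ _ _)).
  apply: ler_sum => l _; rewrite normrM normrX normrN1 expr1n mul1r /G /wt normrM (ger0_norm (powR_ge0 _ _)).
  rewrite ler_wpM2l ?powR_ge0// indicE; have [xA|xA] := boolP (x \in As l).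
    by have /andP[f0 f1] := fam01 l i x; rewrite ger0_norm.
  rewrite fam_out ?normr0//; move=> xc; move: xA; rewrite mem_set//; exact: cube_As.
- by apply: carl_root => //; right; exists i.
Qed.

Let X0 : 0 <= X.
Proof. by apply: sumr_ge0 => j _; rewrite mulr_ge0// exprn_ge0// mulr_ge0// ltW. Qed.

(** [multilinear_signs] replaces the diagonal sum by pairings with one commutator, evaluated at
    signed sums whose norms are insensitive to the signs. The exponent [r1] collects 1/q' from
    Hoelder and the 1/p_i from the input norms. *)
Lemma key_sum : \sum_(j < J) beta j `^ r1 * (cc * I j - eps * Gam j) <= Cb * (CC * X) `^ r1.
Proof.
have [e He] := multilinear_signs Phi_linear.
apply: (@le_trans _ _ (\sum_(j < J) Phi (fun=> unit_vec R j) j)).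
  by apply: ler_sum => j _; exact: diag_lower.
apply: (le_trans He).
pose a i l : R := (-1) ^+ e i l.
pose sg (j : 'I_J) : R := \prod_(i < m) (-1) ^+ e i j.
have sg1 j : `|sg j| = 1.
  rewrite /sg; elim: (index_enum _) => [|i r IH]; first by rewrite big_nil normr1.
  by rewrite big_cons normrM IH normrX normrN1 expr1n mul1r.
pose H x := \sum_(j < J) beta j `^ q'^-1 * \1_(As j) x.
have ig j : (mun n).-integrable setT (EFin \o (fun x => sg j * (h j x * complex.Re (t j * u a x)))).
  by have := integrableZl measurableT (sg j) (integrable_hu a j); under eq_fun do rewrite -EFinM.
have [isum sumE] := Rintegral_sum (index_enum _) ig.
rewrite (eq_bigr (fun j => Rintegral (mun n) setT (fun x => sg j * (h j x * complex.Re (t j * u a x))))); last first.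
  by move=> j _; rewrite RintegralZl//; exact: integrable_hu.
rewrite -sumE.
have qq' : q^-1 + q'^-1 = 1 by rewrite q'V addrC subrK.
have uN : (lnorm q%:E (u a) <= (Cb * \prod_(i < m) (CC * X) `^ (ps i)^-1)%:E)%E.
  have [_ /le_trans->//] := T_bdd (Ccinf_inp a).
  rewrite EFinM; apply: lee_wpmul2l; first by rewrite lee_fin.
  apply: lee_prod_EFin => i; first exact: poweR_ge0.
  exact: inp_lnorm.
have N0' : 0 <= Cb * \prod_(i < m) (CC * X) `^ (ps i)^-1.
  by rewrite mulr_ge0// prodr_ge0// => i _; exact: powR_ge0.
have Hc := carl_root q'0 (or_introl erefl).
have := hoelder_lnorm q0 q'0 qq' (cu a) (measurable_sum_indic q'^-1) (sum_indic_ge0 q'^-1) Hc N0' uN.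
have mH : measurable_fun setT (fun x => H x * cabs (u a x)).
  by apply: measurable_funM; [exact: measurable_sum_indic|exact: measurable_cabs].
have H0 x : 0 <= H x * cabs (u a x).
  by rewrite mulr_ge0 ?cabs_ge0//; exact: sum_indic_ge0.
move=> HH.
have iH : (mun n).-integrable setT (EFin \o (fun x => H x * cabs (u a x))).
  apply/integrableP; split; first exact/measurable_EFinP.
  apply: le_lt_trans (ltry _).
  rewrite (eq_integral (fun x => (H x * cabs (u a x))%:E)) => [|x _ /=]; last by rewrite ger0_norm.
  exact: HH.
rewrite -lee_fin /Rintegral fineK; last exact: integrable_fin_num.
apply: (@le_trans _ _ (\int[mun n]_x (H x * cabs (u a x))%:E)%E).
  apply: le_integral => // x _; rewrite lee_fin.
  rewrite /H mulr_suml; apply: ler_sum => j _.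
  apply: (le_trans (ler_norm _)); rewrite normrM sg1 mul1r; apply: (le_trans (hu_le _ _ _)).
  rewrite mulrA ler_wpM2r ?cabs_ge0// ler_wpM2l ?powR_ge0//.
  rewrite !indicE; have [xc|_] := boolP (x \in cube (z' j) (d j)); last by rewrite ler0n.
  by rewrite mem_set//; apply: cube'_As; exact: set_mem.
apply: (le_trans HH); rewrite lee_fin prod_powR; last by move=> i; rewrite invr_gt0.
rewrite -pE mulrCA ler_wpM2l// /r1 powRD//; apply/implyP => /eqP E0; exfalso.
have : 0 < q'^-1 by rewrite invr_gt0.
have : 0 < p^-1 by rewrite invr_gt0 (lt_trans q0).
by lra.
Qed.

End configuration.

Let rr := (q^-1 - p^-1)^-1.

(** [key_sum] is available for every [eps], with fresh smooth functions each time; the integrals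
    over the sign parts, [Gam] and [X] do not depend on them, so [eps] can tend to 0. *)
Lemma key_estimate Lam : 0 < Lam -> exists2 C1, 0 <= C1 &
  forall (J : nat) (z z' : nat -> n.-tuple R) (d alpha beta : nat -> R) (t : nat -> R[i])
    (U : nat -> set (n.-tuple R)) (s : R),
  s = 1 \/ s = -1 -> (forall j, 0 < d j) ->
  (forall j, is_reference (z j) (d j) (z' j) (t j)) ->
  (forall j, measurable (U j)) -> (forall j, U j `<=` cube (z j) (d j)) ->
  (forall j, 0 <= beta j) ->
  (forall j, (((2 * d j) ^+ n / 2)%:E <=
     mun n (cube (z' j) (d j) `&` [set x | (s * (b x - alpha j) <= 0)%R]))%E) ->
  (forall i, (i < J)%N ->
    \sum_(i.+1 <= j < J | `[< cube (z i) ((A + 1) * d i) `&` cube (z j) ((A + 1) * d j) !=set0 >])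
      (2 * ((A + 1) * d j)) ^+ n <= Lam * (2 * ((A + 1) * d i)) ^+ n) ->
  \sum_(j < J) beta j `^ (1 - rr^-1) *
    Rintegral (mun n) setT (fun y => \1_(U j `&` [set y | (0 <= s * (b y - alpha j))%R]) y * `|b y - alpha j| ^+ k)
  <= C1 * (\sum_(j < J) beta j * (2 * ((A + 1) * d j)) ^+ n) `^ (1 - rr^-1).
Proof.
move=> Lam0.
have [Cq Cq0 Hq] := carleson_Lp q'0 Lam0.
have [Ci HCi] := choice (fun i => (let: ex_intro2 Ci Ci0 H := carleson_Lp (ps0 i) Lam0 in ex_intro (fun Ci => 0 < Ci /\ _) Ci (conj Ci0 H))).
(* One constant serving the exponent q' and all the p_i. *)
pose CC := Cq + \sum_i Ci i.
have Ci0 i : 0 <= Ci i by exact: ltW (HCi i).1.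
have CC0 : 0 <= CC by rewrite addr_ge0 ?(ltW Cq0)// sumr_ge0.
have cc0 : 0 < c * (2 ^+ n / 2) ^+ m by rewrite mulr_gt0// exprn_gt0// divr_gt0// exprn_gt0.
have rrE : (1 - q^-1)^-1^-1 + p^-1 = 1 - rr^-1 by rewrite !invrK; ring.
exists ((c * (2 ^+ n / 2) ^+ m)^-1 * (Cb * CC `^ (1 - rr^-1))).
  by rewrite !mulr_ge0 ?powR_ge0// invr_ge0 ltW.
move=> J z z' d alpha beta t U s s1 d0 zref mU Uc beta0 half pack.
have carl r : (r = (1 - q^-1)^-1 \/ exists i, r = ps i) -> forall lam : nat -> R, (forall j, 0 <= lam j) ->
  (\int[mun n]_x ((\sum_(j < J) lam j * \1_(cube (z j) ((A + 1) * d j)) x) `^ r)%:E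
   <= (CC * \sum_(j < J) lam j `^ r * (2 * ((A + 1) * d j)) ^+ n)%:E)%E.
  have dA0 j : 0 < (A + 1) * d j by rewrite mulr_gt0//; have := A1; lra.
  have mA j : measurable (cube (z j) ((A + 1) * d j)) by exact: measurable_cube.
  have mu_cube j : (j < J)%N -> mun n (cube (z j) ((A + 1) * d j)) = ((2 * ((A + 1) * d j)) ^+ n)%:E.
    by move=> _; exact: mun_cube.
  have s0 (lam : nat -> R) r' : 0 <= \sum_(j < J) lam j `^ r' * (2 * ((A + 1) * d j)) ^+ n.
    by apply: sumr_ge0 => j _; rewrite mulr_ge0 ?powR_ge0// exprn_ge0// mulr_ge0// ltW.
  move=> Hr lam lam0; case: Hr => [->|[i ->]].
    apply: le_trans (Hq _ _ (mun n) J _ _ mA mu_cube pack lam lam0) _.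
    by rewrite lee_fin ler_wpM2r// lerDl sumr_ge0.
  apply: le_trans ((HCi i).2 _ _ (mun n) J _ _ mA mu_cube pack lam lam0) _.
  rewrite lee_fin ler_wpM2r// /CC (bigD1 i)//= addrCA lerDl addr_ge0 ?(ltW Cq0)//.
  exact: sumr_ge0.
set X := \sum_(j < J) beta j * _.
pose E j := U j `&` [set y | (0 <= s * (b y - alpha j))%R].
pose Gam j := Rintegral (mun n) setT (fun x => \1_(cube (z' j) (d j)) x *
   ((c * (1 + `|alpha j|) ^+ k + S * (1 + `|b x|) ^+ k) * ((2 * d j) ^+ n) ^+ m.-1 / (d j) ^+ (m * n))).
pose I j := Rintegral (mun n) setT (fun y => \1_(E j) y * `|b y - alpha j| ^+ k).
rewrite -[leLHS]/(\sum_(j < J) beta j `^ (1 - rr^-1) * I j).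
have mE j : measurable (E j).
  apply: measurableI; first exact: mU.
  rewrite -[X in measurable X]setTI.
  rewrite (_ : [set y | _] = (fun y => s * (b y - alpha j)) @^-1` `[0, +oo[).
    by (suff: measurable_fun setT (fun y => s * (b y - alpha j)) by apply);
      apply: measurable_funM => //; exact: measurable_funB.
  by apply/seteqP; split => y /=; rewrite in_itv/= andbT.
have Ec j : E j `<=` cube (z j) (d j) by move=> y [/Uc].
have key eps : 0 < eps ->
    \sum_(j < J) beta j `^ (1 - rr^-1) * (c * (2 ^+ n / 2) ^+ m * I j - eps * Gam j) <= Cb * (CC * X) `^ (1 - rr^-1).
  move=> e0.
  have W0 x : 0 <= (1 + `|b x|) ^+ k by rewrite exprn_ge0// addr_ge0.
  have [f Hf] := choice (fun j => smooth_approx (d0 j) W0 (b_loc (z j) (d0 j)) (mE j) (Ec j) e0).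
  have f01 j x : 0 <= f j x <= 1 by have [_ H _ _] := Hf j.
  have f_out j x : ~ cube (z j) (d j) x -> f j x = 0 by have [_ _ H _] := Hf j; exact: H.
  have phiP j : exists phi : n.-tuple R -> R, [/\ elem_smooth phi, forall x, 0 <= phi x <= 1,
      forall x, ~ cube (z j) (d j) x -> phi x = 0 & (2 * d j) ^+ n / 2 <= Rintegral (mun n) setT phi].
    have V0 : 0 < (2 * d j) ^+ n by rewrite exprn_gt0// mulr_gt0.
    have V2 : 0 < (2 * d j) ^+ n / 2 by rewrite divr_gt0.
    have mc := measurable_cube (z j) (d j).
    have ic := integrable_indic_lty mc (mun_cube_lty (z j) (d0 j)).
    have ic1 : (mun n).-integrable setT (EFin \o (fun x => (fun=> 1) x * \1_(cube (z j) (d j)) x)).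
      by apply: eq_integrable ic => // x _ /=; rewrite mul1r.
    (* Approximating the whole cube, without weight, within half of its volume leaves at least half
       of the mass. *)
    have [phi [sp p01 pout papp]] := smooth_approx (d0 j) (fun _ => ler01) ic1 mc (@subset_refl _ _) V2.
    exists phi; split => //.
    have ip := unit_cube_integrable (d0 j) (elem_smooth_measurable sp) p01 pout.
    have id : (mun n).-integrable setT (EFin \o (fun x => (\1_(cube (z j) (d j)) x - phi x))).
      exact: (integrableB measurableT ic ip).
    have : Rintegral (mun n) setT (fun x => \1_(cube (z j) (d j)) x - phi x) <= (2 * d j) ^+ n / 2.
      rewrite -lee_fin /Rintegral fineK; last exact: integrable_fin_num.
      apply: le_trans papp; apply: le_integral => //.
        apply: eq_integrable (integrable_norm id) => // x _ /=.
        rewrite indicE; have [xc|xc] := boolP (x \in _); first by rewrite mulr1 mul1r distrC.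
        by rewrite mulr0 mul0r pout ?subr0 ?normr0// => xc'; move: xc; rewrite mem_set.
      move=> x _; rewrite lee_fin mul1r.
      rewrite indicE; have [xc|xc] := boolP (x \in _); first by rewrite mul1r distrC ler_norm.
      by rewrite mul0r pout ?subr0// => xc'; move: xc; rewrite mem_set.
    rewrite RintegralB//.
    have -> : Rintegral (mun n) setT (\1_(cube (z j) (d j))) = (2 * d j) ^+ n.
      by rewrite /Rintegral integral_indic// setIT [X in fine X](mun_cube (z j) (d0 j)).
    lra.
  have [phi Hphi] := choice phiP.
  have p01 j x : 0 <= phi j x <= 1 by have [_ H _ _] := Hphi j.
  have p_out j x : ~ cube (z j) (d j) x -> phi j x = 0 by have [_ _ H _] := Hphi j; exact: H.
  have sf j : elem_smooth (f j) by case: (Hf j).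
  have sp j : elem_smooth (phi j) by case: (Hphi j).
  have [N HN] := choice (fam_repr d0 zref sf f01 f_out sp p01 p_out).
  rewrite -rrE; apply: (key_sum s1 d0 zref mU Uc beta0 half e0 sf f01 f_out _ sp p01 p_out _ _ _ _ carl (N := N)) => //.
  - by move=> j; case: (Hf j).
  - by move=> j; case: (Hphi j).
  - by move=> j; case: (HN j).
  - by move=> j; case: (HN j).
  - by move=> j; case: (HN j).
have X0 : 0 <= X by apply: sumr_ge0 => j _; rewrite mulr_ge0// exprn_ge0// !mulr_ge0// ?(ltW (d0 _))//; have := A1; lra.
rewrite -mulrA ler_pdivlMl// -[leRHS]mulrA -powRM//.
pose G := \sum_(j < J) beta j `^ (1 - rr^-1) * Gam j.
have G0 : 0 <= G.
  apply: sumr_ge0 => j _; rewrite mulr_ge0 ?powR_ge0//; apply: Rintegral_ge0 => x _.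
  have ca : 0 <= (1 + `|alpha j|) ^+ k by rewrite exprn_ge0// addr_ge0.
  have cb : 0 <= (1 + `|b x|) ^+ k by rewrite exprn_ge0// addr_ge0.
  rewrite mulr_ge0 ?indicE// divr_ge0 ?exprn_ge0// ?(ltW (d0 _))//.
  rewrite mulr_ge0 ?exprn_ge0// ?mulr_ge0 ?(ltW (d0 _))//.
  by apply: addr_ge0; apply: mulr_ge0 => //; exact: ltW.
apply/ler_addgt0Pr => e e0.
(* With this [eps] the total error is at most [e], also when [G] is 0. *)
have eG : 0 < e / (G + 1) by rewrite divr_gt0// ltr_wpDl.
have := key _ eG; rewrite (eq_bigr (fun j : 'I_J => c * (2 ^+ n / 2) ^+ m * (beta j `^ (1 - rr^-1) * I j) - e / (G + 1) * (beta j `^ (1 - rr^-1) * Gam j))); last by move=> j _; ring.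
rewrite sumrB -!mulr_sumr -/G => H.
have : e / (G + 1) * G <= e by rewrite -mulrA ler_piMr ?(ltW e0)// mulrC ler_pdivrMr ?ltr_wpDl// mul1r lerDl.
lra.
Qed.

(** The median is taken over a reference cube of [(z, d)], not over the cube itself. Hiding the
    reference cube and the phase leaves a number attached to [z] and [d], all that the stopping
    argument sees. *)
Definition is_reference_median (z : n.-tuple R) (d a : R) : Prop := exists z' t,
  [/\ is_reference z d z' t,
     (((2 * d) ^+ n / 2)%:E <= mun n (cube z' d `&` [set x | (b x <= a)%R]))%E
   & (((2 * d) ^+ n / 2)%:E <= mun n (cube z' d `&` [set x | (a <= b x)%R]))%E].

Lemma reference_median z d z' t : 0 < d -> is_reference z d z' t ->
  exists a, is_reference_median z d a.
Proof.
move=> d0 H; have V0 : 0 < (2 * d) ^+ n by rewrite exprn_gt0// mulr_gt0.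
have [a [a1 a2]] := median mb (measurable_cube z' d) (mun_cube z' d0) V0.
by exists a, z', t.
Qed.

Let rr_gt1 : 1 < rr.
Proof.
have p0 : 0 < p by exact: lt_trans qp.
have V : 0 < q^-1 - p^-1 by rewrite subr_gt0 ltf_pV2.
by rewrite /rr invf_gt1//; have := qV1; have : 0 < p^-1 by [rewrite invr_gt0]; lra.
Qed.

(* Taking [beta] to be the oscillation to the power [rr] turns [key_estimate] into
   [X <= const * X `^ (1 - rr^-1)]. *)
Lemma oscillation_sum Lam : 0 < Lam -> exists2 C2, 0 <= C2 &
  forall (J : nat) (z : nat -> n.-tuple R) (d alpha : nat -> R) (U : nat -> set (n.-tuple R)),
  (forall j, 0 < d j) -> (forall j, is_reference_median (z j) (d j) (alpha j)) ->
  (forall j, measurable (U j)) -> (forall j, U j `<=` cube (z j) (d j)) ->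
  (forall i, (i < J)%N ->
    \sum_(i.+1 <= j < J | `[< cube (z i) ((A + 1) * d i) `&` cube (z j) ((A + 1) * d j) !=set0 >])
      d j ^+ n <= Lam * d i ^+ n) ->
  \sum_(j < J) (Rintegral (mun n) setT (fun y => \1_(U j) y * `|b y - alpha j| ^+ k) / d j ^+ n) `^ rr * d j ^+ n
  <= C2.
Proof.
move=> Lam0; have [C1 C10 H1] := key_estimate Lam0.
pose B := (2 * (A + 1)) ^+ n.
have B0 : 0 < B by rewrite exprn_gt0//; have := A1; lra.
have VAE x : (2 * ((A + 1) * x)) ^+ n = B * x ^+ n by rewrite mulrA exprMn.
have rr0 : 0 < rr by exact: lt_trans rr_gt1.
(* The 2 counts the two signs and [B] compares dilated volumes with d^n; the outer power solves
   Y^(1/rr) <= const. *)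
exists ((2 * C1 * B `^ (1 - rr^-1)) `^ rr); first exact: powR_ge0.
move=> J z d alpha U d0 med mU Uc pack.
have [z' /choice[t zt]] := choice med.
pose O j := Rintegral (mun n) setT (fun y => \1_(U j) y * `|b y - alpha j| ^+ k).
have O0 j : 0 <= O j by apply: Rintegral_ge0 => y _; rewrite mulr_ge0 ?exprn_ge0// indicE.
have dn j : 0 < d j ^+ n by exact: exprn_gt0.
pose o j := O j / d j ^+ n.
have o0 j : 0 <= o j by rewrite divr_ge0// ltW.
pose beta j := o j `^ rr.
pose Y := \sum_(j < J) beta j * d j ^+ n.
have Y0 : 0 <= Y by apply: sumr_ge0 => j _; rewrite mulr_ge0 ?powR_ge0// ltW.
rewrite -[leLHS]/Y.
pose I s j := Rintegral (mun n) setT (fun y => \1_(U j `&` [set y | (0 <= s * (b y - alpha j))%R]) y * `|b y - alpha j| ^+ k).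
have key s : s = 1 \/ s = -1 -> \sum_(j < J) beta j `^ (1 - rr^-1) * I s j <= C1 * (B * Y) `^ (1 - rr^-1).
  move=> s1; have -> : B * Y = \sum_(j < J) beta j * (2 * ((A + 1) * d j)) ^+ n.
    by rewrite /Y mulr_sumr; apply: eq_bigr => j _; rewrite VAE mulrCA.
  apply: (H1 J z z' d alpha beta t U s s1) => //.
  - by move=> j; case: (zt j).
  - by move=> j; exact: powR_ge0.
  - move=> j; have [_ h1 h2] := zt j.
    case: s1 => ->.
      rewrite (_ : [set x | _] = [set x | (b x <= alpha j)%R])//.
      by apply/seteqP; split => x /=; lra.
    rewrite (_ : [set x | _] = [set x | (alpha j <= b x)%R])//.
    by apply/seteqP; split => x /=; lra.
  move=> i iJ; rewrite VAE mulrCA (eq_bigr (fun j => B * d j ^+ n)) -?mulr_sumr; last by move=> j _; rewrite VAE.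
  by rewrite ler_wpM2l ?(ltW B0)//; exact: pack.
(* The two sign parts cover [U j], overlapping where b equals alpha. *)
have split_O j : O j <= I 1 j + I (- 1) j.
  have mUb s : measurable (U j `&` [set y | (0 <= s * (b y - alpha j))%R]).
    apply: measurableI; first exact: mU.
    rewrite -[X in measurable X]setTI.
    rewrite (_ : [set y | _] = (fun y => s * (b y - alpha j)) @^-1` `[0, +oo[).
      by (suff: measurable_fun setT (fun y => s * (b y - alpha j)) by apply);
        apply: measurable_funM => //; exact: measurable_funB.
    by apply/seteqP; split => y /=; rewrite in_itv/= andbT.
  have iw := integrableZl measurableT ((1 + `|alpha j|) ^+ k) (b_loc (z j) (d0 j)).
  have iE (E : set (n.-tuple R)) : measurable E -> E `<=` U j ->
      (mun n).-integrable setT (EFin \o (fun y => \1_E y * `|b y - alpha j| ^+ k)).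
    move=> mE' EU; apply: le_integrable iw => //.
      apply/measurable_EFinP; apply: measurable_funM; first exact: measurable_indic.
      apply: measurable_funX; apply: measurableT_comp => //; exact: measurable_funB.
    move=> y _ /=; rewrite lee_fin indicE.
    have [yE|yE] := boolP (y \in E); last by rewrite mul0r normr0.
    rewrite indicE mem_set; last by apply: Uc; apply: EU; exact: set_mem.
    rewrite mul1r mulr1 -exprMn [leLHS]ger0_norm ?exprn_ge0// [leRHS]ger0_norm; last by rewrite exprn_ge0// mulr_ge0// addr_ge0.
    rewrite lerXn2r ?nnegrE ?mulr_ge0 ?addr_ge0//; apply: le_trans (ler_normB _ _) _.
    have : 0 <= `|alpha j| * `|b y| by rewrite mulr_ge0.
    by lra.
  have i1 := iE _ (mUb 1) (@subIsetl _ _ _).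
  have i2 := iE _ (mUb (-1)) (@subIsetl _ _ _).
  rewrite /I -RintegralD//; apply: le_Rintegral => //.
  - exact: iE (mU j) (@subset_refl _ _).
  - exact: (integrableD measurableT i1 i2).
  move=> y _; rewrite -mulrDl ler_wpM2r ?exprn_ge0// !indicE.
  have [yU|//] := boolP (y \in U j); last by rewrite addr_ge0.
  have [bs|bs] := lerP 0 (b y - alpha j).
    by rewrite mem_set ?lerDl//; split; [exact: set_mem|rewrite /= mul1r].
  rewrite (@mem_set _ (_ `&` [set y | 0 <= -1 * (b y - alpha j)]) y) ?lerDr//.
  by split; [exact: set_mem|rewrite /=; lra].
(* beta^(1 - 1/rr) o = o^(rr - 1) o = o^rr = beta. *)
have YE : Y <= \sum_(j < J) beta j `^ (1 - rr^-1) * O j.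
  apply: ler_sum => j _; rewrite /beta -powRrM mulrBr mulr1 divff ?gt_eqF//.
  rewrite -[X in _ <= _ * X](divfK (lt0r_neq0 (dn j))) -/(o j) mulrA ler_wpM2r ?(ltW (dn j))//.
  have [->|oj] := eqVneq (o j) 0; first by rewrite powR0 ?mulr0// gt_eqF.
  by rewrite -[X in _ <= _ * X]powRr1// -powRD ?subrK// oj implybT.
have : Y <= 2 * C1 * B `^ (1 - rr^-1) * Y `^ (1 - rr^-1).
  apply: (le_trans YE).
  apply: (@le_trans _ _ (\sum_(j < J) beta j `^ (1 - rr^-1) * (I 1 j + I (-1) j))).
    by apply: ler_sum => j _; rewrite ler_wpM2l ?powR_ge0.
  rewrite -mulrA -powRM ?(ltW B0)//.
  under eq_bigr do rewrite mulrDr.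
  rewrite big_split/=; have := key 1 (or_introl erefl); have := key (-1) (or_intror erefl); lra.
(* [Y] is a finite sum of reals, so if it is nonzero its power can be divided out. *)
have [->|Yn0] := eqVneq Y 0; first by move=> _; exact: powR_ge0.
have Ygt0 : 0 < Y by rewrite lt_neqAle eq_sym Yn0.
move=> H.
have : Y `^ rr^-1 <= 2 * C1 * B `^ (1 - rr^-1).
  rewrite -(ler_pM2r (powR_gt0 (1 - rr^-1) Ygt0)); apply: le_trans H.
  by rewrite -powRD ?Yn0 ?implybT// addrC subrK powRr1.
move=> H'; rewrite -(powR_root rr0 Y0); apply: le_powR => //; [exact: ltW|exact: powR_ge0].
Qed.

End commutator_pairing.

(** * Dyadic grids *)

Section box.
Context {R : realType} (n : nat).
Implicit Types (z x : n.-tuple R) (l : R).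

(** Half-open, so that the boxes of one level tile the space; the parameters are the lower corner
    and the full side, as opposed to centre and half side for [cube]. *)
Definition box z l : set (n.-tuple R) := [set x | forall i, tnth z i <= tnth x i < tnth z i + l].

Lemma boxE z l : (\1_(box z l) : n.-tuple R -> R) =
  fun x => \prod_(i < n) \1_([set` `[tnth z i, tnth z i + l[] : set R) (tnth x i).
Proof.
apply/funext => x; rewrite indicE; case: (boolP (x \in _)) => [|/negP] xz.
  rewrite big1// => i _; rewrite indicE mem_set//=.
  by move: xz; rewrite inE in_itv => /(_ i).
apply/esym/eqP; rewrite prodf_seq_eq0; apply/hasP.
have [i Hi] : exists i, ~ (tnth z i <= tnth x i < tnth z i + l).
  by apply/existsNP => H; apply: xz; rewrite inE.
by exists i; rewrite ?mem_index_enum//= indicE memNset//= in_itv.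
Qed.

Lemma measurable_box z l : measurable (box z l).
Proof.
rewrite (_ : box z l = \bigcap_(i in [set: 'I_n]) (fun x => tnth x i) @^-1` [set` `[tnth z i, tnth z i + l[]).
  apply: fin_bigcap_measurable => [|i _]; first exact: finite_finset.
  by rewrite -[X in measurable X]setTI; apply: measurable_tnth => //; exact: measurable_itv.
apply/seteqP; split => x /= H i; first by move=> _ /=; rewrite in_itv/=.
by have := H i I; rewrite /= in_itv.
Qed.

Lemma mun_box z l : 0 < l -> mun n (box z l) = (l ^+ n)%:E.
Proof.
move=> l0; have mc := measurable_box z l.
have -> : mun n (box z l) = (\int[mun n]_x (\1_(box z l) x)%:E)%E.
  by rewrite integral_indic// setIT.
pose I (i : 'I_n) : set R := [set` `[tnth z i, tnth z i + l[].
have mI i : measurable (I i) by exact: measurable_itv.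
have E i : (\int[leb]_x (\1_(I i) x)%:E)%E = l%:E.
  rewrite integral_indic// setIT.
  by rewrite [LHS]lebesgue_measure_itv/= lte_fin ltrDl l0 -EFinD addrAC subrr add0r.
rewrite (eq_integral (fun x => (\prod_(i < n) \1_(I i) (tnth x i))%:E)); last by move=> x _; rewrite boxE.
rewrite (@integral_tuple_prod _ _ R leb n (fun i => \1_(I i))).
- under eq_bigr => i _ do rewrite E.
  by rewrite prodEFin prodr_const card_ord.
- by move=> i; exact: measurable_indic.
- by move=> i x; rewrite indicE.
Qed.

Lemma Rintegral_indic_box z l : 0 < l -> Rintegral (mun n) setT (\1_(box z l) : n.-tuple R -> R) = l ^+ n.
Proof.
move=> l0; rewrite /Rintegral integral_indic//; last exact: measurable_box.
by rewrite setIT [X in fine X](mun_box z l0).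
Qed.

(** The cube is centred at the corner of the box and has twice its side. The waste is a constant
    factor, and in return one pair [(z, l)] indexes the box, the cube and its median. *)
Lemma box_cube z l : box z l `<=` cube z l.
Proof.
move=> x H i; have /andP[h1 h2] := H i.
by rewrite ger0_norm ?subr_ge0// ltrBlDl.
Qed.

End box.

Section grid.
Context {R : realType} (n : nat) (w : n.-tuple R) (L : R).
Hypothesis L0 : 0 < L.

Definition side (l : nat) : R := L / 2 ^+ l.

Lemma side_gt0 l : 0 < side l. Proof. by rewrite divr_gt0// exprn_gt0. Qed.

Lemma side0 : side 0 = L. Proof. by rewrite /side expr0 divr1. Qed.

Lemma sideS l : side l = 2 * side l.+1.
Proof. by rewrite /side exprS; field; rewrite expf_neq0. Qed.

Lemma side_le k l : (k <= l)%N -> side l <= side k.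
Proof.
move=> kl; rewrite /side ler_pM2l// lef_pV2 ?posrE ?exprn_gt0//.
by rewrite ler_weXn2l// ler1n.
Qed.

Definition grid_index l (x : n.-tuple R) (i : 'I_n) : int := Num.floor ((tnth x i - tnth w i) / side l).

(** The corner serves as the name of the level [l] box containing [x]: lying in the same box becomes
    an equality of corners. *)
Definition corner l (x : n.-tuple R) : n.-tuple R :=
  [tuple tnth w i + side l * (grid_index l x i)%:~R | i < n].

Lemma index_itv l x i : (grid_index l x i)%:~R * side l <= tnth x i - tnth w i < ((grid_index l x i)%:~R + 1) * side l.
Proof.
have := floor_itv ((tnth x i - tnth w i) / side l).
by rewrite -/(grid_index l x i) ler_pdivlMr ?ltr_pdivrMr ?side_gt0// intrD.
Qed.

Lemma index_unique l x i (a : int) : a%:~R * side l <= tnth x i - tnth w i < (a%:~R + 1) * side l -> grid_index l x i = a.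
Proof.
move=> H; apply: floor_def.
by rewrite ler_pdivlMr ?ltr_pdivrMr ?side_gt0// intrD.
Qed.

Lemma corner_grid_index l x y : corner l x = corner l y -> grid_index l x =1 grid_index l y.
Proof.
move=> H i; have := congr1 (fun t => tnth t i) H; rewrite !tnth_mktuple => /addrI.
by move/(mulfI (lt0r_neq0 (side_gt0 l))) => /eqP; rewrite eqr_int => /eqP.
Qed.

Lemma corner_eq l x y : grid_index l x =1 grid_index l y -> corner l x = corner l y.
Proof. by move=> H; apply: eq_from_tnth => i; rewrite !tnth_mktuple H. Qed.

Lemma corner_box l x y : box (corner l x) (side l) y <-> corner l y = corner l x.
Proof.
split => [H|H].
  apply: corner_eq => i; apply: index_unique; have := H i; rewrite tnth_mktuple; lra.
by rewrite -H => i; rewrite tnth_mktuple; have := index_itv l y i; lra.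
Qed.

Lemma box_corner l x : box (corner l x) (side l) x.
Proof. exact/corner_box. Qed.

Lemma corner_corner l x : corner l (corner l x) = corner l x.
Proof. by apply/corner_box => i; rewrite lexx ltrDl side_gt0. Qed.

Lemma corner_coarse l x y : corner l.+1 x = corner l.+1 y -> corner l x = corner l y.
Proof.
move=> /corner_grid_index H; apply: corner_eq => i; apply/esym/index_unique.
have := index_itv l.+1 x i; have := index_itv l.+1 y i; have := index_itv l x i.
rewrite H (sideS l); set a := grid_index l x i; set c := grid_index l.+1 y i; set s := side l.+1.
have s0 : 0 < s by exact: side_gt0.
move=> /andP[h1 h2] /andP[h3 h4] /andP[h5 h6].
(* The real inequalities are strict on one side; integrality sharpens them to 2a <= c and c + 1 <=
   2a + 2, so the fine interval lies inside the coarse one. *)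
have c1 : c < a + a + 2.
  rewrite -(ltr_int R) !intrD -(ltr_pM2r s0); lra.
have c2 : a + a < c + 1.
  rewrite -(ltr_int R) !intrD -(ltr_pM2r s0); lra.
have c3 : c%:~R + 1 <= (a + a + 2)%:~R :> R by rewrite -(intrD _ c 1) ler_int; lia.
have c4 : (a + a)%:~R <= c%:~R :> R by rewrite ler_int; lia.
move: c3 c4; rewrite -(ler_pM2r s0) -(ler_pM2r s0 (a + a)%:~R) !intrD; lra.
Qed.

Lemma corner_le k l x y : (k <= l)%N -> corner l x = corner l y -> corner k x = corner k y.
Proof.
elim: l => [|l IH]; first by rewrite leqn0 => /eqP ->.
by rewrite leq_eqVlt => /orP[/eqP->//|kl] /corner_coarse/IH; apply.
Qed.

Lemma corner0 x : box w L x <-> corner 0 x = w.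
Proof.
have H : corner 0 w = w.
  apply: eq_from_tnth => i; rewrite tnth_mktuple /grid_index subrr mul0r floor0.
  by rewrite mulr0 addr0.
by have := corner_box 0 w x; rewrite H side0.
Qed.

Definition corners l : seq (n.-tuple R) :=
  [seq [tuple tnth w i + side l * (val (tnth a i))%:R | i < n] | a : n.-tuple 'I_(2 ^ l) <- enum {: n.-tuple 'I_(2 ^ l)}].

Lemma corners_uniq l : uniq (corners l).
Proof.
rewrite map_inj_uniq ?enum_uniq// => a a' H; apply: eq_from_tnth => i; apply: val_inj.
have := congr1 (fun t => tnth t i) H; rewrite !tnth_mktuple => /addrI.
by move/(mulfI (lt0r_neq0 (side_gt0 l))) => /eqP; rewrite eqr_nat => /eqP.
Qed.

Lemma side_total l : side l * 2 ^+ l = L.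
Proof. by rewrite /side divfK// expf_neq0. Qed.

Lemma cornersP l z : z \in corners l <-> corner l z = z /\ box w L z.
Proof.
have s0 := side_gt0 l; split => [/mapP[a _ ->]|[H Hz]].
  split.
    apply: eq_from_tnth => i; rewrite !tnth_mktuple; congr (_ + _ * _).
    rewrite (@index_unique _ _ _ (Posz (tnth a i)))// tnth_mktuple addrAC subrr add0r mulrC lexx/=.
    by rewrite [ltRHS]mulrC ltr_pM2l// ltrDl.
  move=> i; rewrite tnth_mktuple lerDl ltrD2l mulr_ge0 ?(ltW s0)//= -[ltRHS](side_total l).
  by rewrite ltr_pM2l// -natrX ltr_nat.
have ai i : 0 <= grid_index l z i < (2 ^ l)%:Z.
  have /andP[h1 h2] := Hz i; have /andP[h3 h4] := index_itv l z i.
  apply/andP; split.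
    rewrite -ltzD1 -(ltr_int R) intrD -(ltr_pM2r s0) mul0r; lra.
  rewrite -(ltr_int R) -(ltr_pM2r s0); apply: (le_lt_trans h3).
  have : (2 ^ l)%:Z%:~R * side l = L.
    by rewrite -pmulrn natrX mulrC side_total.
  move=> ->; lra.
have ai' i : (`|grid_index l z i| < 2 ^ l)%N by have := ai i; lia.
apply/mapP; exists [tuple Ordinal (ai' i) | i < n]; first by rewrite mem_enum.
rewrite -{1}H; apply: eq_from_tnth => i; rewrite !tnth_mktuple/=; congr (_ + _ * _).
by rewrite pmulrn gez0_abs//; have /andP[] := ai i.
Qed.

Lemma corner_mem l x : box w L x -> corner l x \in corners l.
Proof.
move=> xQ; apply/cornersP; split; first exact: corner_corner.
apply/corner0; rewrite -((corner0 x).1 xQ); apply: (@corner_le 0 l) => //.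
exact: corner_corner.
Qed.

Lemma corners_box l z x : z \in corners l -> box z (side l) x <-> corner l x = z.
Proof. by move=> /cornersP[H _]; have := corner_box l z x; rewrite H. Qed.

Lemma corners_sub l z : z \in corners l -> box z (side l) `<=` box w L.
Proof.
move=> zl x /(corners_box x zl) xz; apply/corner0.
have /cornersP[H /corner0 <-] := zl.
by apply: (@corner_le 0 l) => //; rewrite xz H.
Qed.

(** Measurability with respect to the level [l] boxes, with arbitrary values so as to cover
    functions, sets and the level-valued [selected]. *)
Definition saturated T l (f : n.-tuple R -> T) := forall x y, corner l x = corner l y -> f x = f y.

Lemma step_sum l (f : n.-tuple R -> R) x : saturated l f ->
  f x * \1_(box w L) x = \sum_(z <- corners l) f z * \1_(box z (side l)) x.
Proof.
move=> sf; rewrite indicE; have [xQ|xQ] := boolP (x \in _); last first.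
  rewrite mulr0 big_seq big1// => z zl; rewrite indicE memNset ?mulr0//.
  by move=> /(corners_sub zl) H; move: xQ; rewrite mem_set.
have cx := corner_mem l (set_mem xQ).
rewrite mulr1 (bigD1_seq (corner l x)) ?corners_uniq//= indicE mem_set; last exact: box_corner.
rewrite mulr1 -(sf x); last by rewrite corner_corner.
rewrite big_seq_cond big1 ?addr0// => z /andP[zl zx]; rewrite indicE memNset ?mulr0//.
by move=> /(corners_box x zl) H; rewrite H eqxx in zx.
Qed.

Lemma measurable_step l (f : n.-tuple R -> R) : saturated l f ->
  measurable_fun setT (fun x => f x * \1_(box w L) x).
Proof.
move=> sf; under eq_fun do rewrite (step_sum _ sf).
apply: measurable_sum => z; apply: measurable_funM => //.
by apply: measurable_indic; exact: measurable_box.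
Qed.

End grid.

(** * Stopping cubes *)

Section averages.
Context {R : realType} (n : nat) (w : n.-tuple R) (L : R).
Hypothesis L0 : 0 < L.

Local Notation corner := (corner w L).
Local Notation side := (side L).
Local Notation corners := (corners w L).
Local Notation saturated := (saturated w L).

(** The conditional expectation on the level [l] boxes; [step_integral] is its defining property
    against saturated functions. *)
Definition average l (G : n.-tuple R -> R) x :=
  Rintegral (mun n) setT (fun y => \1_(box (corner l x) (side l)) y * G y) / side l ^+ n.

Lemma average_saturated l G : saturated l (average l G).
Proof. by move=> x y H; rewrite /average H. Qed.

Lemma step_integral l (f G : n.-tuple R -> R) : saturated l f ->
  (forall z, (mun n).-integrable setT (EFin \o (fun y => \1_(box z (side l)) y * G y))) ->
  [/\ (mun n).-integrable setT (EFin \o (fun x => f x * \1_(box w L) x * G x)),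
      (mun n).-integrable setT (EFin \o (fun x => f x * \1_(box w L) x * average l G x)) &
  Rintegral (mun n) setT (fun x => f x * \1_(box w L) x * G x) =
  Rintegral (mun n) setT (fun x => f x * \1_(box w L) x * average l G x)].
Proof.
move=> sf iG; have s0 := side_gt0 L0 l.
have E1 : (fun x => f x * \1_(box w L) x * G x) =
    fun x => \sum_(z <- corners l) f z * (\1_(box z (side l)) x * G x).
  apply/funext => x; rewrite (step_sum L0 x sf) mulr_suml.
  by apply: eq_bigr => z _; rewrite mulrA.
have sfa : saturated l (fun x => f x * average l G x).
  by move=> x y H; rewrite (sf x y H) (@average_saturated l G x y H).
have E2 : (fun x => f x * \1_(box w L) x * average l G x) =
    fun x => \sum_(z <- corners l) f z * average l G z * \1_(box z (side l)) x.
  by apply/funext => x; rewrite -(step_sum L0 x sfa) mulrAC.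
have i1 z : (mun n).-integrable setT (EFin \o (fun x => f z * (\1_(box z (side l)) x * G x))).
  exact: (integrableZl measurableT (f z) (iG z)).
have ib z : (mun n).-integrable setT (EFin \o (\1_(box z (side l)) : n.-tuple R -> R)).
  apply: integrable_indic_lty; first exact: measurable_box.
  by rewrite [X in (X < _)%E](mun_box z s0) ltry.
have i2 z : (mun n).-integrable setT (EFin \o (fun x => f z * average l G z * \1_(box z (side l)) x)).
  exact: (integrableZl measurableT (f z * average l G z) (ib z)).
have [j1 S1] := Rintegral_sum (corners l) i1.
have [j2 S2] := Rintegral_sum (corners l) i2.
rewrite E1 E2; split => //; rewrite S1 S2 big_seq [RHS]big_seq.
apply: eq_bigr => z zl; rewrite RintegralZl// RintegralZl// -mulrA; congr (_ * _).
have -> : Rintegral (mun n) setT (\1_(box z (side l))) = side l ^+ n.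
  exact: Rintegral_indic_box.
rewrite /average divfK ?expf_neq0 ?gt_eqF//.
by have /(cornersP w L0 l)[-> _] := zl.
Qed.

End averages.

Section stopping.
Context {R : realType} (n k : nat) (b : n.-tuple R -> R) (med : n.-tuple R -> R -> R).
Hypothesis mb : measurable_fun setT b.
Hypothesis b_loc : forall (z : n.-tuple R) d, 0 < d ->
  (mun n).-integrable setT (EFin \o (fun x => (1 + `|b x|) ^+ k * \1_(cube z d) x)).
Hypothesis k0 : (0 < k)%N.

Lemma box_integrable z d a : 0 < d ->
  (mun n).-integrable setT (EFin \o (fun y => \1_(box z d) y * `|b y - a| ^+ k)).
Proof.
move=> d0.
have iw := integrableZl measurableT ((1 + `|a|) ^+ k) (b_loc z d0).
apply: le_integrable iw => //.
  apply/measurable_EFinP; apply: measurable_funM; first by apply: measurable_indic; exact: measurable_box.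
  apply: measurable_funX; apply: measurableT_comp => //; exact: measurable_funB.
move=> y _ /=; rewrite lee_fin indicE.
have [yE|yE] := boolP (y \in box z d); last by rewrite mul0r normr0.
rewrite indicE mem_set; last by apply: box_cube; exact: set_mem.
rewrite mul1r mulr1 -exprMn [leLHS]ger0_norm ?exprn_ge0// [leRHS]ger0_norm; last by rewrite exprn_ge0// mulr_ge0// addr_ge0.
rewrite lerXn2r ?nnegrE ?mulr_ge0 ?addr_ge0//; apply: le_trans (ler_normB _ _) _.
have : 0 <= `|a| * `|b y| by rewrite mulr_ge0.
by lra.
Qed.

Lemma exprD_le (x y : R) : 0 <= x -> 0 <= y -> (x + y) ^+ k <= 2 ^+ k * (x ^+ k + y ^+ k).
Proof.
move=> x0 y0; have xk := exprn_ge0 k x0; have yk := exprn_ge0 k y0.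
have k2 : 0 <= 2 ^+ k :> R by rewrite exprn_ge0.
have [xy|/ltW yx] := leP x y.
  apply: (@le_trans _ _ (2 ^+ k * y ^+ k)); last by rewrite ler_wpM2l// lerDr.
  by rewrite -exprMn lerXn2r// ?nnegrE; lra.
apply: (@le_trans _ _ (2 ^+ k * x ^+ k)); last by rewrite ler_wpM2l// lerDl.
by rewrite -exprMn lerXn2r// ?nnegrE; lra.
Qed.

Lemma root_le (a M u v : R) : 0 <= a -> 0 <= M -> 0 <= u -> 0 <= v -> a ^+ k <= M * (u + v) ->
  a <= (2 * M) `^ k%:R^-1 * (u `^ k%:R^-1 + v `^ k%:R^-1).
Proof.
move=> a0 M0 u0 v0 H.
have kR : k%:R != 0 :> R by rewrite pnatr_eq0 -lt0n.
have -> : a = (a ^+ k) `^ k%:R^-1 by rewrite -powR_mulrn// -powRrM divff// powRr1.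
have ki : 0 <= k%:R^-1 :> R by rewrite invr_ge0.
have [uv|/ltW vu] := leP u v.
  apply: (@le_trans _ _ ((2 * M * v) `^ k%:R^-1)).
    apply: le_powR => //; rewrite ?exprn_ge0//; apply: (le_trans H).
    by rewrite mulrAC mulrC ler_wpM2r//; lra.
  by rewrite powRM ?mulr_ge0// ler_wpM2l ?powR_ge0// lerDr powR_ge0.
apply: (@le_trans _ _ ((2 * M * u) `^ k%:R^-1)).
  apply: le_powR => //; rewrite ?exprn_ge0//; apply: (le_trans H).
  by rewrite mulrAC mulrC ler_wpM2r//; lra.
by rewrite powRM ?mulr_ge0// ler_wpM2l ?powR_ge0// lerDl powR_ge0.
Qed.

Variables (w : n.-tuple R) (L : R).
Hypothesis L0 : 0 < L.

Local Notation corner := (corner w L).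
Local Notation side := (side L).
Local Notation corners := (corners w L).
Local Notation saturated := (saturated w L).

Definition deviation l x a := average w L l (fun y => `|b y - a| ^+ k) x.

Let bi l x a := box_integrable (corner l x) a (side_gt0 L0 l).

Lemma deviation_ge0 l x a : 0 <= deviation l x a.
Proof.
apply: divr_ge0; last by rewrite exprn_ge0// ltW// side_gt0.
by apply: Rintegral_ge0 => y _; rewrite mulr_ge0 ?exprn_ge0// indicE.
Qed.

Lemma deviation_child l x a : deviation l.+1 x a <= 2 ^+ n * deviation l x a.
Proof.
have s0 := side_gt0 L0 l.+1.
have E r : 2 ^+ n * (r / (2 * side l.+1) ^+ n) = r / side l.+1 ^+ n.
  by rewrite exprMn; field; rewrite !expf_neq0// gt_eqF.
rewrite /deviation /average (sideS L l) E ler_wpM2r ?invr_ge0 ?exprn_ge0 ?(ltW s0)//.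
rewrite -(sideS L l); apply: le_Rintegral => // y _.
rewrite ler_wpM2r ?exprn_ge0// !indicE.
have [xy|//] := boolP (y \in box (corner l.+1 x) _).
rewrite mem_set//; apply/(corner_box w L0); apply: (corner_coarse L0).
exact/(corner_box w L0)/set_mem.
Qed.

Lemma Rintegral_box l x : Rintegral (mun n) setT (\1_(box (corner l x) (side l)) : n.-tuple R -> R) = side l ^+ n.
Proof. exact: Rintegral_indic_box (side_gt0 L0 l). Qed.

Let ibox l x : (mun n).-integrable setT (EFin \o (\1_(box (corner l x) (side l)) : n.-tuple R -> R)).
Proof.
apply: integrable_indic_lty; first exact: measurable_box.
by rewrite [X in (X < _)%E](mun_box _ (side_gt0 L0 l)) ltry.
Qed.

(** The triangle inequality for k-th powers averaged over the box; it compares two medians through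
    deviations over a common box. *)
Lemma dist_deviation l x a a' : `|a - a'| ^+ k <= 2 ^+ k * (deviation l x a + deviation l x a').
Proof.
have sn : 0 < side l ^+ n by rewrite exprn_gt0// side_gt0.
rewrite -(ler_pM2r sn) /deviation /average -mulrDl -!mulrA mulVf ?gt_eqF// mulr1.
rewrite -(Rintegral_box l x) -RintegralZl//; last exact: ibox.
rewrite -RintegralD//.
have i2 := integrableD measurableT (bi l x a) (bi l x a').
rewrite -[leRHS]RintegralZl//.
apply: le_Rintegral => //.
- exact: (integrableZl measurableT (`|a - a'| ^+ k) (ibox l x)).
- exact: (integrableZl measurableT (2 ^+ k) i2).
move=> y _; rewrite -mulrDr mulrCA [leLHS]mulrC ler_wpM2l//.
apply: le_trans (exprD_le _ _) => //; rewrite lerXn2r ?nnegrE ?addr_ge0//.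
by rewrite -[a - a'](subrKA (b y)) (distrC (b y)) ler_normD.
Qed.

Lemma deviation_shift l x a a' : deviation l x a' <= 2 ^+ k * (deviation l x a + `|a - a'| ^+ k).
Proof.
have sn : 0 < side l ^+ n by rewrite exprn_gt0// side_gt0.
rewrite -(ler_pM2r sn) /deviation /average divfK ?gt_eqF// -mulrA mulrDl divfK ?gt_eqF//.
rewrite -(Rintegral_box l x) -RintegralZl//; last exact: ibox.
have i1 := integrableZl measurableT (`|a - a'| ^+ k) (ibox l x).
rewrite -RintegralD//.
have i2 := integrableD measurableT (bi l x a) i1.
have i3 := bi l x a'.
rewrite -[leRHS]RintegralZl//.
apply: le_Rintegral => //.
- exact: (integrableZl measurableT (2 ^+ k) i2).
move=> y _; rewrite [`|a - a'| ^+ k * _]mulrC -mulrDr mulrCA ler_wpM2l//.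
apply: le_trans (exprD_le _ _) => //; rewrite lerXn2r ?nnegrE ?addr_ge0//.
by rewrite -[b y - a'](subrKA a) ler_normD.
Qed.

Definition cube_median l x := med (corner l x) (side l).
Definition oscillation l x := deviation l x (cube_median l x).

(* The last level at which the mean deviation from the median of the previously
   selected cube exceeded twice the oscillation over that cube. *)
Fixpoint selected l x : nat :=
  if l is l'.+1 then
    let t := selected l' x in
    if 2 * oscillation t x < deviation l x (cube_median t x) then l else t
  else 0.

Lemma selected_le l x : (selected l x <= l)%N.
Proof. by elim: l => //= l IH; case: ifP => // _; exact: leqW. Qed.

Lemma cube_median_saturated l : saturated l (cube_median l).
Proof. by move=> x y H; rewrite /cube_median H. Qed.

Lemma deviation_saturated l a : saturated l (fun x => deviation l x a).
Proof. by move=> x y H; rewrite /deviation /average H. Qed.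

Lemma oscillation_saturated l : saturated l (oscillation l).
Proof. by move=> x y H; rewrite /oscillation (cube_median_saturated H); exact: deviation_saturated. Qed.

Lemma oscillation_ge0 l x : 0 <= oscillation l x.
Proof. exact: deviation_ge0. Qed.

Lemma selected_saturated l : saturated l (selected l).
Proof.
elim: l => // l IH x y H /=; have E := IH _ _ (corner_coarse L0 H); rewrite -E.
have Ht : corner (selected l x) x = corner (selected l x) y.
  by apply: (corner_le L0 _ H); apply: leqW; exact: selected_le.
by rewrite (oscillation_saturated Ht) (cube_median_saturated Ht) (deviation_saturated _ H).
Qed.

(** Either level [l] is itself selected, and the deviation is an oscillation, or the stopping
    inequality failed at [l]. *)
Lemma deviation_selected l x : deviation l x (cube_median (selected l x) x) <= 2 * oscillation (selected l x) x.
Proof.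
have o2 t : oscillation t x <= 2 * oscillation t x by have := oscillation_ge0 t x; lra.
by case: l => [|l] /=; [exact: o2|case: ltP => // _; exact: o2].
Qed.

(** 2^k comes from the triangle inequality for k-th powers, 2^n from passing to a child box, and 2
    from the stopping rule. The further 2 in [chain_const] comes from taking the k-th root of a sum
    in [root_le]. *)
Let M : R := 2 ^+ k * (2 ^+ n * 2).
Definition chain_const : R := (2 * M) `^ k%:R^-1.

Let M1 : 1 <= M.
Proof.
rewrite /M; have : 1 <= 2 ^+ k :> R by rewrite exprn_ege1// ler1n.
have : 1 <= 2 ^+ n :> R by rewrite exprn_ege1// ler1n.
by nra.
Qed.

Definition osc_root l x := oscillation l x `^ k%:R^-1.

Lemma osc_root_ge0 l x : 0 <= osc_root l x. Proof. exact: powR_ge0. Qed.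

Lemma cube_median_step l x : selected l.+1 x = l.+1 ->
  `|cube_median l.+1 x - cube_median (selected l x) x| <=
   chain_const * (osc_root l.+1 x + osc_root (selected l x) x).
Proof.
move=> _; set t := selected l x.
apply: root_le => //; rewrite ?oscillation_ge0//; first by have := M1; lra.
apply: (le_trans (dist_deviation l.+1 x _ _)).
rewrite /M -mulrA ler_wpM2l ?exprn_ge0//.
have n1 : 1 <= 2 ^+ n :> R by rewrite exprn_ege1// ler1n.
have h1 := deviation_child l x (cube_median t x).
have h2 := deviation_selected l x; rewrite -/t in h2.
have h3 : 2 ^+ n * deviation l x (cube_median t x) <= 2 ^+ n * (2 * oscillation t x).
  by rewrite ler_wpM2l// exprn_ge0.
have := oscillation_ge0 l.+1 x; rewrite -/(oscillation l.+1 x).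
have := oscillation_ge0 t x; nra.
Qed.

(** The second term on the left is a reserve that makes the induction close: a new selection costs
    chain_const times the new and the old root; the reserve pays for the old one, and the factor 2
    pays for the new one and the new reserve. *)
Lemma cube_median_chain l x :
  `|cube_median (selected l x) x - cube_median 0 x| + chain_const * osc_root (selected l x) x <=
  2 * chain_const * \sum_(j < l.+1 | selected j x == j) osc_root j x.
Proof.
have c0 : 0 <= chain_const by exact: powR_ge0.
elim: l => [|l IH].
  rewrite /= big_mkcond big_ord_recl big_ord0/= subrr normr0 addr0 add0r -mulrA.
  have : 0 <= chain_const * osc_root 0 x by rewrite mulr_ge0// osc_root_ge0.
  by lra.
rewrite big_mkcond big_ord_recr -big_mkcond [X in _ * (_ + X)]/=.
have [E|E] := eqVneq (selected l.+1 x) l.+1.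
  rewrite mulrDr E; have H := cube_median_step E; have := osc_root_ge0 l.+1 x.
  have T : `|cube_median l.+1 x - cube_median 0 x| <= `|cube_median l.+1 x - cube_median (selected l x) x| + `|cube_median (selected l x) x - cube_median 0 x|.
    by rewrite -[X in `|X| <= _](subrKA (cube_median (selected l x) x)) ler_normD.
  rewrite mulrDr in H; lra.
have -> : selected l.+1 x = selected l x.
  by move: E => /=; case: ifP => //; rewrite eqxx.
by rewrite addr0.
Qed.

(** The 8 is a product of three factors 2: one from [cube_median_chain], one from the 2^k of
    [deviation_shift], and one from adding two k-th powers, since 2 <= 2^k. *)
Lemma deviation_chain l x : deviation l x (cube_median 0 x) <=
  (8 * chain_const * \sum_(j < l.+1 | selected j x == j) osc_root j x) ^+ k.
Proof.
set S := \sum_(j < l.+1 | _) _; set t := selected l x.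
have c0 : 0 <= chain_const by exact: powR_ge0.
have kR : k%:R != 0 :> R by rewrite pnatr_eq0 -lt0n.
pose u := `|cube_median t x - cube_median 0 x|; pose v := chain_const * osc_root t x.
have v0 : 0 <= v by rewrite mulr_ge0// osc_root_ge0.
have u0 : 0 <= u by exact: normr_ge0.
have uv : u + v <= 2 * chain_const * S by exact: cube_median_chain.
have vk : 2 * oscillation t x <= v ^+ k.
  have rootK (r : R) : 0 <= r -> (r `^ k%:R^-1) ^+ k = r.
    by move=> r0; rewrite -powR_mulrn ?powR_ge0// -powRrM mulVf// powRr1.
  rewrite /v exprMn /chain_const /osc_root !rootK ?oscillation_ge0//; last by have := M1; lra.
  by rewrite ler_wpM2r ?oscillation_ge0//; have := M1; lra.
have uk : u ^+ k <= (u + v) ^+ k by rewrite lerXn2r ?nnegrE ?addr_ge0// lerDl.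
have vk' : v ^+ k <= (u + v) ^+ k by rewrite lerXn2r ?nnegrE ?addr_ge0// lerDr.
apply: (le_trans (deviation_shift l x (cube_median t x) _)).
have -> : 8 * chain_const * S = 2 * (2 * (2 * chain_const * S)) by ring.
rewrite exprMn ler_wpM2l ?exprn_ge0//.
apply: (@le_trans _ _ ((2 * (u + v)) ^+ k)); last first.
  rewrite lerXn2r ?nnegrE ?mulr_ge0 ?addr_ge0// ?ler_wpM2l//.
  by apply: sumr_ge0 => j _; exact: osc_root_ge0.
have h := deviation_selected l x; rewrite -/t in h.
have k2 : 2 <= 2 ^+ k :> R.
  by rewrite -(prednK k0) exprS ler_peMr// exprn_ege1// ler1n.
have uvk : 0 <= (u + v) ^+ k by rewrite exprn_ge0// addr_ge0.
rewrite exprMn; apply: (@le_trans _ _ (2 * (u + v) ^+ k)); last by rewrite ler_wpM2r.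
rewrite -/u; lra.
Qed.

End stopping.

(** * Packing of the stopping cubes *)

Lemma sum_indic_le (R : realType) (T I : eqType) (r : seq I) (E : I -> set T) (C : set T) (x : T) :
  uniq r -> (forall j, j \in r -> E j `<=` C) ->
  (forall i j, i \in r -> j \in r -> E i x -> E j x -> i = j) ->
  \sum_(j <- r) \1_(E j) x <= \1_C x :> R.
Proof.
move=> ur EC dis; have [[j jr Ej]|none] := pselect (exists2 j, j \in r & E j x); last first.
  rewrite big_seq big1 ?indicE// => j jr; rewrite indicE memNset// => Ej.
  by apply: none; exists j.
rewrite (bigD1_seq j)//= big_seq_cond big1 => [|i /andP[ir ij]]; last first.
  rewrite indicE memNset// => Ei; move: ij; rewrite (dis i j)// eqxx//.
by rewrite addr0 !indicE !mem_set//; exact: (EC j).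
Qed.

Section packing.
Context {R : realType} (n k : nat) (b : n.-tuple R -> R) (med : n.-tuple R -> R -> R).
Hypothesis mb : measurable_fun setT b.
Hypothesis b_loc : forall (z : n.-tuple R) d, 0 < d ->
  (mun n).-integrable setT (EFin \o (fun x => (1 + `|b x|) ^+ k * \1_(cube z d) x)).
Hypothesis k0 : (0 < k)%N.
Variables (w : n.-tuple R) (L : R).
Hypothesis L0 : 0 < L.

Local Notation corner := (corner w L).
Local Notation side := (side L).
Local Notation corners := (corners w L).
Local Notation saturated := (saturated w L).
Local Notation sel := (selected k b med w L).
Local Notation osc := (oscillation k b med w L).
Local Notation cmed := (cube_median med w L).
Local Notation dev := (deviation k b w L).

Let indic_sat l (P : set (n.-tuple R)) : saturated l P -> saturated l (\1_P : n.-tuple R -> R).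
Proof. by move=> sP x y /sP H; rewrite !indicE /in_mem/= /in_set/= H. Qed.

Let sel_sat l : saturated l (sel l).
Proof. exact: selected_saturated. Qed.

Let G a := fun y => `|b y - a| ^+ k.
Let mu P := Rintegral (mun n) setT (fun x => \1_P x * \1_(box w L) x * 1).

Let sat_G l (P : set (n.-tuple R)) a : saturated l P ->
  [/\ (mun n).-integrable setT (EFin \o (fun x => \1_P x * \1_(box w L) x * G a x)),
      (mun n).-integrable setT (EFin \o (fun x => \1_P x * \1_(box w L) x * dev l x a)) &
  Rintegral (mun n) setT (fun x => \1_P x * \1_(box w L) x * G a x) =
  Rintegral (mun n) setT (fun x => \1_P x * \1_(box w L) x * dev l x a)].
Proof.
move=> /indic_sat sP; apply: (step_integral L0 sP) => z.
by apply: box_integrable => //; exact: side_gt0.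
Qed.

Let sat_1 l (P : set (n.-tuple R)) : saturated l P ->
  (mun n).-integrable setT (EFin \o (fun x => \1_P x * \1_(box w L) x * 1)).
Proof.
move=> /indic_sat sP; case: (@step_integral R n w L L0 l _ (fun=> 1) sP) => // z.
have : (mun n).-integrable setT (EFin \o (\1_(box z (side l)) : n.-tuple R -> R)).
  apply: integrable_indic_lty; first exact: measurable_box.
  by rewrite [X in (X < _)%E](mun_box z (side_gt0 L0 l)) ltry.
by apply: eq_integrable => // x _ /=; rewrite mulr1.
Qed.

Let left_set N l z := [set y | corner l y = corner l z /\ sel N y <> l].

(** Points leave level [l] through boxes on each of which the mean deviation exceeds twice the
    oscillation. Boxes of departure at different levels are disjoint, so the inequality adds up
    level by level. *)
Lemma selected_mass l z N : (l <= N)%N -> sel l z = l ->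
  2 * osc l z * mu (left_set N l z) <=
  Rintegral (mun n) setT (fun x => \1_(left_set N l z) x * \1_(box w L) x * G (cmed l z) x).
Proof.
move=> lN zl; rewrite -(subnKC lN); elim: (N - l)%N => [|j IH].
  rewrite addn0 (_ : left_set _ _ _ = set0); last first.
    by apply/seteqP; split => // y [H]; rewrite (sel_sat H).
  have Z g : Rintegral (mun n) setT (fun x => \1_set0 x * \1_(box w L) x * g x) = 0.
    by under eq_Rintegral do rewrite indic0 /= !mul0r; rewrite Rintegral_cst// mul0r.
  by rewrite /mu !Z mulr0.
rewrite addnS; set M := (l + j)%N in IH *.
have lM : (l <= M)%N by rewrite leq_addr.
pose B := left_set M l z.
(* The points that leave exactly at level [M.+1]. This set is saturated at that level, so on it |b -
   median|^k integrates like its averages, which exceed the stopping threshold. *)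
pose A := [set y | corner l y = corner l z /\ (sel M y = l /\ sel M.+1 y = M.+1)].
have sB : saturated M B.
  by move=> x y H; rewrite /B /left_set/= (corner_le L0 lM H) (sel_sat H).
have sA : saturated M.+1 A.
  move=> x y H; rewrite /A /mkset (corner_le L0 (leqW lM) H) (sel_sat H).
  by rewrite (sel_sat (corner_coarse L0 H)).
have cases y : sel M.+1 y = M.+1 \/ sel M.+1 y = sel M y.
  by rewrite /=; case: ifP => _; [left|right].
have BA : (\1_(left_set M.+1 l z) : n.-tuple R -> R) =
    fun x => \1_B x + \1_A x.
  apply/funext => x; rewrite !indicE.
  have [xz|xz] := pselect (corner l x = corner l z); last first.
    by rewrite !memNset ?addr0//= => -[].
  have [sM|sM] := pselect (sel M x = l).
    rewrite (@memNset _ B); last by case.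
    rewrite add0r; have [sM1|sM1] := cases x.
      rewrite !mem_set//=; split => //; rewrite sM1 => E.
      by move: lM; rewrite -E ltnn.
    rewrite !memNset//; [move=> [_ [_ E]]|by move=> [_]; rewrite sM1 sM].
    have : (sel M x <= M)%N by exact: selected_le.
    by rewrite -sM1 E ltnn.
  rewrite (@mem_set _ B); last by split.
  rewrite (@memNset _ A); last by move=> [_ []].
  rewrite addr0 mem_set//=; split => //; have [sM1|->//] := cases x.
  rewrite sM1 => E.
  by move: lM; rewrite -E ltnn.
have [iB _ _] := sat_G (cmed l z) sB.
have [iA iA' EA] := sat_G (cmed l z) sA.
have jB := sat_1 sB; have jA := sat_1 sA.
rewrite /mu BA.
under eq_Rintegral do rewrite mulrDl mulrDl.
rewrite [X in _ <= X](_ : _ = Rintegral (mun n) setT (fun x => \1_B x * \1_(box w L) x * G (cmed l z) x) +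
  Rintegral (mun n) setT (fun x => \1_A x * \1_(box w L) x * G (cmed l z) x)); last first.
  by rewrite -RintegralD//; under eq_Rintegral do rewrite mulrDl mulrDl.
rewrite RintegralD// mulrDr; apply: lerD; first exact: IH.
rewrite EA -RintegralZl//.
apply: le_Rintegral => //.
  exact: (integrableZl measurableT (2 * osc l z) jA).
move=> x _; rewrite indicE; have [xA|_] := boolP (x \in A); last by rewrite !mul0r mulr0.
rewrite !mul1r mulr1 mulrC ler_wpM2l ?indicE//.
have [xz [sM sM1]] := set_mem xA.
rewrite -(cube_median_saturated med xz) -(oscillation_saturated k b med xz).
move: sM1 => /=; rewrite sM; case: ltP => [/ltW//|_ E].
by move: lM; rewrite E ltnn.
Qed.

(** The part of the box not taken over by later selections up to level [N]. A point has a single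
    selection at level [N], so these parts are disjoint for distinct chosen boxes. *)
Let E N l z := [set y | corner l y = corner l z /\ sel N y = l].

(** Chebyshev: the integral of |b - median|^k over the box is oscillation times volume, and by
    [selected_mass] it is at least twice the oscillation times the measure of what has been left. *)
Lemma selected_half N l z : (l <= N)%N -> sel l z = l -> 0 < osc l z -> box w L z ->
  side l ^+ n / 2 <= Rintegral (mun n) setT (\1_(E N l z)) /\ 
  (mun n).-integrable setT (EFin \o (\1_(E N l z) : n.-tuple R -> R)).
Proof.
move=> lN zl o0 zQ.
have s0 := side_gt0 L0 l.
have sn : 0 < side l ^+ n by exact: exprn_gt0.
pose B := left_set N l z.
have boxE' y : box (corner l z) (side l) y <-> corner l y = corner l z by exact: corner_box.
have inQ y : corner l y = corner l z -> box w L y.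
  move=> /(corner_le L0 (leq0n l)) H; apply/(corner0 w L0).
  by rewrite H; exact/(corner0 w L0).
have sB : saturated N B.
  by move=> x y H; rewrite /B /left_set/= (corner_le L0 lN H) (sel_sat H).
have sE : saturated N (E N l z).
  by move=> x y H; rewrite /E/= (corner_le L0 lN H) (sel_sat H).
have [iB _ _] := sat_G (cmed l z) sB; have jB := sat_1 sB; have jE := sat_1 sE.
have E1 : (fun x => \1_(E N l z) x * \1_(box w L) x * 1 : R) = \1_(E N l z).
  apply/funext => x; rewrite !indicE mulr1; have [xE|_] := boolP (x \in E N l z); last by rewrite mul0r.
  by rewrite mem_set ?mulr1//; apply: inQ; case: (set_mem xE).
rewrite E1 in jE; split => //.
have H := selected_mass lN zl; rewrite -/B in H.
have H2 : Rintegral (mun n) setT (fun x => \1_B x * \1_(box w L) x * G (cmed l z) x) <= osc l z * side l ^+ n.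
  rewrite /oscillation /deviation /average divfK ?gt_eqF//.
  apply: le_Rintegral => //; first by apply: box_integrable.
  move=> x _; rewrite ler_wpM2r ?exprn_ge0// !indicE.
  have [xB|_] := boolP (x \in B); last by rewrite mul0r.
  have [xz _] := set_mem xB.
  by rewrite mem_set ?mem_set ?mulr1//; [exact/boxE'|exact: inQ].
have H3 : 2 * mu B <= side l ^+ n.
  by rewrite -(ler_pM2l o0); lra.
have ES : side l ^+ n = Rintegral (mun n) setT (\1_(E N l z)) + mu B.
  rewrite -(Rintegral_indic_box (corner l z) s0) /mu -RintegralD//.
  apply: eq_Rintegral => x _; rewrite mulr1 !indicE.
  have [xz|xz] := pselect (corner l x = corner l z); last first.
    have -> : (x \in box (corner l z) (side l)) = false by apply: memNset => /boxE'/xz.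
    have -> : (x \in E N l z) = false by apply: memNset => -[/xz].
    have -> : (x \in B) = false by apply: memNset => -[/xz].
    by rewrite mul0r addr0.
  rewrite (@mem_set _ (box w L)) ?mulr1; last exact: inQ.
  rewrite (@mem_set _ (box _ _)); last exact/boxE'.
  have [sx|sx] := pselect (sel N x = l).
    have -> : (x \in E N l z) by exact: mem_set.
    have -> : (x \in B) = false by apply: memNset => -[].
    by rewrite addr0.
  have -> : (x \in E N l z) = false by apply: memNset => -[].
  have -> : (x \in B) by exact: mem_set.
  by rewrite add0r.
lra.
Qed.

Local Notation oroot := (osc_root k b med w L).

(* Cubes with zero oscillation are dropped: [selected_mass] bounds the measure below them
   only after division by the oscillation. *)
Definition chosen N : seq (nat * n.-tuple R) :=
  sort (fun s t => (s.1 <= t.1)%N)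
    [seq s <- [seq (l, z) | l <- iota 0 N.+1, z <- corners l] |
      (sel s.1 s.2 == s.1) && (0 < osc s.1 s.2)].

Lemma chosenP N s : s \in chosen N ->
  [/\ (s.1 <= N)%N, s.2 \in corners s.1, sel s.1 s.2 = s.1 & 0 < osc s.1 s.2].
Proof.
rewrite mem_sort mem_filter => /andP[/andP[/eqP s1 s2] /allpairsPdep[l [z [lN zl E']]]].
by move: lN s1 s2; rewrite E' mem_iota /= add0n ltnS => lN s1 s2.
Qed.

Lemma chosen_uniq N : uniq (chosen N).
Proof.
rewrite sort_uniq filter_uniq//; apply: allpairs_uniq_dep; first exact: iota_uniq.
  by move=> l _; exact: corners_uniq.
by move=> [l z] [l' z'] _ _ /= [-> ->].
Qed.

(** Later boxes are not larger, which confines those meeting a given dilated cube to a fixed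
    dilation of it. *)
Lemma chosen_sorted N i j : (i <= j)%N -> (j < size (chosen N))%N ->
  ((nth (0%N, w) (chosen N) i).1 <= (nth (0%N, w) (chosen N) j).1)%N.
Proof.
move=> ij jN; apply: (sorted_leq_nth (leT := fun s t : nat * n.-tuple R => (s.1 <= t.1)%N)) => //.
- by move=> x y z; exact: leq_trans.
- by apply: sort_sorted => x y; exact: leq_total.
- by rewrite inE; exact: leq_ltn_trans jN.
Qed.

(** At each level a single box contains [x]; the boxes dropped for zero oscillation would contribute
    the root of 0. *)
Lemma chosen_sum N x : box w L x ->
  \sum_(s <- chosen N) oroot s.1 s.2 * \1_(box s.2 (side s.1)) x =
  \sum_(j < N.+1 | sel j x == j) oroot j x.
Proof.
move=> xQ; rewrite (perm_big _ (permEl (perm_sort _ _))) big_filter big_mkcond big_allpairs_dep.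
rewrite -[iota 0 N.+1]/(index_iota 0 N.+1) big_mkord [RHS]big_mkcond; apply: eq_bigr => l _.
pose f (z : n.-tuple R) : R := if (sel l z == l) && (0 < osc l z) then oroot l z else 0.
have sf : saturated l f.
  move=> y z H; rewrite /f (sel_sat H) (oscillation_saturated k b med H).
  by rewrite /osc_root (oscillation_saturated k b med H).
have Q1 : \1_(box w L) x = 1 :> R by rewrite indicE mem_set.
have H : f x = \sum_(z <- corners l) f z * \1_(box z (side l)) x.
  by rewrite -[LHS]mulr1 -[X in _ * X = _]Q1; exact: (@step_sum R n w L L0 l f x sf).
rewrite (eq_bigr (fun z => f z * \1_(box z (side l)) x)); last first.
  by move=> z _; rewrite /f /=; case: ifP => // _; rewrite mul0r.
rewrite -H /f; case: (sel l x == l) => //=; case: (ltP 0 (osc l x)) => // o0.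
rewrite /osc_root (_ : osc l x = 0) ?powR0//.
  by rewrite invr_neq0// pnatr_eq0 -lt0n.
by apply/eqP; rewrite eq_le o0 oscillation_ge0.
Qed.

Variable A : R.
Hypothesis A1 : 1 <= A.

Let zs N j := (nth (0%N, w) (chosen N) j).2.
Let ds N j := side (nth (0%N, w) (chosen N) j).1.

(** The leading 2 comes from [selected_half]. A point of a later box lies within d_j + (A + 1) d_j +
    (A + 1) d_i <= (2 A + 3) d_i of z_i in each coordinate, so the disjoint parts [E] fit into a
    cube of that half side. *)
Lemma chosen_packing N i : (i < size (chosen N))%N ->
  \sum_(i.+1 <= j < size (chosen N) | `[< cube (zs N i) ((A + 1) * ds N i) `&` cube (zs N j) ((A + 1) * ds N j) !=set0 >])
     ds N j ^+ n <= 2 * (2 * (2 * A + 3)) ^+ n * ds N i ^+ n.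
Proof.
move=> iN; pose z := zs N; pose d := ds N; rewrite -/z -/d; set Ss := chosen N in iN z d *.
pose s j := nth (0%N, w) Ss j.
have sP j : (j < size Ss)%N -> s j \in Ss by exact: mem_nth.
have d0 j : 0 < d j by exact: side_gt0.
rewrite -big_filter; set r := [seq _ <- _ | _].
have rP j : j \in r -> [/\ (i < j)%N, (j < size Ss)%N & cube (z i) ((A + 1) * d i) `&` cube (z j) ((A + 1) * d j) !=set0].
  by rewrite mem_filter mem_index_iota => /andP[/asboolP H /andP[ij jN]].
have ur : uniq r by rewrite filter_uniq// iota_uniq.
pose F j := E N (s j).1 (s j).2.
have dA : 0 < (2 * A + 3) * d i by rewrite mulr_gt0//; have := A1; lra.
have iC : (mun n).-integrable setT (EFin \o (\1_(cube (z i) ((2 * A + 3) * d i)) : n.-tuple R -> R)).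
  apply: integrable_indic_lty; first exact: measurable_cube.
  exact: (mun_cube_lty (z i) dA).
have iF j : (j < size Ss)%N -> d j ^+ n / 2 <= Rintegral (mun n) setT (\1_(F j)) /\
    (mun n).-integrable setT (EFin \o (\1_(F j) : n.-tuple R -> R)).
  move=> /sP/chosenP[h1 h2 h3 h4]; apply: selected_half => //.
  by case/(cornersP w L0): h2.
pose F' j := if (j < size Ss)%N then F j else set0.
have iF' j : (mun n).-integrable setT (EFin \o (\1_(F' j) : n.-tuple R -> R)).
  rewrite /F'; case: ifP => [/iF[]//|_].
  rewrite indic0 (_ : _ \o _ = cst 0%E); first exact: integrable0.
  by apply/funext.
have [iS ES] := Rintegral_sum r iF'.
apply: (@le_trans _ _ (2 * Rintegral (mun n) setT (fun x => \sum_(j <- r) \1_(F' j) x))).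
  rewrite ES mulr_sumr big_seq [leRHS]big_seq; apply: ler_sum => j jr.
  have [_ jN _] := rP j jr; rewrite /F' jN; have [H _] := iF j jN; lra.
rewrite -mulrA ler_wpM2l// -exprMn -mulrA -(Rintegral_cube (z i) dA).
apply: le_Rintegral => // x _; apply: sum_indic_le => //.
  move=> j jr; have [ij jN [v [vi vj]]] := rP j jr.
  rewrite /F' jN => y [yz _] l.
  have dij : d j <= d i by apply: side_le => //; exact: chosen_sorted (ltnW ij) jN.
  have /chosenP[_ /(cornersP w L0)[h2 _] _ _] := sP j jN.
  have yj : cube (z j) (d j) y by apply: box_cube; rewrite /z /zs -/Ss -/(s j) -h2; exact/(corner_box w L0).
  have Aj : (A + 1) * d j <= (A + 1) * d i by rewrite ler_wpM2l//; have := A1; lra.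
  have e1 := yj l; have e2 := vj l; have e3 := vi l; rewrite distrC in e2.
  have h3 := ler_distD (tnth (z j) l) (tnth y l) (tnth (z i) l).
  have h4 := ler_distD (tnth v l) (tnth (z j) l) (tnth (z i) l).
  lra.
move=> j j' jr j'r; have [_ jN _] := rP j jr; have [_ j'N _] := rP j' j'r.
rewrite /F' jN j'N => -[cz sj] [cz' sj'].
have /chosenP[_ /(cornersP w L0)[h2 _] _ _] := sP j jN.
have /chosenP[_ /(cornersP w L0)[h2' _] _ _] := sP j' j'N.
apply/eqP; rewrite -(nth_uniq (0%N, w) jN j'N (chosen_uniq N)) -/(s j) -/(s j').
have e1 : (s j).1 = (s j').1 by rewrite -sj -sj'.
apply/eqP; rewrite [LHS]surjective_pairing [RHS]surjective_pairing e1; congr pair.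
by rewrite -h2 -h2' -cz -cz' e1.
Qed.

Variable rr : R.
Hypothesis rr0 : 0 < rr.
Let Lam : R := 2 * (2 * (2 * A + 3)) ^+ n.
Variable C2 : R.
Hypothesis osc_sum : forall (J : nat) (z : nat -> n.-tuple R) (d : nat -> R) (U : nat -> set (n.-tuple R)),
  (forall j, 0 < d j) -> 
  (forall j, measurable (U j)) -> (forall j, U j `<=` cube (z j) (d j)) ->
  (forall i, (i < J)%N ->
    \sum_(i.+1 <= j < J | `[< cube (z i) ((A + 1) * d i) `&` cube (z j) ((A + 1) * d j) !=set0 >])
      d j ^+ n <= Lam * d i ^+ n) ->
  \sum_(j < J) (Rintegral (mun n) setT (fun y => \1_(U j) y * `|b y - med (z j) (d j)| ^+ k) / d j ^+ n) `^ rr * d j ^+ n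
  <= C2.
Variable Cc : R.
Hypothesis Cc0 : 0 <= Cc.
Hypothesis carl : forall (J : nat)
    (A : nat -> set (n.-tuple R)) (v : nat -> R),
  (forall j, measurable (A j)) -> (forall j, (j < J)%N -> mun n (A j) = (v j)%:E) ->
  (forall i, (i < J)%N ->
    \sum_(i.+1 <= j < J | `[< A i `&` A j !=set0 >]) v j <= Lam * v i) ->
  forall lam : nat -> R, (forall j, 0 <= lam j) ->
  (\int[mun n]_x ((\sum_(j < J) lam j * \1_(A j) x) `^ (k%:R * rr))%:E
   <= (Cc * \sum_(j < J) lam j `^ (k%:R * rr) * v j)%:E)%E.

(** At exponent k rr the embedding turns the k-th roots of the oscillations into their powers rr,
    whose sum [osc_sum] controls. No constant depends on [N], [w] or [L]. *)
Lemma deviation_bound N :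
  (\int[mun n]_x (\1_(box w L) x * dev N x (med w L) `^ rr)%:E <=
   (Cc * ((8 * chain_const n k) `^ (k%:R * rr) * (2 * (A + 1)) ^+ n * C2))%:E)%E.
Proof.
set Ss := chosen N; pose s j := nth (0%N, w) Ss j.
pose z j := (s j).2; pose d j := side (s j).1.
have d0 j : 0 < d j by exact: side_gt0.
have c0 : 0 <= 8 * chain_const n k :> R by rewrite mulr_ge0// powR_ge0.
have kR : k%:R != 0 :> R by rewrite pnatr_eq0 -lt0n.
have kr0 : 0 < k%:R * rr by rewrite mulr_gt0// ltr0n.
pose lam j := 8 * chain_const n k * oroot (s j).1 (s j).2.
have lam0 j : 0 <= lam j by rewrite mulr_ge0// osc_root_ge0.
have A0 : 0 < A + 1 by have := A1; lra.
have dA0 j : 0 < (A + 1) * d j by rewrite mulr_gt0.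
have pack i : (i < size Ss)%N -> \sum_(i.+1 <= j < size Ss | `[< cube (z i) ((A + 1) * d i) `&` cube (z j) ((A + 1) * d j) !=set0 >])
      d j ^+ n <= Lam * d i ^+ n by exact: chosen_packing.
have VAE x : (2 * ((A + 1) * x)) ^+ n = (2 * (A + 1)) ^+ n * x ^+ n by rewrite mulrA exprMn.
have mA j : measurable (cube (z j) ((A + 1) * d j)) by exact: measurable_cube.
have mu_cube j : (j < size Ss)%N -> mun n (cube (z j) ((A + 1) * d j)) = ((2 * ((A + 1) * d j)) ^+ n)%:E.
  by move=> _; exact: mun_cube.
have pack' i : (i < size Ss)%N -> \sum_(i.+1 <= j < size Ss | `[< cube (z i) ((A + 1) * d i) `&` cube (z j) ((A + 1) * d j) !=set0 >])
    (2 * ((A + 1) * d j)) ^+ n <= Lam * (2 * ((A + 1) * d i)) ^+ n.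
  move=> iS; rewrite VAE [leRHS]mulrCA (eq_bigr (fun j => (2 * (A + 1)) ^+ n * d j ^+ n)); last by move=> j _; rewrite VAE.
  by rewrite -mulr_sumr ler_wpM2l ?exprn_ge0 ?mulr_ge0 ?(ltW A0)//; exact: pack.
have H := carl mA mu_cube pack' lam0.
apply: (@le_trans _ _ (\int[mun n]_x ((\sum_(j < size Ss) lam j * \1_(cube (z j) ((A + 1) * d j)) x) `^ (k%:R * rr))%:E)%E).
  apply: ge0_le_integral => //.
  - by move=> x _; rewrite lee_fin mulr_ge0 ?powR_ge0// indicE.
  - apply/measurable_EFinP.
    have sf : saturated N (fun x => dev N x (med w L) `^ rr).
      by move=> x y E'; rewrite (deviation_saturated k b _ E').
    apply: eq_measurable_fun (measurable_step L0 sf) => x _; exact: mulrC.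
  - apply/measurable_EFinP; apply: (measurableT_comp (measurable_powR _)).
    apply: measurable_sum => j; apply: measurable_funM => //.
  move=> x _; rewrite lee_fin indicE; have [xQ|_] := boolP (x \in box w L); last by rewrite mul0r powR_ge0.
  have {}xQ := set_mem xQ; rewrite mul1r.
  have dc := deviation_chain med mb b_loc k0 w L0 N x.
  (* The level 0 box of any point of [box w L] is that box, so the chain starts at the fixed value
     [med w L]. *)
  rewrite /cube_median ((corner0 w L0 x).1 xQ) side0 in dc.
  set X := _ * \sum_(j < N.+1 | _) _ in dc.
  have X0 : 0 <= X by rewrite mulr_ge0// sumr_ge0// => j _; exact: osc_root_ge0.
  apply: (@le_trans _ _ ((X ^+ k) `^ rr)).
    by apply: le_powR; [exact: ltW|exact: deviation_ge0|].
  rewrite -powR_mulrn// -powRrM; apply: le_powR => //; first exact: ltW.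
  rewrite /X -chosen_sum// (big_nth (0%N, w)) big_mkord mulr_sumr.
  apply: ler_sum => j _; rewrite /lam -/(s j) mulrA ler_wpM2l ?mulr_ge0 ?powR_ge0 ?osc_root_ge0//.
  rewrite !indicE; have [xb|_] := boolP (x \in box _ _); last by rewrite ler0n.
  rewrite mem_set// => i; apply: lt_le_trans (box_cube (set_mem xb) i) _.
  by rewrite -/(d j) ler_peMl ?(ltW (d0 j))//; have := A1; lra.
apply: (le_trans H); rewrite lee_fin ler_wpM2l//.
have o0 j : 0 <= osc (s j).1 (s j).2 by exact: oscillation_ge0.
rewrite (eq_bigr (fun j : 'I_(size Ss) => (8 * chain_const n k) `^ (k%:R * rr) * (2 * (A + 1)) ^+ n *
   (osc (s j).1 (s j).2 `^ rr * d j ^+ n))); last first.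
  move=> j _; rewrite /lam powRM ?osc_root_ge0// /osc_root -powRrM mulrA mulVf// mul1r VAE.
  ring.
rewrite -mulr_sumr ler_wpM2l ?mulr_ge0 ?powR_ge0 ?exprn_ge0 ?mulr_ge0 ?(ltW A0)//.
have := osc_sum d0 (fun j => measurable_box (z j) (d j)) (fun j => @box_cube R n (z j) (d j)) pack.
apply: le_trans; apply: ler_sum => j _.
have oE : osc (s j).1 (s j).2 =
    Rintegral (mun n) setT (fun y => \1_(box (z j) (d j)) y * `|b y - med (z j) (d j)| ^+ k) / d j ^+ n.
  rewrite /oscillation /deviation /average /cube_median.
  have /chosenP[_ /(cornersP w L0)[h2 _] _ _] : s j \in Ss by exact: mem_nth.
  by rewrite h2.
by rewrite oE lexx.
Qed.

End packing.

(** * Convergence of dyadic averages *)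

(* Young's inequality gives this Lipschitz bound without differentiating the power. *)
Lemma truncated_powR_le (R : realType) (r x y t : R) : 1 < r -> 0 <= x -> 0 <= y -> 0 < t ->
  Num.min x t `^ r <= y `^ r + r * t `^ (r - 1) * `|x - y|.
Proof.
move=> r1 x0 y0 t0; set u := Num.min x t.
have r0 : 0 < r by lra.
have u0 : 0 <= u by rewrite le_min x0 ltW.
have ux : u <= x by rewrite ge_min lexx.
have ut : u <= t by rewrite ge_min lexx orbT.
have r'0 : 0 < r / (r - 1) by rewrite divr_gt0// subr_gt0.
have conj : r^-1 + (r / (r - 1))^-1 = 1 by field; apply/andP; split; lra.
have Y := conjugate_powR y0 (powR_ge0 u (r - 1)) r0 r'0 conj.
have uE : (u `^ (r - 1)) `^ (r / (r - 1)) = u `^ r.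
  by rewrite -powRrM; congr (_ `^ _); field; lra.
rewrite uE in Y.
have uu : u `^ r = u * u `^ (r - 1).
  have [->|un] := eqVneq u 0; first by rewrite powR0 ?mul0r// gt_eqF.
  by rewrite -[X in _ = X * _]powRr1// -powRD ?un ?implybT// addrC subrK.
have H1 : u `^ r <= x * u `^ (r - 1) by rewrite uu ler_wpM2r ?powR_ge0.
have H2 : (x - y) * u `^ (r - 1) <= `|x - y| * t `^ (r - 1).
  apply: (le_trans (ler_wpM2r (powR_ge0 _ _) (ler_norm _))).
  by rewrite ler_wpM2l//; apply: le_powR => //; lra.
have H3 : u `^ r / r <= y `^ r / r + `|x - y| * t `^ (r - 1).
  have -> : u `^ r / r = u `^ r - u `^ r / (r / (r - 1)) by field; apply/andP; split; lra.
  lra.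
rewrite -(ler_pM2r (_ : 0 < r^-1)) ?invr_gt0// mulrDl.
apply: (le_trans H3); rewrite lerD2l le_eqVlt; apply/orP; left; apply/eqP; field; lra.
Qed.

Section step_density.
Context {R : realType} (n : nat) (w : n.-tuple R) (L : R).
Hypothesis L0 : 0 < L.

Local Notation corner := (corner w L).
Local Notation side := (side L).
Local Notation saturated := (saturated w L).
Let Q : n.-tuple R -> R := \1_(box w L).
Let mQ : measurable_fun setT Q.
Proof. by apply: measurable_indic; exact: measurable_box. Qed.
Let Q0 x : 0 <= Q x. Proof. by rewrite /Q indicE. Qed.
Let iQ : (mun n).-integrable setT (EFin \o Q).
Proof.
apply: integrable_indic_lty; first exact: measurable_box.
by rewrite [X in (X < _)%E](mun_box w L0) ltry.
Qed.

Let step01 (f : n.-tuple R -> R) := [/\ measurable_fun setT f, forall x, 0 <= f x <= 1 & exists N, saturated N f].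

Lemma side_cvg0 : side l @[l --> \oo] --> (0 : R).
Proof.
rewrite (_ : side = fun l => L * (2^-1) ^+ l); last by apply/funext => l; rewrite exprVn.
rewrite -[X in _ --> X](mulr0 L); apply: cvgMr; apply: cvg_expr.
by rewrite ger0_norm// invf_lt1// ltr1n.
Qed.

Lemma step01_ray i (a : R) : exists2 f : nat -> n.-tuple R -> R, forall N, step01 (f N) &
  forall x, f N x @[N --> \oo] --> ((a < tnth x i)%R%:R : R).
Proof.
exists (fun N x => (a < tnth (corner N x) i)%R%:R).
  move=> N; split; last by exists N => x y ->.
    pose D := [set t : R | a < tnth w i + side N * (Num.floor ((t - tnth w i) / side N))%:~R].
    (* The rounded coordinate is nondecreasing in [t], so [D] is an interval. *)
    have mD : measurable D.
      apply: is_interval_measurable => x y /= Dx Dy z /andP[xz zy]; apply: (lt_le_trans Dx).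
      rewrite lerD2l ler_pM2l ?side_gt0// ler_int le_floor//.
      by rewrite ler_pM2r ?invr_gt0 ?side_gt0// lerB.
    rewrite (_ : (fun x => _) = \1_D \o (fun x => tnth x i)).
      by apply: measurableT_comp; [exact: measurable_indic|exact: measurable_tnth].
    apply/funext => x /=; rewrite indicE tnth_mktuple; congr (nat_of_bool _)%:R.
    by apply/idP/idP; rewrite inE.
  by move=> x; case: (_ < _); rewrite ?lexx ?ler01.
move=> x; have H N := box_corner w L0 N x i.
have [ax|xa] := ltP a (tnth x i).
  apply: cvg_near_cst; near=> N; apply/eqP.
  have /andP[_ h] := H N.
  have : side N < tnth x i - a.
    near: N; apply: (cvgr_lt 0); last by rewrite subr_gt0.
    exact: side_cvg0.
  by move=> h'; rewrite (_ : a < _)//; lra.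
apply: cvg_near_cst; near=> N; have /andP[h _] := H N.
by rewrite ltNge (le_trans h xa).
Unshelve. all: by end_near. Qed.

Lemma indic_step_dense (E : set (n.-tuple R)) : measurable E -> forall e : R, 0 < e ->
  exists2 f, step01 f & (\int[mun n]_x (Q x * `|f x - \1_E x|)%:E <= e%:E)%E.
Proof.
apply: (@tuple_density R n (mun n) Q Q0 iQ step01).
- by move=> f [].
- by move=> f [].
- by split => //; [move=> x /=; rewrite ler01 lexx|exists 0%N].
- move=> f [mf f01 [N sf]]; split; [exact: measurable_funB| |by exists N => x y /sf ->].
  by move=> x; have := f01 x; lra.
- move=> f g [mf f01 [N sf]] [mg g01 [M sg]]; split; first exact: measurable_funM.
    by move=> x; have /andP[f0 f1] := f01 x; have /andP[g0 g1] := g01 x; rewrite mulr_ge0//= mulr_ile1.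
  exists (maxn N M) => x y H; rewrite (sf x y) ?(sg x y)//.
    exact: (corner_le L0 (leq_maxr N M) H).
  exact: (corner_le L0 (leq_maxl N M) H).
- exact: step01_ray.
Qed.

Let mQn (g : n.-tuple R -> R) : measurable_fun setT g -> measurable_fun setT (fun x => (Q x * `|g x|)%:E).
Proof.
by move=> mg; apply/measurable_EFinP; apply: measurable_funM => //; exact: measurableT_comp.
Qed.

Let triangle (f g h : n.-tuple R -> R) (e1 e2 : R) : measurable_fun setT f -> measurable_fun setT g -> measurable_fun setT h ->
  (\int[mun n]_x (Q x * `|f x - g x|)%:E <= e1%:E)%E -> (\int[mun n]_x (Q x * `|g x - h x|)%:E <= e2%:E)%E ->
  (\int[mun n]_x (Q x * `|f x - h x|)%:E <= (e1 + e2)%:E)%E.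
Proof.
move=> mf mg mh H1 H2; rewrite EFinD; apply: le_trans (leeD H1 H2).
rewrite -ge0_integralD//=; try by [move=> x _; rewrite lee_fin mulr_ge0|apply: mQn; exact: measurable_funB].
apply: ge0_le_integral => //=.
- by move=> x _; rewrite lee_fin mulr_ge0.
- by apply: mQn; exact: measurable_funB.
- by apply: emeasurable_funD; apply: mQn; exact: measurable_funB.
- by move=> x _; rewrite -EFinD lee_fin -mulrDr ler_wpM2l// ler_distD.
Qed.

Lemma sum_step_dense (I : Type) (s : seq I) (c : I -> R) (E : I -> set (n.-tuple R)) (e : R) :
  (forall i, measurable (E i)) -> 0 < e -> exists N (h : n.-tuple R -> R), [/\ saturated N h, measurable_fun setT h &
  (\int[mun n]_x (Q x * `|h x - \sum_(i <- s) c i * \1_(E i) x|)%:E <= e%:E)%E].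
Proof.
move=> mE; elim: s e => [|i s IH] e e0.
  exists 0%N, (fun=> 0); split => //.
  rewrite integral0_eq ?lee_fin ?ltW// => x _.
  by rewrite big_nil subrr normr0 mulr0.
have e2 : 0 < e / 2 by lra.
have [N [h [sh mh Hh]]] := IH _ e2.
have c0 : 0 < `|c i| + 1 by rewrite ltr_wpDl.
have [f [mf f01 [M sf]] Hf] := indic_step_dense (mE i) (divr_gt0 e2 c0).
exists (maxn M N), (fun x => c i * f x + h x); split.
- move=> x y H; rewrite (sf x y) ?(sh x y)//.
    exact: (corner_le L0 (leq_maxr M N) H).
  exact: (corner_le L0 (leq_maxl M N) H).
- by apply: measurable_funD => //; exact: measurable_funM.
have mi : measurable_fun setT (fun x => c i * \1_(E i) x).
  by apply: measurable_funM => //; exact: measurable_indic.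
have ms : measurable_fun setT (fun x => \sum_(j <- s) c j * \1_(E j) x).
  by apply: measurable_sum => j; apply: measurable_funM => //; exact: measurable_indic.
under eq_integral do rewrite big_cons.
rewrite (splitr e); apply: (@triangle _ (fun x => c i * \1_(E i) x + h x)).
- by apply: measurable_funD => //; exact: measurable_funM.
- exact: measurable_funD.
- exact: measurable_funD.
- rewrite (eq_integral (fun x => (`|c i|%:E * (Q x * `|f x - \1_(E i) x|)%:E)%E)); last first.
    by move=> x _; rewrite opprD addrACA subrr addr0 -mulrBr normrM mulrCA EFinM.
  rewrite ge0_integralZl_EFin//; last 2 first.
  - by move=> x _; rewrite lee_fin mulr_ge0.
  - by apply: mQn; apply: measurable_funB => //; exact: measurable_indic.
  apply: le_trans (lee_wpmul2l _ Hf) _; first by rewrite lee_fin.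
  rewrite -EFinM lee_fin mulrCA ler_piMr ?(ltW e2)//.
  by rewrite ler_pdivrMr// mul1r lerDl.
- by under eq_integral do rewrite opprD addrACA subrr add0r.
Qed.

Import HBSimple.

Lemma step_dense (g : n.-tuple R -> R) (e : R) : measurable_fun setT g ->
  (mun n).-integrable setT (EFin \o (fun x => Q x * g x)) -> 0 < e ->
  exists N (h : n.-tuple R -> R), [/\ saturated N h, measurable_fun setT h &
  (\int[mun n]_x (Q x * `|h x - g x|)%:E <= e%:E)%E].
Proof.
move=> mg ig e0; have e2 : 0 < e / 2 by lra.
have [h [ih _ Hc]] := approximation_sfun_integrable measurableT ig.
have [M HM] : exists M, (\int[mun n]_z `|(Q z * g z)%:E - (h M z)%:E| <= (e / 2)%:E)%E.
  have /fine_cvgP[fin /cvgrPdist_le/(_ _ e2) Hd] := Hc.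
  near \oo => M; exists M.
  have fM : (\int[mun n]_z `|(Q z * g z)%:E - (h M z)%:E|)%E \is a fin_num by near: M.
  rewrite -(fineK fM) lee_fin; apply: le_trans (ler_norm _) _.
  by rewrite -normrN -sub0r; near: M.
have hE x : h M x = \sum_(y <- finmap.enum_fset (fset_set (range (h M)))) y * \1_(h M @^-1` [set y]) x.
  by rewrite fimfunE fsbig_finite.
have [N [f [sf mf Hf]]] := sum_step_dense (finmap.enum_fset (fset_set (range (h M)))) id
   (fun y => measurable_funPTI (h M) (measurable_set1 y)) e2.
exists N, f; split => //; rewrite (splitr e).
apply: (@triangle _ (h M)) => //; first by under eq_integral do rewrite hE.
apply: le_trans HM; apply: ge0_le_integral => //=.
- by move=> x _; rewrite lee_fin mulr_ge0.
- by apply: mQn; exact: measurable_funB.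
- apply/measurable_EFinP; apply: measurableT_comp => //; apply: measurable_funB => //.
  exact: measurable_funM.
- move=> x _; rewrite lee_fin /Q indicE.
  by have [_|_] := boolP (x \in _); rewrite ?mul1r 1?distrC// mul0r.
Unshelve. all: by end_near. Qed.

Section martingale.
Variable g : n.-tuple R -> R.
Hypothesis mg : measurable_fun setT g.
Hypothesis g_box : forall z d, 0 < d -> (mun n).-integrable setT (EFin \o (fun y => \1_(box z d) y * g y)).

Let integrable_step N (f : n.-tuple R -> R) : saturated N f ->
  (mun n).-integrable setT (EFin \o (fun x => f x * Q x)).
Proof.
move=> sf; have [|i _ _] := @step_integral R n w L L0 N f (fun=> 1) sf.
  move=> z; have : (mun n).-integrable setT (EFin \o (\1_(box z (side N)) : n.-tuple R -> R)).
    apply: integrable_indic_lty; first exact: measurable_box.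
    by rewrite [X in (X < _)%E](mun_box z (side_gt0 L0 N)) ltry.
  by apply: eq_integrable => // x _ /=; rewrite mulr1.
by apply: eq_integrable i => // x _ /=; rewrite mulr1.
Qed.

(** Contractivity of conditional expectation in L^1, by duality: the sign of average - h is
    saturated, so pairing it with g - h gives the same integral as pairing it with average - h. *)
Lemma average_dist N (h : n.-tuple R -> R) : saturated N h ->
  Rintegral (mun n) setT (fun x => `|average w L N g x - h x| * Q x) <=
  Rintegral (mun n) setT (fun x => `|g x - h x| * Q x).
Proof.
move=> sh; set a := average w L N g.
have sa : saturated N a by exact: average_saturated.
pose f x := Num.sg (a x - h x).
have sf : saturated N f by move=> x y H; rewrite /f (sa x y H) (sh x y H).
have sfh : saturated N (fun x => f x * h x) by move=> x y H; rewrite (sf x y H) (sh x y H).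
have [iG iA EA] := step_integral L0 sf (fun z => g_box z (side_gt0 L0 N)).
have ifh := integrable_step sfh.
have -> : Rintegral (mun n) setT (fun x => `|a x - h x| * Q x) =
    Rintegral (mun n) setT (fun x => f x * Q x * g x - f x * h x * Q x).
  rewrite RintegralB// EA -RintegralB//; apply: eq_Rintegral => x _.
  by rewrite normrEsg -/(f x) -[\1_(box w L) x]/(Q x) -[average w L N g x]/(a x); ring.
have iB := integrableB measurableT iG ifh.
have ih := integrable_step sh.
have iGQ : (mun n).-integrable setT (EFin \o (fun x => g x * Q x)).
  by apply: eq_integrable (g_box w L0) => // x _ /=; rewrite mulrC.
have iD := integrable_norm (integrableB measurableT iGQ ih).
apply: le_Rintegral => //.
  apply: eq_integrable iD => // x _ /=.
  by rewrite -mulrBl normrM (ger0_norm (Q0 x)).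
move=> x _; rewrite -/(Q x) (_ : _ - _ = f x * (g x - h x) * Q x); last by ring.
rewrite ler_wpM2r//; apply: le_trans (ler_norm _) _.
by rewrite normrM ler_piMl// /f normr_sg; case: (_ != 0).
Qed.

(** A step function [h] of some level is close to [g], and by [average_dist] the average at that
    level is as close to [h]. A single good level is enough for [averages_Lp]. *)
Lemma average_approx (e : R) : 0 < e -> exists N,
  Rintegral (mun n) setT (fun x => `|g x - average w L N g x| * Q x) <= e.
Proof.
move=> e0; have e2 : 0 < e / 2 by lra.
have [N [h [sh mh Hh]]] := step_dense mg (g_box w L0) e2.
exists N; set a := average w L N g.
have sa : saturated N a by exact: average_saturated.
have iGQ : (mun n).-integrable setT (EFin \o (fun x => g x * Q x)).
  by apply: eq_integrable (g_box w L0) => // x _ /=; rewrite mulrC.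
have norm_int (u v : n.-tuple R -> R) : (mun n).-integrable setT (EFin \o (fun x => u x * Q x)) ->
    (mun n).-integrable setT (EFin \o (fun x => v x * Q x)) ->
    (mun n).-integrable setT (EFin \o (fun x => `|u x - v x| * Q x)).
  move=> iu iv; apply: eq_integrable (integrable_norm (integrableB measurableT iu iv)) => // x _ /=.
  by rewrite -mulrBl normrM (ger0_norm (Q0 x)).
have i1 := norm_int _ _ iGQ (integrable_step sh).
have i2 := norm_int _ _ (integrable_step sa) (integrable_step sh).
have i3 := norm_int _ _ iGQ (integrable_step sa).
have h1 : Rintegral (mun n) setT (fun x => `|g x - h x| * Q x) <= e / 2.
  rewrite -lee_fin /Rintegral fineK; last exact: integrable_fin_num.
  by apply: le_trans Hh; rewrite le_eqVlt; apply/orP; left; apply/eqP;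
    apply: eq_integral => x _; rewrite distrC mulrC.
have h2 := le_trans (average_dist sh) h1; rewrite -/a in h2.
apply: (@le_trans _ _ (Rintegral (mun n) setT (fun x => `|g x - h x| * Q x + `|a x - h x| * Q x))); last first.
  by rewrite RintegralD//; lra.
apply: le_Rintegral => //; first exact: (integrableD measurableT i1 i2).
by move=> x _; rewrite -mulrDl ler_wpM2r// (distrC (a x)) ler_distD.
Qed.

(** For [g] truncated at [t], the Lipschitz factor r t^(r - 1) is fixed before the level is chosen,
    so L^1 closeness of one average carries the L^r bound over. Monotone convergence then removes
    the truncation, without any almost everywhere convergence of the averages. *)
Lemma averages_Lp (r M : R) : 1 < r -> (forall x, 0 <= g x) ->
  (forall N, \int[mun n]_x (\1_(box w L) x * average w L N g x `^ r)%:E <= M%:E)%E ->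
  (\int[mun n]_x (\1_(box w L) x * g x `^ r)%:E <= M%:E)%E.
Proof.
move=> r1 g0 H; have r0 : 0 < r by lra.
have a0 N x : 0 <= average w L N g x.
  apply: divr_ge0; last by rewrite exprn_ge0// ltW// side_gt0.
  by apply: Rintegral_ge0 => y _; rewrite mulr_ge0// indicE.
have mpow (u : n.-tuple R -> R) : measurable_fun setT u -> measurable_fun setT (fun x => (Q x * u x `^ r)%:E).
  move=> mu; apply/measurable_EFinP; apply: measurable_funM => //.
  exact: (measurableT_comp (measurable_powR r)).
have mmin (t : R) : measurable_fun setT (fun x => Num.min (g x) t).
  exact: measurable_minr.
have trunc t : 0 < t -> (\int[mun n]_x (Q x * Num.min (g x) t `^ r)%:E <= M%:E)%E.
  move=> t0; apply/lee_addgt0Pr => e e0.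
  have rt : 0 < r * t `^ (r - 1) by rewrite mulr_gt0// powR_gt0.
  have [N HN] := average_approx (divr_gt0 e0 rt).
  set a := average w L N g in HN.
  have sa : saturated N a by exact: average_saturated.
  have sar : saturated N (fun x => a x `^ r) by move=> x y E; rewrite (sa x y E).
  have mar : measurable_fun setT (fun x => (Q x * a x `^ r)%:E).
    apply/measurable_EFinP.
    by apply: eq_measurable_fun (measurable_step L0 sar) => x _; exact: mulrC.
  have iGQ : (mun n).-integrable setT (EFin \o (fun x => g x * Q x)).
    by apply: eq_integrable (g_box w L0) => // x _ /=; rewrite mulrC.
  have id : (mun n).-integrable setT (EFin \o (fun x => `|g x - a x| * Q x)).
    apply: eq_integrable (integrable_norm (integrableB measurableT iGQ (integrable_step sa))) => // x _ /=.
    by rewrite -mulrBl normrM (ger0_norm (Q0 x)).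
  have ird := integrableZl measurableT (r * t `^ (r - 1)) id.
  have md := measurable_int _ ird.
  apply: (@le_trans _ _ (\int[mun n]_x ((Q x * a x `^ r)%:E + (r * t `^ (r - 1))%:E * (`|g x - a x| * Q x)%:E))%E).
    apply: ge0_le_integral => //=.
    - by move=> x _; rewrite lee_fin mulr_ge0// powR_ge0.
    - exact: mpow.
    - exact: emeasurable_funD.
    - move=> x _; rewrite -EFinM -EFinD lee_fin mulrA [X in _ + X]mulrC -mulrDr ler_wpM2l//.
      by apply: truncated_powR_le => //; exact: a0.
  rewrite ge0_integralD//=; last 2 first.
  - by move=> x _; rewrite lee_fin mulr_ge0// powR_ge0.
  - by move=> x _; rewrite -EFinM lee_fin mulr_ge0 ?(ltW rt)// mulr_ge0.
  apply: leeD; first exact: H.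
  rewrite ge0_integralZl_EFin//=; last 3 first.
  - by move=> x _; rewrite lee_fin mulr_ge0.
  - exact: measurable_int id.
  - exact: ltW.
  have -> : (\int[mun n]_x (`|g x - a x| * Q x)%:E)%E = (Rintegral (mun n) setT (fun x => `|g x - a x| * Q x))%:E.
    by rewrite /Rintegral fineK//; exact: integrable_fin_num.
  by rewrite -EFinM lee_fin mulrC -ler_pdivlMr.
have mono x (s t : nat) : (s <= t)%N -> ((Q x * Num.min (g x) s%:R `^ r)%:E <= (Q x * Num.min (g x) t%:R `^ r)%:E)%E.
  move=> st; rewrite lee_fin ler_wpM2l//; apply: le_powR; first exact: ltW.
    by rewrite le_min g0 ler0n.
  by rewrite le_min ge_min lexx/= ge_min ler_nat st orbT.
have HC := @cvg_monotone_convergence _ _ R (mun n) setT measurableT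
  (fun t x => (Q x * Num.min (g x) t%:R `^ r)%:E) (fun t => mpow _ (mmin t%:R))
  (fun t x _ => mulr_ge0 (Q0 x) (powR_ge0 _ _)) (fun x _ s t => mono x s t).
have lim x : limn (fun t : nat => (Q x * Num.min (g x) t%:R `^ r)%:E) = (Q x * g x `^ r)%:E.
  apply/cvg_lim => //; apply: cvg_near_cst; near=> t; congr (_ * _ `^ _)%:E.
  apply/min_idPl; near: t; exact: nbhs_infty_ger.
have <- : (\int[mun n]_x limn (fun t : nat => (Q x * Num.min (g x) t%:R `^ r)%:E))%E =
   (\int[mun n]_x (\1_(box w L) x * g x `^ r)%:E)%E by apply: eq_integral => x _; exact: lim.
have <- := cvg_lim _ HC => //.
apply: lime_le; first by apply/cvg_ex; eexists; exact: HC.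
near=> t; apply: trunc; rewrite ltr0n; near: t; exact: nbhs_infty_gt.
Unshelve. all: by end_near. Qed.

End martingale.

End step_density.

(** * Exhaustion by cubes *)

Section exhaustion.
Context {R : realType} (n : nat) (b : n.-tuple R -> R) (s C : R) (a : n.-tuple R -> R -> R).
Hypothesis mb : measurable_fun setT b.
Hypothesis s0 : 0 < s.
Hypothesis C0 : 0 <= C.
Hypothesis bound : forall z l, 0 < l ->
  (\int[mun n]_x (\1_(box z l) x * `|b x - a z l| `^ s)%:E <= C%:E)%E.

Lemma normD_powR (x y : R) : `|x + y| `^ s <= 2 `^ s * (`|x| `^ s + `|y| `^ s).
Proof.
have s2 : 0 <= 2 `^ s :> R by exact: powR_ge0.
have [xy|/ltW yx] := leP `|x| `|y|.
  apply: (@le_trans _ _ (2 `^ s * `|y| `^ s)); last by rewrite ler_wpM2l// lerDr powR_ge0.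
  rewrite -powRM//; apply: le_powR => //; first exact: ltW.
  by apply: (le_trans (ler_normD _ _)); lra.
apply: (@le_trans _ _ (2 `^ s * `|x| `^ s)); last by rewrite ler_wpM2l// lerDl powR_ge0.
rewrite -powRM//; apply: le_powR => //; first exact: ltW.
by apply: (le_trans (ler_normD _ _)); lra.
Qed.

Let z M : n.-tuple R := [tuple - 2 ^+ M | _ < n].
Let Lb M : R := 2 ^+ M.+1.
Let Q M := box (z M) (Lb M).
Let Lb0 M : 0 < Lb M. Proof. by rewrite exprn_gt0. Qed.
Let al M := a (z M) (Lb M).
Let vol M := Lb M ^+ n.
Let vol0 M : 0 < vol M. Proof. by rewrite exprn_gt0. Qed.

Let Q_le M N : (M <= N)%N -> Q M `<=` Q N.
Proof.
move=> MN x xM i; have := xM i; rewrite /z /Lb !tnth_mktuple.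
have : 2 ^+ M <= 2 ^+ N :> R by rewrite ler_weXn2l// ler1n.
by rewrite !exprS; lra.
Qed.

Let mQ M : measurable_fun setT (\1_(Q M) : n.-tuple R -> R).
Proof. by apply: measurable_indic; exact: measurable_box. Qed.

Let mpow (c : R) : measurable_fun setT (fun x => `|b x - c| `^ s).
Proof.
apply: (measurableT_comp (measurable_powR s)).
by apply: measurableT_comp => //; exact: measurable_funB.
Qed.

Let indic_ge0 M x : 0 <= \1_(Q M) x :> R. Proof. by rewrite indicE. Qed.

Let int_indic M : (\int[mun n]_x (\1_(Q M) x)%:E)%E = (vol M)%:E.
Proof.
rewrite integral_indic//; last exact: measurable_box.
by rewrite setIT [LHS](mun_box (z M) (Lb0 M)).
Qed.

(** Both values approximate [b] on the smaller box, so their distance to the power [s] is at most a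
    constant divided by its volume. *)
Let al_dist M N : (M <= N)%N -> `|al M - al N| `^ s * vol M <= 2 `^ s * (C + C).
Proof.
move=> MN.
have s2 : 0 <= 2 `^ s :> R by exact: powR_ge0.
have mf c M' : measurable_fun setT (fun x => (\1_(Q M') x * `|b x - c| `^ s)%:E).
  by apply/measurable_EFinP; exact: measurable_funM.
have f0 c M' x : (0 <= (\1_(Q M') x * `|b x - c| `^ s)%:E)%E by rewrite lee_fin mulr_ge0 ?powR_ge0.
have -> : `|al M - al N| `^ s * vol M = fine (\int[mun n]_x (\1_(Q M) x * `|al M - al N| `^ s)%:E)%E.
  under eq_integral do rewrite mulrC EFinM.
  rewrite ge0_integralZl_EFin ?powR_ge0//; last exact/measurable_EFinP.
  by rewrite int_indic.
have : (\int[mun n]_x (\1_(Q M) x * `|al M - al N| `^ s)%:E <= (2 `^ s * (C + C))%:E)%E.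
  apply: (@le_trans _ _ (\int[mun n]_x ((2 `^ s)%:E * ((\1_(Q M) x * `|b x - al M| `^ s)%:E + (\1_(Q N) x * `|b x - al N| `^ s)%:E)))%E).
    apply: ge0_le_integral => //.
    - by apply/measurable_EFinP; exact: measurable_funM.
    - by apply: measurable_funeM; exact: emeasurable_funD.
    - move=> x _; rewrite -EFinD -EFinM lee_fin !indicE.
      have [xM|_] := boolP (x \in Q M); last by rewrite !mul0r add0r !mulr_ge0 ?powR_ge0.
      rewrite mem_set ?mul1r; last by apply: (Q_le MN); exact: set_mem.
      have := normD_powR (al M - b x) (b x - al N).
      by rewrite addrA subrK (distrC (al M) (b x)).
  rewrite ge0_integralZl_EFin//; last 2 first.
  - by move=> x _; exact: adde_ge0.
  - exact: emeasurable_funD.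
  rewrite ge0_integralD// EFinM; apply: lee_wpmul2l; first by rewrite lee_fin.
  by rewrite EFinD; apply: leeD; exact: bound.
move=> H; rewrite -lee_fin fineK//; rewrite ge0_fin_numE; last first.
  by apply: integral_ge0 => x _; rewrite lee_fin mulr_ge0 ?powR_ge0.
exact: le_lt_trans H (ltry _).
Qed.

Let D := 2 `^ s * (C + C).
Let D0 : 0 <= D. Proof. by rewrite mulr_ge0 ?powR_ge0// addr_ge0. Qed.
Let e M := (D / vol M) `^ s^-1.

Let al_close M N : (M <= N)%N -> `|al M - al N| <= e M.
Proof.
move=> MN; rewrite /e -[leLHS](powRr1 (normr_ge0 _)) -(mulfV (lt0r_neq0 s0)) powRrM.
apply: le_powR; [by rewrite invr_ge0 ltW|exact: powR_ge0|].
by rewrite ler_pdivlMr//; exact: al_dist.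
Qed.

Let e0 M : 0 <= e M. Proof. exact: powR_ge0. Qed.

(* The intervals of center [al M] and radius [e M] meet pairwise, hence all contain the
   supremum of their left end points. *)
Let common_value : exists c, forall M, `|al M - c| <= e M.
Proof.
pose Lo := [set al M - e M | M in setT].
have lohi M N : al M - e M <= al N + e N.
  have [MN|/ltnW NM] := leqP M N.
    have := al_close MN; rewrite ler_distl; have := e0 N; lra.
  have := al_close NM; rewrite ler_distl; have := e0 M; lra.
have ubLo N : ubound Lo (al N + e N) by move=> _ [M _ <-].
have supLo : has_sup Lo by split; [exists (al 0%N - e 0%N), 0%N|exists (al 0%N + e 0%N)].
exists (sup Lo) => M; rewrite ler_distl; apply/andP; split.
  have := ge_sup supLo.1 (ubLo M); lra.
have : al M - e M <= sup Lo by apply: ub_le_sup; [exact: supLo.2|exists M].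
lra.
Qed.

(** Replacing [al M] by the common value on [Q M] costs (e M)^s times the volume of [Q M], which is
    [D] for every [M]; the bound therefore survives the monotone limit. *)
Lemma exhaustion : exists c, (\int[mun n]_x (`|b x - c| `^ s)%:E <= (2 `^ s * (C + D))%:E)%E.
Proof.
have [c Hc] := common_value; exists c.
have s2 : 0 <= 2 `^ s :> R by exact: powR_ge0.
have mf c' M' : measurable_fun setT (fun x => (\1_(Q M') x * `|b x - c'| `^ s)%:E).
  by apply/measurable_EFinP; exact: measurable_funM.
have f0 c' M' x : (0 <= (\1_(Q M') x * `|b x - c'| `^ s)%:E)%E by rewrite lee_fin mulr_ge0 ?powR_ge0.
have loc M : (\int[mun n]_x (\1_(Q M) x * `|b x - c| `^ s)%:E <= (2 `^ s * (C + D))%:E)%E.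
  apply: (@le_trans _ _ (\int[mun n]_x ((2 `^ s)%:E * ((\1_(Q M) x * `|b x - al M| `^ s)%:E + (D / vol M * \1_(Q M) x)%:E)))%E).
    apply: ge0_le_integral => //.
    - apply: measurable_funeM; apply: emeasurable_funD => //.
      by apply/measurable_EFinP; exact: measurable_funM.
    - move=> x _; rewrite -EFinD -EFinM lee_fin !indicE.
      have [xM|_] := boolP (x \in Q M); last by rewrite !mul0r mulr0 addr0 mulr0.
      rewrite !mul1r mulr1.
      have := normD_powR (b x - al M) (al M - c); rewrite addrA subrK => /le_trans; apply.
      rewrite ler_wpM2l// lerD2l.
      have <- : e M `^ s = D / vol M by rewrite /e powR_root// divr_ge0// ltW.
      by apply: le_powR => //; exact: ltW.
  rewrite ge0_integralZl_EFin//; last 2 first.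
  - by move=> x _; apply: adde_ge0 => //; rewrite lee_fin mulr_ge0// divr_ge0// ltW.
  - by apply: emeasurable_funD => //; apply/measurable_EFinP; exact: measurable_funM.
  rewrite ge0_integralD//; last 2 first.
  - by move=> x _; rewrite lee_fin mulr_ge0// divr_ge0// ltW.
  - by apply/measurable_EFinP; exact: measurable_funM.
  rewrite EFinM; apply: lee_wpmul2l; first by rewrite lee_fin.
  rewrite EFinD; apply: leeD; first exact: bound.
  under eq_integral do rewrite EFinM.
  rewrite ge0_integralZl_EFin//; last 2 first.
  - exact/measurable_EFinP.
  - by rewrite divr_ge0// ltW.
  by rewrite int_indic -EFinM divfK// gt_eqF.
have mono x (M N : nat) : (M <= N)%N -> ((\1_(Q M) x * `|b x - c| `^ s)%:E <= (\1_(Q N) x * `|b x - c| `^ s)%:E)%E.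
  move=> MN; rewrite lee_fin ler_wpM2r ?powR_ge0// !indicE.
  have [xM|_] := boolP (x \in Q M); last by rewrite ler0n.
  by rewrite mem_set//; apply: (Q_le MN); exact: set_mem.
have HC := @cvg_monotone_convergence _ _ R (mun n) setT measurableT
  (fun M x => (\1_(Q M) x * `|b x - c| `^ s)%:E) (fun M => mf c M)
  (fun M x _ => f0 c M x) (fun x _ M N => mono x M N).
have lim x : limn (fun M : nat => (\1_(Q M) x * `|b x - c| `^ s)%:E) = (`|b x - c| `^ s)%:E.
  apply/cvg_lim => //; apply: cvg_near_cst.
  pose B := \sum_(i < n) `|tnth x i|.
  have xB i : `|tnth x i| <= B by rewrite /B (bigD1 i)//= lerDl sumr_ge0.
  near=> M; rewrite indicE mem_set ?mul1r// => i.
  have : B < 2 ^+ M.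
    apply: (@lt_le_trans _ _ M%:R); first by near: M; exact: nbhs_infty_gtr.
    by rewrite -natrX ler_nat ltnW// ltn_expl.
  have := xB i; rewrite ler_norml /z /Lb !tnth_mktuple exprS; lra.
rewrite (eq_integral (fun x => limn (fun M : nat => (\1_(Q M) x * `|b x - c| `^ s)%:E))); last first.
  by move=> x _; rewrite lim.
have <- := cvg_lim _ HC => //.
apply: lime_le; first by apply/cvg_ex; eexists; exact: HC.
by near=> M; exact: loc.
Unshelve. all: by end_near. Qed.

End exhaustion.

(** * From uniform bounds on boxes to the homogeneous space *)

Lemma dotL_of_bound (R : realType) (n : nat) (b : @vec R n -> R) (s C c : R) : measurable_fun setT b -> 0 < s ->
  (\int[mun n]_x (`|b x - c| `^ s)%:E <= C%:E)%E -> dotL s b.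
Proof.
move=> mb s0 H; exists c.
have mbc : measurable_fun setT (fun x => b x - c) by exact: measurable_funB.
have cm : cmeas (fun x : @vec R n => toC (b x - c)) by split => //; exact: measurable_cst.
split => //; apply: le_lt_trans (ltry (C `^ s^-1)).
apply: (lnorm_le s0 cm (G := fun x => `|b x - c|)) => //.
- exact: measurableT_comp.
- by move=> x; rewrite cabs_toC.
Qed.

Theorem theorem3p6 (R : realType) (n m : nat) (p q : R) (ps : 'I_m -> R) (k : nat)
    (T : op m n) (K : vec n -> ktuple m n -> R[i]) (w : R -> R) (b : vec n -> R) :
  (2 <= m)%N ->
  1 < q -> q < p ->
  (forall i, 1 < ps i) ->
  p^-1 = \sum_(i < m) (ps i)^-1 ->
  (0 < k)%N ->
  nondegenerate_CZO T K w ->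
  kernel_repr_ext T K ->
  Lloc k%:R b ->
  (exists Cb : R, forall f : 'I_m -> vec n -> R[i],
      (forall i, Ccinf (f i)) ->
      inLp q%:E (commutator k T b f) /\
      (lnorm q%:E (commutator k T b f) <= Cb%:E * \prod_(i < m) lnorm (ps i)%:E (f i))%E) ->
  dotL (k%:R * (q^-1 - p^-1)^-1) b.
Proof.
move=> m2 q1 qp ps1 pE k0 [[T_multi [_ [[[w_homo [_ [w_ge0 _]]] [C0 [K_size0 K_smooth0]]] _]]] [w_cvg0 [c0 c0_gt0 K_nondeg]]] T_repr bL [Cb0 T_bdd0].
have m0 : (0 < m)%N by exact: ltnW.
(* In dimension 0 all norms vanish, so nondegeneracy could not provide a point at distance 1. *)
have n0 : (0 < n)%N.
  case: n T K b T_multi K_size0 K_smooth0 K_nondeg T_repr bL T_bdd0 => // T' K' b' _ _ _ K_nondeg' _ _ _.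
  have [x [H _]] := K_nondeg' [tuple] 1 ltr01; move: H.
  by rewrite /vnorm big_ord0 sqrtr0 ler10.
have mn0 : (0 < m * n)%N by rewrite muln_gt0 m0.
(* The constants in the hypotheses carry no sign; raising them to at least 0 preserves the bounds
   and permits multiplication by them. *)
pose C := Num.max C0 0; pose Cb := Num.max Cb0 0.
have CC : 0 <= C by rewrite le_max lexx orbT.
have Cb_ge0 : 0 <= Cb by rewrite le_max lexx orbT.
have ss0 (x : vec n) (y : ktuple m n) : 0 <= ssum x y by apply: sumr_ge0 => i _; exact: vnorm_ge0.
have K_size x y : offdiag x y -> cabs (K x y) <= C / ssum x y ^+ (m * n).
  move=> /K_size0/le_trans; apply; rewrite ler_wpM2r ?invr_ge0 ?exprn_ge0 ?ss0//.
  by rewrite le_max lexx.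
have K_smooth x y (h : vec n) : offdiag x y -> vnorm h <= smax x y / 2 ->
     cabs (K (vadd x h) y - K x y) + \sum_(i < m) cabs (K x (yshift y i h) - K x y)
       <= C / ssum x y ^+ (m * n) * w (vnorm h / ssum x y).
  move=> o hs; apply: (le_trans (K_smooth0 x y h o hs)).
  have sm : smax x y <= ssum x y.
    apply: bigmax_le => [|i _]; first exact: ss0.
    rewrite /ssum (bigD1 i)//= lerDl.
    by apply: sumr_ge0 => j _; exact: vnorm_ge0.
  (* At 0 both right-hand sides are 0, since inversion sends 0 to 0 and the exponent is positive. *)
  have [s0|s0] := eqVneq (ssum x y) 0.
    by rewrite s0 expr0n gtn_eqF//= invr0 !mulr0 !mul0r.
  have sp : 0 < ssum x y by rewrite lt_neqAle eq_sym s0 ss0.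
  apply: ler_wpM2r; last by rewrite ler_wpM2r ?invr_ge0 ?exprn_ge0 ?ss0// le_max lexx.
  apply: w_ge0; first by rewrite divr_ge0 ?vnorm_ge0 ?ss0.
  by rewrite ltr_pdivrMr// mul1r; apply: (le_lt_trans hs); lra.
have lnorm_ge0 r (f : vec n -> R[i]) : (0 <= lnorm r%:E f)%E by exact: poweR_ge0.
have T_bdd (f : 'I_m -> vec n -> R[i]) : (forall i, Ccinf (f i)) ->
      inLp q%:E (commutator k T b f) /\
      (lnorm q%:E (commutator k T b f) <= Cb%:E * \prod_(i < m) lnorm (ps i)%:E (f i))%E.
  move=> /T_bdd0[h1 h2]; split => //; apply: (le_trans h2).
  apply: lee_wpmul2r; first by apply: prode_ge0 => i _; exact: lnorm_ge0.
  by rewrite lee_fin le_max lexx.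
have [mb _] := bL.
have b_loc := Lloc_weight bL.
have [A [c [S [A1 c_gt0 S0 Href]]]] := reference_cube mn0 CC w_homo w_ge0 w_cvg0 K_size K_smooth c0_gt0 K_nondeg.
have mReK := fun x => @measurable_ReK R m n K w C CC w_homo w_ge0 w_cvg0 K_smooth x.
have mImK := fun x => @measurable_ImK R m n K w C CC w_homo w_ge0 w_cvg0 K_smooth x.
(* One choice over pairs supplies the medians for all centres and sizes; nonpositive sizes receive
   the default 0. *)
have medP (zd : n.-tuple R * R) : exists a, 0 < zd.2 -> is_reference_median K b A c S zd.1 zd.2 a.
  have [d0|d0] := ltP 0 zd.2; last by exists 0.
  have [z' [t zt]] := Href zd.1 zd.2 d0.
  by have [a Ha] := reference_median mb d0 zt; exists a.
have [med0 Hmed] := choice medP.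
pose med z d := med0 (z, d).
(* The constant of [chosen_packing]; the dilation scales both sides of the packing inequality alike,
   so it also serves for dilated volumes. *)
pose Lam : R := 2 * (2 * (2 * A + 3)) ^+ n.
have Lam0 : 0 < Lam by rewrite mulr_gt0// exprn_gt0// mulr_gt0//; lra.
have p0 : 0 < p by apply: lt_trans qp; exact: lt_trans q1.
pose rr := (q^-1 - p^-1)^-1.
have V : 0 < q^-1 - p^-1 by rewrite subr_gt0 ltf_pV2 ?posrE// (lt_trans _ q1).
have rr1 : 1 < rr.
  rewrite invf_gt1//; have : q^-1 < 1 by rewrite invf_lt1// (lt_trans _ q1).
  by have : 0 < p^-1 by [rewrite invr_gt0]; lra.
have rr0 : 0 < rr by lra.
have [C2 C20 HC2] := oscillation_sum q1 qp ps1 pE T_multi K_size CC mReK mImK T_repr mb b_loc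
  (erefl : nat_of_ord (Ordinal m0) = 0%N) Cb_ge0 T_bdd A1 c_gt0 S0 Lam0.
have krr0 : 0 < k%:R * rr by rewrite mulr_gt0// ltr0n.
have [Cc Cc0 HCc] := carleson_Lp krr0 Lam0.
pose Cf := Cc * ((8 * chain_const n k) `^ (k%:R * rr) * (2 * (A + 1)) ^+ n * C2).
have Cf0 : 0 <= Cf.
  by rewrite mulr_ge0 ?(ltW Cc0)// !mulr_ge0 ?powR_ge0// exprn_ge0// mulr_ge0//; lra.
have bound z l : 0 < l -> (\int[mun n]_x (\1_(box z l) x * `|b x - med z l| `^ (k%:R * rr))%:E <= Cf%:E)%E.
  (* The averages concern the k-th power of |b - median| and are bounded in L^rr; this gives the
     exponent k rr. *)
  move=> l0; pose g x := `|b x - med z l| ^+ k.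
  have mg : measurable_fun setT g.
    by apply: measurable_funX; apply: measurableT_comp => //; exact: measurable_funB.
  rewrite (eq_integral (fun x => (\1_(box z l) x * g x `^ rr)%:E)); last first.
    by move=> x _; rewrite /g -powR_mulrn// -powRrM.
  apply: (averages_Lp l0 mg (fun z' d d0 => box_integrable mb b_loc z' (med z l) d0) rr1).
    by move=> x; exact: exprn_ge0.
  move=> N; apply: (deviation_bound mb b_loc k0 z l0 A1 rr0 _ (ltW Cc0)).
  - move=> J z' d U d0 mU Uc pack; apply: (HC2 J z' d (fun j => med (z' j) (d j)) U d0 _ mU Uc pack) => j.
    exact: (Hmed (z' j, d j) (d0 j)).
  - by move=> J A' v; exact: HCc.
have [c' Hc'] := exhaustion mb krr0 Cf0 bound.
exact: dotL_of_bound mb krr0 Hc'.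
Qed.
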